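(* Let $n\ge1$ and $\alpha\in(0,2)$. The Markov semigroup $(P_t^{LOU})_{t\ge0}$ on $\mathbb R^n$ with generator $\mathcal I^\alpha-x\cdot\nabla$ satisfies the hypercontractive bound $$\|f\|_{L^{q_1}(K^\alpha_{1/\alpha})}\le\|P_t^{LOU}f\|_{L^{q_2}(K^\alpha_{1/\alpha})}$$ for all positive functions $f$, all $t\ge0$ and all $0<q_2\le q_1<1$ such that $$q_2-1=\frac{q_2}{q_1}\,(q_1-1)\,e^{\alpha t}.$$
   Context: For $t>0$, $K_t^\alpha$ is the density of the rotationally invariant $\alpha$-stable law on $\mathbb R^n$ with characteristic function $e^{-t|\xi|^\alpha}$, i.e. $K_t^\alpha(x)=\frac1{(2\pi)^{n/2}}\mathcal F(e^{-t|\cdot|^\alpha})(x)$ with $\mathcal F(g)(x)=\frac1{(2\pi)^{n/2}}\int e^{-iu\cdot x}g(u)\,du$. The $\alpha$-stable Lévy semigroup is $L_t^\alpha f=K_t^\alpha\star f$, and $\mathcal I^\alpha$ is its generator (the fractional Laplacian $-(-\Delta)^{\alpha/2}$). The Lévy-Ornstein-Uhlenbeck semigroup $(P_t^{LOU})_{t\ge0}$ with generator $\mathcal I^\alpha-x\cdot\nabla$ is given by $P_t^{LOU}f(x)=\big(L^\alpha_{(1-e^{-\alpha t})/\alpha}f\big)(e^{-t}x)$. $L^q(K^\alpha_{1/\alpha})$ refers to the probability measure $K^\alpha_{1/\alpha}(x)\,dx$, and $\|f\|_{L^q(K^\alpha_{1/\alpha})}=\big(\int|f|^qK^\alpha_{1/\alpha}dx\big)^{1/q}$,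 also for $q\in(0,1)$. *)

(* Defs.v *)
From HB Require Import structures.
From mathcomp Require Import all_boot all_order all_algebra.
From mathcomp Require Import all_classical all_reals all_analysis.
From mathcomp Require Import complex.

Set Implicit Arguments.
Unset Strict Implicit.
Unset Printing Implicit Defensive.

Import Order.TTheory GRing.Theory Num.Theory.
Import numFieldNormedType.Exports.

Local Open Scope classical_set_scope.
Local Open Scope ring_scope.
Local Open Scope ereal_scope.

Section tuple_cons.
Context {R : realType} {n : nat}.

Definition tuple_cons (z : measurableTypeR R * n.-tuple R) : n.+1.-tuple R :=
  [tuple of z.1 :: z.2].

Lemma measurable_tuple_cons : measurable_fun setT tuple_cons.
Proof. exact: (measurable_cons measurable_fst measurable_snd). Qed.

HB.instance Definition _ :=
  isMeasurableFun.Build _ _ _ _ tuple_cons measurable_tuple_cons.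

End tuple_cons.

(* R^n is n.-tuple R with the product (Borel) sigma-algebra; its Lebesgue
   measure is the n-fold product of lebesgue_measure, built one coordinate at a
   time along R * R^n ~ R^(n+1). *)
Section lebesgue_cons.
Context {R : realType} {n : nat}.
Variable mu : {sigma_finite_measure set (n.-tuple R) -> \bar R}.

Definition lebesgue_cons : set (n.+1.-tuple R) -> \bar R :=
  pushforward (lebesgue_measure \x mu) tuple_cons.

Let lebesgue_cons0 : lebesgue_cons set0 = 0.
Proof. exact: measure0. Qed.

Let lebesgue_cons_ge0 A : 0 <= lebesgue_cons A.
Proof. exact: measure_ge0. Qed.

Let lebesgue_cons_sigma_additive : semi_sigma_additive lebesgue_cons.
Proof. exact: measure_semi_sigma_additive. Qed.

HB.instance Definition _ := isMeasure.Build _ _ _ lebesgue_cons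
  lebesgue_cons0 lebesgue_cons_ge0 lebesgue_cons_sigma_additive.

Let sigma_finite_lebesgue_cons : sigma_finite setT lebesgue_cons.
Proof.
have /sigma_finiteP[F [FT ndF Foo]] := sigma_finiteT (@lebesgue_measure R).
have /sigma_finiteP[G [GT ndG Goo]] := sigma_finiteT mu.
exists (fun k => [set x | F k (thead x) /\ G k [tuple of behead x]]).
  apply/esym/seteqP; split => // x _.
  have [i _ Fi] : (\bigcup_i F i) (thead x) by rewrite -FT.
  have [j _ Gj] : (\bigcup_j G j) [tuple of behead x] by rewrite -GT.
  exists (maxn i j) => //; split.
    by move: (thead x) Fi; exact/subsetPset/ndF/leq_maxl.
  by move: ([tuple of behead x]) Gj; exact/subsetPset/ndG/leq_maxr.
move=> k; have [mF Fk] := Foo k; have [mG Gk] := Goo k; split.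
  rewrite (_ : [set x | _] = ((fun x => tnth x ord0) @^-1` F k) `&`
    ((fun x : n.+1.-tuple R => [tuple of behead x]) @^-1` G k)) //.
  apply: measurableI; rewrite -[X in measurable X]setTI.
    exact: (measurable_tnth ord0).
  exact: measurable_behead.
rewrite /lebesgue_cons /pushforward (_ : _ @^-1` _ = F k `*` G k).
  by rewrite product_measure1E// lte_mul_pinfty// ge0_fin_numE.
have beheadK a t : [tuple of behead (tuple_cons (a, t))] = t by exact/val_inj.
by apply/seteqP; split => -[a t] /=; rewrite theadE beheadK.
Qed.

HB.instance Definition _ := Measure_isSigmaFinite.Build _ _ _
  lebesgue_cons sigma_finite_lebesgue_cons.
End lebesgue_cons.

Fixpoint lebesgue_tuple {R : realType} (n : nat) :
    {sigma_finite_measure set (n.-tuple R) -> \bar R} :=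
  if n is n'.+1 then lebesgue_cons (lebesgue_tuple n') else \d_[tuple].

Section euclidean.
Context {R : realType} {n : nat}.
Implicit Types x y : n.-tuple R.
Local Open Scope ring_scope.

Definition dotp x y : R := \sum_(i < n) tnth x i * tnth y i.

Definition enorm x : R := Num.sqrt (dotp x x).

Definition scalet (a : R) x : n.-tuple R := [tuple a * tnth x i | i < n].

Definition subt x y : n.-tuple R := [tuple tnth x i - tnth y i | i < n].
End euclidean.

Section fourier.
Context {R : realType} {n : nat}.
Local Open Scope ring_scope.

Definition expi (theta : R) : R[i] := (cos theta +i* sin theta)%C.

Definition cintegral (g : n.-tuple R -> R[i]) : R[i] :=
  ((\int[lebesgue_tuple n]_u complex.Re (g u))
   +i* (\int[lebesgue_tuple n]_u complex.Im (g u)))%C.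

Definition fourier_const : R := (2 * pi) `^ (- (n%:R / 2)).

Definition fourier (g : n.-tuple R -> R[i]) (x : n.-tuple R) : R[i] :=
  (fourier_const%:C)%C * cintegral (fun u => expi (- dotp u x) * g u).
End fourier.
Arguments fourier_const R n : clear implicits.

Section stable.
Context {R : realType} {n : nat}.
Variable alpha : R.

(* The Fourier transform of the even real function exp(-t|u|^alpha) is real, so
   nothing is lost in taking its real part. *)
Definition stable_density (t : R) (x : n.-tuple R) : R :=
  (fourier_const R n * complex.Re (fourier
    (fun u : n.-tuple R => (expR (- t * enorm u `^ alpha))%:C%C) x))%R.

(* Functions on R^n take values in \bar R, as an integral of a positive function
   may be +oo. At t = 0 the stable law is the Dirac mass at the origin, which
   has no density, and the operator is the identity. *)
Definition levy_semigroup (t : R) (f : n.-tuple R -> \bar R) (x : n.-tuple R) :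
    \bar R :=
  if t == 0%R then f x
  else \int[lebesgue_tuple n]_y ((stable_density t (subt x y))%:E * f y).

Definition LOU_semigroup (t : R) (f : n.-tuple R -> \bar R) (x : n.-tuple R) :
    \bar R :=
  levy_semigroup ((1 - expR (- (alpha * t))) / alpha)%R f (scalet (expR (- t)) x).

Definition Lq_stable (q : R) (f : n.-tuple R -> \bar R) : \bar R :=
  (\int[lebesgue_tuple n]_x
     (`|f x| `^ q * (stable_density alpha^-1 x)%:E)) `^ q^-1.
End stable.

(* Main.v *)
From HB Require Import structures.
Require Import Defs.
From mathcomp Require Import all_boot all_order all_algebra.
From mathcomp Require Import all_classical all_reals all_analysis.
From mathcomp Require Import measurable_realfun complex zify ring lra.

Import Order.TTheory GRing.Theory Num.Theory.
Import numFieldNormedType.Exports.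

Set Implicit Arguments.
Unset Strict Implicit.
Unset Printing Implicit Defensive.

Local Open Scope classical_set_scope.
Local Open Scope ring_scope.

(** The proof rests on the convolution semigroup of the stable laws.  Write
[T_t] for averaging against the stable law at time [t], so that
[T_s T_r = T_(s+r)].  By self-similarity [exp(-t) X] has law [K_r] with
[r = exp(- alpha t) / alpha] when [X] has law [K_A], [A = 1 / alpha], and the
claim becomes, with [s = A - r],
  [T_A (f^q1)^(1/q1) <= T_r ((T_s f)^q2)^(1/q2)] at the origin, where
  [(1 - q2) q1 r = q2 (1 - q1) A].

When [r / A = k / m] is rational this is an inequality about [m] independent
increments of law [T_(A/m)] with sum [S].  Put [H = T_s f] and let [a_j],
[j < m], be the sum of the increments in the [j]-th cyclic window of length [k].
Since the exponents of [H] cancel,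
  [f(S)^q1 = prod_j (f(S) H(a_j)^(q2-1))^w1 (H(a_j)^q2)^w2],
with [w1 = q1 / m], [w2 = (1 - q1) / k].  A given increment occurs in the [m]
factors of the first kind and in [k] of those of the second kind, hence with
total weight [m w1 + k w2 = 1]: integrating the increments one by one, each
time with the Hoelder inequality, bounds [E f(S)^q1] by the product of the
means raised to the same weights (Finner's inequality).  All these means are
equal to [E H(a_j)^q2], because the expectation of [f(S)] given [a_j] is
[H(a_j)], and their weights add up to [m (w1 + w2) = q1 / q2]; this is
[discrete_reverse_hypercontractivity].  An arbitrary ratio is approximated by
rationals from above, Jensen's inequality paying for the excess time
([bounded_reverse_hypercontractivity]), and an arbitrary positive [f] by
truncations bounded away from [0] and infinity
([reverse_hypercontractivity]).

What remains is that the [K_t], defined by Fourier inversion, really are the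
densities of a convolution semigroup of probability measures. The crux is
[K_t >= 0]. The functions obtained from cosines by sums, nonnegative scalars
and bounded pointwise limits are closed under products, and
[exp(- t |u|^alpha)] is one of them: [1 - cos] yields [|u|^2] as a limit, and
[x^b], [0 < b < 1], is reached through the binomial series
[(1 - x)^b = 1 - sum_k c_k x^(k+1)], whose [c_k] are nonnegative
([posdef_stable]). Tested against [exp(- del |u_1| - ... - del |u_n|)] times a
cosine, such a function has a nonnegative integral, since the Fourier
transform of this kernel is a product of Cauchy kernels. Letting [del] tend to
[0] gives positivity, and the same kernels prove Fourier inversion
([invft_cos]), from which total mass and the semigroup law follow. *)

(** * Averages of bounded positive functions *)

Section averaging.
Context d {E : measurableType d} {R : realType} (mu : probability E R).

(** Bounded away from 0 and infinity: a class stable under powers with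
exponents of either sign, on which logarithms of means are finite. *)
Definition bounded_pos d' (X : measurableType d') (g : X -> R) :=
  measurable_fun setT g /\
  exists c C : R, 0 < c /\ forall x, c <= g x <= C.

Lemma bounded_pos_measurable d' (X : measurableType d') (g : X -> R) :
  bounded_pos g -> measurable_fun setT g.
Proof. by case. Qed.

Lemma bounded_pos_gt0 d' (X : measurableType d') (g : X -> R) x :
  bounded_pos g -> 0 < g x.
Proof. by move=> [_ [c [C [c0 /(_ x)/andP[cg _]]]]]; exact: lt_le_trans cg. Qed.

Lemma bounded_pos_comp d1 d2 (X : measurableType d1) (Y : measurableType d2)
  (h : X -> Y) (g : Y -> R) :
  measurable_fun setT h -> bounded_pos g -> bounded_pos (g \o h).
Proof.
move=> mh [mg [c [C [c0 gC]]]]; split; first exact: measurableT_comp.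
by exists c, C; split => // x; exact: gC.
Qed.

Lemma bounded_posM d' (X : measurableType d') (f g : X -> R) :
  bounded_pos f -> bounded_pos g -> bounded_pos (fun x => f x * g x).
Proof.
move=> [mf [c [C [c0 fC]]]] [mg [k [K [k0 gK]]]]; split.
  exact: measurable_funM.
exists (c * k), (C * K); split; first exact: mulr_gt0.
move=> x; have /andP[cf fC'] := fC x; have /andP[kg gK'] := gK x.
rewrite !ler_pM// ?ltW//; first exact: lt_le_trans cf.
exact: lt_le_trans kg.
Qed.

Lemma bounded_pos_powR d' (X : measurableType d') (f : X -> R) (p : R) :
  bounded_pos f -> bounded_pos (fun x => f x `^ p).
Proof.
move=> [mf [c [C [c0 fC]]]]; split.
  exact: (measurableT_comp (measurable_powR p)).
have f0 x : 0 < f x by have /andP[+ _] := fC x; exact: lt_le_trans.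
have lepow (a b r : R) : 0 < a -> a <= b -> 0 <= r -> a `^ r <= b `^ r.
  move=> a0 ab r0; apply: ge0_ler_powR => //; rewrite nnegrE ltW//.
  exact: lt_le_trans ab.
pose C' := Num.max c C; have C'0 : 0 < C' by rewrite lt_max c0.
have fC' x : f x <= C' by have /andP[_ h] := fC x; rewrite le_max h orbT.
have cf x : c <= f x by have /andP[] := fC x.
have [p0|p0] := leP 0 p.
  exists (c `^ p), (C' `^ p); split; first exact: powR_gt0.
  by move=> x; apply/andP; split; apply: lepow.
exists (C' `^ p), (c `^ p); split; first exact: powR_gt0.
move=> x; have p0' : 0 <= - p by rewrite oppr_ge0 ltW.
have pN : p = - - p by rewrite opprK.
by rewrite pN !(powRN _ (- p)) !lef_pV2 ?posrE ?powR_gt0//; apply/andP; split; apply: lepow.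
Qed.

Lemma bounded_pos_cst d' (X : measurableType d') (c : R) :
  0 < c -> bounded_pos (fun _ : X => c).
Proof. by move=> c0; split => //; exists c, c; split => // x; rewrite lexx. Qed.

Lemma bounded_pos_integrable d' (X : measurableType d') (P : probability X R)
  (g : X -> R) : bounded_pos g -> P.-integrable setT (EFin \o g).
Proof.
move=> [mg [c [C [c0 gC]]]].
apply: (@le_integrable _ _ _ P _ measurableT _ (EFin \o cst C)) => //.
- exact/measurable_EFinP.
- move=> x _ /=; rewrite lee_fin; have /andP[cg gC'] := gC x.
  have g0 : 0 <= g x by apply: le_trans cg; exact: ltW.
  by rewrite !ger0_norm// (le_trans g0).
- exact: finite_measure_integrable_cst.
Qed.

Lemma Rintegral_probability_bounds d' (X : measurableType d')
  (P : probability X R) (g : X -> R) (c C : R) : bounded_pos g ->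
  (forall x, c <= g x <= C) -> c <= \int[P]_x g x <= C.
Proof.
move=> bg gC.
have cstE (k : R) : \int[P]_(x in setT) (cst k x) = k.
  transitivity (k * fine (P setT)); first exact: Rintegral_cst.
  by rewrite probability_setT mulr1.
have ik (k : R) : P.-integrable setT (EFin \o (cst k : X -> R)).
  exact: finite_measure_integrable_cst.
have ig := bounded_pos_integrable P bg.
apply/andP; split.
  rewrite -[leLHS](cstE c); apply: le_Rintegral => //.
  by move=> x _; have /andP[] := gC x.
rewrite -[leRHS](cstE C); apply: le_Rintegral => //.
by move=> x _; have /andP[] := gC x.
Qed.

Lemma Rintegral_bounded_pos_gt0 d' (X : measurableType d')
  (P : probability X R) (g : X -> R) : bounded_pos g -> 0 < \int[P]_x g x.
Proof.
move=> bg; have [_ [c [C [c0 gC]]]] := bg.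
by have /andP[+ _] := Rintegral_probability_bounds P bg gC; exact: lt_le_trans.
Qed.

Lemma EFin_Rintegral_bounded_pos d' (X : measurableType d')
  (P : probability X R) (g : X -> R) : bounded_pos g ->
  ((\int[P]_x g x)%:E = \int[P]_x (g x)%:E)%E.
Proof.
move=> bg; rewrite /Rintegral fineK//.
exact: (integrable_fin_num measurableT (bounded_pos_integrable P bg)).
Qed.

Section averaging_operator.
Context d' {X : measurableType d'}.

(** The law [mu] is averaged along an abstract map [act] so that the same
operator serves on [E] and on [E * E]. *)
Definition avg (act : X -> E -> X) (g : X -> R) (z : X) : R :=
  \int[mu]_y g (act z y).

Definition measurable_act (act : X -> E -> X) :=
  measurable_fun setT (fun zy : X * E => act zy.1 zy.2).

Lemma bounded_pos_act act g z : measurable_act act -> bounded_pos g ->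
  bounded_pos (fun y => g (act z y)).
Proof.
move=> mact; apply: bounded_pos_comp.
exact: (measurableT_comp mact (measurable_pair1 z)).
Qed.

Lemma bounded_pos_avg act g : measurable_act act ->
  bounded_pos g -> bounded_pos (avg act g).
Proof.
move=> mact bg; have [mg [c [C [c0 gC]]]] := bg; split; last first.
  exists c, C; split => // x.
  by apply: Rintegral_probability_bounds => //; exact: (bounded_pos_act _ mact bg).
apply: (@measurableT_comp _ _ _ _ _ _ fine) => //.
apply: (measurable_fun_fubini_tonelli_F (fun zy => (g (act zy.1 zy.2))%:E)).
  by apply/measurable_EFinP; exact: (measurableT_comp mg).
by move=> z /=; rewrite lee_fin ltW// (bounded_pos_gt0 _ bg).
Qed.

(** Tonelli's theorem, as the two shifts commute pointwise. *)
Lemma avg_commute act1 act2 g z : measurable_act act1 -> measurable_act act2 ->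
  (forall z x y, act1 (act2 z y) x = act2 (act1 z x) y) -> bounded_pos g ->
  avg act1 (avg act2 g) z = avg act2 (avg act1 g) z.
Proof.
move=> m1 m2 C12 bg.
have bgE h w : measurable_act h ->
    (\int[mu]_x (g (h w x)))%:E = (\int[mu]_x (g (h w x))%:E)%E.
  by move=> mh; exact: EFin_Rintegral_bounded_pos (bounded_pos_act _ mh bg).
rewrite /avg; congr fine.
under eq_integral do rewrite bgE//.
under [RHS]eq_integral do rewrite bgE//.
rewrite (fubini_tonelli (fun xy => (g (act2 (act1 z xy.1) xy.2))%:E)) /=.
- by apply: eq_integral => y _; apply: eq_integral => x _; rewrite C12.
- apply/measurable_EFinP; apply: measurableT_comp; first by case: bg.
  have m1z := measurableT_comp m1 (measurable_pair1 z).
  apply: (measurableT_comp m2 (measurable_fun_pair _ measurable_snd)).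
  exact: (measurableT_comp m1z measurable_fst).
- by move=> xy; rewrite lee_fin ltW// (bounded_pos_gt0 _ bg).
Qed.

Lemma bounded_pos_iter act g k : measurable_act act -> bounded_pos g ->
  bounded_pos (iter k (avg act) g).
Proof. by move=> mact bg; elim: k => //= k IH; exact: bounded_pos_avg. Qed.

Lemma avg_iter_commute act1 act2 g k z : measurable_act act1 ->
  measurable_act act2 ->
  (forall z x y, act1 (act2 z y) x = act2 (act1 z x) y) -> bounded_pos g ->
  avg act2 (iter k (avg act1) g) z = iter k (avg act1) (avg act2 g) z.
Proof.
move=> m1 m2 C12 bg; elim: k z => //= k IH z.
rewrite -avg_commute//; last exact: bounded_pos_iter.
by apply: eq_Rintegral => y _; exact: IH.
Qed.

End averaging_operator.
End averaging.

(** * Finner's inequality on cyclic windows *)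

Section jensen.
Context {R : realType}.

(** Jensen's inequality for the exponential, from its tangent at the weighted
mean. *)
Lemma expR_sum_le (I : finType) (D : pred I) (w y : I -> R) :
  (forall i, 0 <= w i) -> \sum_(i | D i) w i = 1 ->
  expR (\sum_(i | D i) w i * y i) <= \sum_(i | D i) w i * expR (y i).
Proof.
move=> w0 w1; set m := \sum_(i | D i) w i * y i.
(* the linear terms of the tangent at [m] average to 0 *)
have -> : expR m = expR m * \sum_(i | D i) w i * (1 + (y i - m)).
  under eq_bigr do rewrite mulrDr mulr1 mulrBr.
  by rewrite big_split/= sumrB -mulr_suml w1 mul1r -/m subrr addr0 mulr1.
rewrite mulr_sumr; apply: ler_sum => i _.
rewrite mulrCA ler_wpM2l// -[X in _ <= expR X](subrK m) expRD mulrC.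
by rewrite ler_wpM2r ?expR_ge0 ?expR_ge1Dx.
Qed.

(** The Hoelder inequality for several functions, in logarithmic form: weights
need only sum to 1 over the indices [D] of the functions that do vary, because
a constant function equals its own mean. After division by the means it
reduces to the weighted arithmetic-geometric inequality, integrated. *)
Lemma ln_Rintegral_le d (X : measurableType d) (P : probability X R)
  (I : finType) (D : pred I) (w : I -> R) (phi : X -> R) (g : I -> X -> R) :
  bounded_pos phi -> (forall i, bounded_pos (g i)) ->
  (forall i, 0 <= w i) -> \sum_(i | D i) w i = 1 ->
  (forall i, ~~ D i -> forall x y, g i x = g i y) ->
  (forall x, ln (phi x) <= \sum_i w i * ln (g i x)) ->
  ln (\int[P]_x phi x) <= \sum_i w i * ln (\int[P]_x g i x).
Proof.
move=> bphi bg w0 w1 gD phig.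
pose G i := \int[P]_x g i x; pose L := \sum_i w i * ln (G i).
have G0 i : 0 < G i by exact: Rintegral_bounded_pos_gt0.
have GD i x : ~~ D i -> g i x = G i.
  move=> /gD gi; apply/eqP; rewrite eq_le.
  by apply: Rintegral_probability_bounds => // y; rewrite (gi y x) lexx.
(* [expR L] is the weighted product of the means; the right-hand side has mean
   [expR L] *)
have phi_le x : phi x <= \sum_(i | D i) expR L * w i / G i * g i x.
  have phi0 : 0 < phi x by exact: bounded_pos_gt0.
  rewrite -[leLHS]lnK ?posrE// -[X in expR X](subrK L) expRD mulrC.
  under eq_bigr do rewrite -mulrA -mulrA; rewrite -mulr_sumr.
  rewrite ler_wpM2l ?expR_ge0//.
  apply: (@le_trans _ _ (expR (\sum_(i | D i) w i * ln (g i x / G i)))).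
    rewrite ler_expR lerBlDr (le_trans (phig x))// /L.
    rewrite (bigID D) [X in _ <= _ + X](bigID D) /= addrA lerD//; last first.
      by apply: ler_sum => i /GD ->.
    rewrite -big_split/=; apply: ler_sum => i _.
    by rewrite -mulrDr ln_div ?posrE ?subrK// bounded_pos_gt0.
  apply: le_trans (expR_sum_le _ w0 w1) _; apply: ler_sum => i _.
  rewrite lnK; first by rewrite (mulrC (g i x)).
  by rewrite posrE divr_gt0//; exact: bounded_pos_gt0.
have iphi := bounded_pos_integrable P bphi.
have ig i : P.-integrable setT (EFin \o g i) by exact: bounded_pos_integrable.
have : ((\int[P]_x phi x)%:E <= (expR L)%:E)%E.
  rewrite (EFin_Rintegral_bounded_pos P bphi).
  have ih i : P.-integrable setT (fun x => (expR L * w i / G i)%:E * (g i x)%:E)%E.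
    exact: (integrableZl measurableT _ (ig i)).
  apply: (@le_trans _ _ (\int[P]_x
     (\sum_(i | D i) (expR L * w i / G i)%:E * (g i x)%:E))%E).
    apply: le_integral => //; first exact: integrable_sum.
    move=> x _; under eq_bigr do rewrite -EFinM; rewrite sumEFin lee_fin.
    exact: phi_le.
  rewrite integral_sum//.
  under eq_bigr.
    move=> i _; rewrite (integralZl measurableT (ig i)).
    have -> : (\int[P]_x (g i x)%:E = (G i)%:E)%E.
      by rewrite -(EFin_Rintegral_bounded_pos P (bg i)).
    rewrite -EFinM divfK ?gt_eqF//; over.
  by rewrite sumEFin -mulr_sumr w1 mulr1.
by rewrite lee_fin -[X in _ -> _ <= X](expRK L) ler_ln// posrE ?expR_gt0 ?Rintegral_bounded_pos_gt0.
Qed.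

End jensen.

Section finner.
Context d {E : measurableType d} {R : realType} (mu : probability E R).
Variable add : E -> E -> E.
Hypothesis madd : measurable_act add.
Hypothesis addC : forall x y, add x y = add y x.
Hypothesis addA : forall x y z, add x (add y z) = add (add x y) z.

Local Notation T := (avg mu add).

(** Points of [E * E] are pairs (total sum, sum over a window). An increment
of the window shifts both coordinates, any other one only the total sum. *)
Definition shift_both (z : E * E) (x : E) := (add z.1 x, add z.2 x).
Definition shift_fst (z : E * E) (x : E) := (add z.1 x, z.2).

Lemma measurable_shift_both : measurable_act shift_both.
Proof.
apply: measurable_fun_pair.
  apply: (measurableT_comp madd (measurable_fun_pair _ measurable_snd)).
  exact: measurableT_comp.
apply: (measurableT_comp madd (measurable_fun_pair _ measurable_snd)).
exact: measurableT_comp.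
Qed.

Lemma measurable_shift_fst : measurable_act shift_fst.
Proof.
apply: measurable_fun_pair.
  apply: (measurableT_comp madd (measurable_fun_pair _ measurable_snd)).
  exact: measurableT_comp.
exact: measurableT_comp.
Qed.

Lemma shift_commute z x y :
  shift_both (shift_fst z y) x = shift_fst (shift_both z x) y.
Proof. by rewrite /shift_both /shift_fst /= -!addA (addC x). Qed.

Section chain.
Context {J : finType} (A : nat -> J -> bool) (w1 w2 : R).
Variables (F : E * E -> R) (G : E -> R).
Hypotheses (bF : bounded_pos F) (bG : bounded_pos G).

(** The factor [F], resp. [G], of index [j] after the first [l] increments
have been averaged out; [A i j] tells whether increment [i] lies in window
[j]. *)
Fixpoint avg_fst (l : nat) (j : J) : E * E -> R :=
  if l is l'.+1 then
    avg mu (if A l' j then shift_both else shift_fst) (avg_fst l' j)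
  else F.

Fixpoint avg_snd (l : nat) (j : J) : E -> R :=
  if l is l'.+1 then
    if A l' j then T (avg_snd l' j) else avg_snd l' j
  else G.

Let act_meas l j : measurable_act (if A l j then shift_both else shift_fst).
Proof.
by case: ifP => _; [exact: measurable_shift_both|exact: measurable_shift_fst].
Qed.

Lemma bounded_pos_avg_fst l j : bounded_pos (avg_fst l j).
Proof. by elim: l => //= l IH; apply: bounded_pos_avg. Qed.

Lemma bounded_pos_avg_snd l j : bounded_pos (avg_snd l j).
Proof. by elim: l => //= l IH; case: ifP => // _; exact: bounded_pos_avg. Qed.

(** Induction on the number of increments already integrated: the Hoelder
inequality applies to the next one, since only the factors that depend on it
have to carry the total weight 1. *)
Lemma finner_chain (phi : E -> R) : bounded_pos phi -> 0 <= w1 -> 0 <= w2 ->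
  (forall l, \sum_(j : J) w1 + \sum_(j | A l j) w2 = 1) ->
  (forall S (a : J -> E), ln (phi S) <=
    \sum_j w1 * ln (F (S, a j)) + \sum_j w2 * ln (G (a j))) ->
  forall l S (a : J -> E), ln (iter l T phi S) <=
    \sum_j w1 * ln (avg_fst l j (S, a j)) + \sum_j w2 * ln (avg_snd l j (a j)).
Proof.
move=> bphi w10 w20 w12 phiFG; elim => [|l IH] S a; first exact: phiFG.
(* increment [l], of value [x], enters the windows that contain it *)
pose a' x j := if A l j then add (a j) x else a j.
pose g (i : J + J) x := match i with
  | inl j => avg_fst l j (add S x, a' x j)
  | inr j => avg_snd l j (a' x j) end.
pose w (i : J + J) := if i is inl _ then w1 else w2.
pose D (i : J + J) := if i is inr j then A l j else true.
have gfstE j x : g (inl j) x =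
    avg_fst l j ((if A l j then shift_both else shift_fst) (S, a j) x).
  by rewrite /g /a'; case: ifP.
have -> : \sum_j w1 * ln (avg_fst l.+1 j (S, a j)) +
    \sum_j w2 * ln (avg_snd l.+1 j (a j)) =
    \sum_i w i * ln (\int[mu]_x g i x).
  rewrite big_sumType/=; congr (_ + _); apply: eq_bigr => j _.
    by congr (_ * ln _); apply: eq_Rintegral => x _; rewrite -gfstE.
  congr (_ * ln _); rewrite /a'; case: ifP => // _.
  have bc := bounded_pos_avg_snd l j.
  apply/eqP; rewrite eq_le; apply: Rintegral_probability_bounds.
    by apply: bounded_pos_cst; exact: bounded_pos_gt0.
  by move=> y; rewrite lexx.
rewrite iterS; apply: (@ln_Rintegral_le _ _ _ _ _ D w _ g).
- exact: (bounded_pos_act _ madd (bounded_pos_iter mu _ madd bphi)).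
- move=> [j|j].
    have -> : g (inl j) = (fun x => avg_fst l j
        ((if A l j then shift_both else shift_fst) (S, a j) x)).
      by apply/funext => x; exact: gfstE.
    exact: (bounded_pos_act _ (act_meas l j) (bounded_pos_avg_fst l j)).
  rewrite /g /a' /=; case: (A l j).
    exact: (bounded_pos_act _ madd (bounded_pos_avg_snd l j)).
  by apply: bounded_pos_cst; apply: bounded_pos_gt0; exact: bounded_pos_avg_snd.
- by case.
- by rewrite big_sumType/= w12.
- by move=> [//|j] /= /negbTE Alj x y; rewrite /a' Alj.
- move=> x; rewrite big_sumType/=; exact: IH.
Qed.

(** As the two kinds of shift commute, only their numbers matter. *)
Lemma avg_fstE l j z : avg_fst l j z =
  iter (\sum_(i < l) A i j)%N (avg mu shift_both)
    (iter (\sum_(i < l) ~~ A i j)%N (avg mu shift_fst) F) z.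
Proof.
have mb := measurable_shift_both; have mf := measurable_shift_fst.
elim: l z => [|l IH] z; first by rewrite !big_ord0.
rewrite !big_ord_recr/=; case: ifP => Alj /=; rewrite addn1 addn0 /=.
  by apply: eq_Rintegral => x _; exact: IH.
rewrite -(avg_iter_commute _ _ _ mb mf shift_commute); last exact: bounded_pos_iter.
by apply: eq_Rintegral => x _; exact: IH.
Qed.

Lemma avg_sndE l j x : avg_snd l j x = iter (\sum_(i < l) A i j)%N T G x.
Proof.
elim: l x => [|l IH] x; first by rewrite big_ord0.
rewrite big_ord_recr/=; case: ifP => _; rewrite ?addn0 ?addn1//.
by apply: eq_Rintegral => y _; exact: IH.
Qed.

End chain.

(** Increments outside the window act on [f] alone, with [h] as a constant. *)
Lemma iter_shift_fst (f h : E -> R) k z : bounded_pos f ->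
  iter k (avg mu shift_fst) (fun z => f z.1 * h z.2) z = iter k T f z.1 * h z.2.
Proof.
move=> bf; elim: k z => //= k IH z.
transitivity (\int[mu]_x (iter k T f (add z.1 x) * h z.2)).
  by apply: eq_Rintegral => x _; rewrite IH.
rewrite RintegralZr//; apply: bounded_pos_integrable.
exact: (bounded_pos_act _ madd (bounded_pos_iter mu _ madd bf)).
Qed.

(** The diagonal is stable under the increments of the window. *)
Lemma iter_shift_both (g : E * E -> R) k s :
  iter k (avg mu shift_both) g (s, s) = iter k T (fun s => g (s, s)) s.
Proof.
elim: k s => //= k IH s.
by apply: eq_Rintegral => x _; rewrite IH.
Qed.

Section cyclic_windows.
Variables (M k : nat).
Hypothesis kM : (k <= M.+1)%N.

(** The subtraction is that of the cyclic group on ['I_M.+1], so that the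
window starts at [j] and wraps around. *)
Definition window (i : nat) (j : 'I_M.+1) : bool :=
  (((inord i : 'I_M.+1) - j)%R < k)%N.

Let sum_ltk : (\sum_(l < M.+1) (l < k) = k)%N.
Proof.
rewrite -big_mkcond/= -(big_ord_widen _ (fun=> 1%N) kM).
by rewrite sum1_card card_ord.
Qed.

(** For a fixed increment, [j |-> i - j] is a bijection of the cyclic
group. *)
Lemma card_window_row i : (\sum_j window i j = k)%N.
Proof.
rewrite -[RHS]sum_ltk [RHS](reindex_inj (h := fun j => inord i - j))//.
by move=> j j' /addrI/oppr_inj.
Qed.

Lemma card_window_col j : (\sum_(i < M.+1) window i j = k)%N.
Proof.
rewrite -[RHS]sum_ltk [RHS](reindex_inj (h := fun i => i - j))/=; last exact: addIr.
by apply: eq_bigr => i _; rewrite /window inord_val.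
Qed.

End cyclic_windows.

(** The case of a rational time ratio [k / M.+1]: Finner's inequality for the
cyclic windows of length [k] among [M.+1] increments, with weights chosen so
that the powers of [H] cancel. *)
Lemma discrete_reverse_hypercontractivity (M k : nat) (q1 q2 : R) (f : E -> R) S :
  (0 < k <= M.+1)%N -> 0 < q1 < 1 -> 0 < q2 ->
  k%:R * (1 - q2) * q1 = M.+1%:R * q2 * (1 - q1) -> bounded_pos f ->
  ln (iter M.+1 T (fun x => f x `^ q1) S) <=
  q1 / q2 * ln (iter k T (fun x => iter (M.+1 - k) T f x `^ q2) S).
Proof.
move=> /andP[k0 kM] /andP[q10 q11] q20 hq bf.
pose H := iter (M.+1 - k) T f.
have bH : bounded_pos H by exact: bounded_pos_iter.
pose F (z : E * E) := f z.1 * (H z.2 `^ (q2 - 1)).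
pose G x := H x `^ q2.
have bF : bounded_pos F.
  apply: bounded_posM; first exact: (bounded_pos_comp measurable_fst).
  exact: (bounded_pos_comp measurable_snd (bounded_pos_powR _ bH)).
have bG : bounded_pos G by exact: bounded_pos_powR.
pose w1 : R := q1 / M.+1%:R; pose w2 : R := (1 - q1) / k%:R.
have k0' : 0 < k%:R :> R by rewrite ltr0n.
have M0 : 0 < M.+1%:R :> R by rewrite ltr0n.
have w10 : 0 <= w1 by rewrite divr_ge0 ?ltW.
have w20 : 0 <= w2 by rewrite divr_ge0 ?subr_ge0 ?ltW.
have w1E : M.+1%:R * w1 = q1 by rewrite /w1 mulrCA divff ?mulr1 ?gt_eqF.
have w2E : k%:R * w2 = 1 - q1 by rewrite /w2 mulrCA divff ?mulr1 ?gt_eqF.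
have hw l : \sum_(j : 'I_M.+1) w1 + \sum_(j : 'I_M.+1 | window k l j) w2 = 1.
  rewrite [X in _ + X]big_mkcond/= sumr_const card_ord.
  rewrite (eq_bigr (fun j => w2 *+ window k l j)); last first.
    by move=> j _; case: (window k l j); rewrite ?mulr1n ?mulr0n.
  rewrite sumrMnr (card_window_row kM).
  by rewrite -mulr_natl w1E -mulr_natl w2E addrC subrK.
(* this cancellation is the relation between the exponents and [k / M.+1] *)
have cancel : w1 * (q2 - 1) + w2 * q2 = 0.
  apply: (mulfI (x := M.+1%:R * k%:R)); first by rewrite mulf_neq0 ?gt_eqF.
  transitivity (k%:R * (M.+1%:R * w1) * (q2 - 1) + M.+1%:R * (k%:R * w2) * q2).
    by ring.
  by rewrite w1E w2E mulr0; lra.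
have start S' (a : 'I_M.+1 -> E) : ln (f S' `^ q1) <=
    \sum_j w1 * ln (F (S', a j)) + \sum_j w2 * ln (G (a j)).
  rewrite -big_split/= (eq_bigr (fun=> w1 * ln (f S'))); last first.
    move=> j _; rewrite /F /G lnM ?posrE ?powR_gt0 ?bounded_pos_gt0// !ln_powR.
    transitivity (w1 * ln (f S') + (w1 * (q2 - 1) + w2 * q2) * ln (H (a j))).
      by ring.
    by rewrite cancel mul0r addr0.
  by rewrite sumr_const card_ord -mulr_natl mulrA w1E ln_powR.
have := finner_chain bF bG (bounded_pos_powR _ bf) w10 w20 hw start M.+1 S (fun=> S).
move/le_trans; apply.
set L := ln (iter k T _ S).
have colN (j : 'I_M.+1) : (\sum_(i < M.+1) ~~ window k i j = M.+1 - k)%N.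
  have : (\sum_(i < M.+1) (window k i j + ~~ window k i j) = M.+1)%N.
    rewrite (eq_bigr (fun=> 1%N)) ?sum1_card ?card_ord// => i _.
    by case: window.
  by rewrite big_split/= (card_window_col kM); lia.
rewrite (eq_bigr (fun=> w1 * L)); last first.
  move=> j _; congr (_ * ln _); rewrite avg_fstE// (card_window_col kM) colN.
  rewrite iter_shift_both; congr (iter _ _ _ _); apply/funext => s.
  rewrite (@iter_shift_fst f (fun a => H a `^ (q2 - 1)) _ (s, s) bf)/= -/H.
  by rewrite mulr_powRB1// ltW// bounded_pos_gt0.
rewrite [X in _ + X](eq_bigr (fun=> w2 * L)); last first.
  by move=> j _; congr (_ * ln _); rewrite avg_sndE (card_window_col kM).
have -> : \sum_(j : 'I_M.+1) w1 * L = q1 * L.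
  by rewrite sumr_const card_ord -mulr_natl mulrA w1E.
have -> : \sum_(j : 'I_M.+1) w2 * L = M.+1%:R * w2 * L.
  by rewrite sumr_const card_ord -[LHS]mulr_natl mulrA.
rewrite -mulrDl.
have -> // : q1 + M.+1%:R * w2 = q1 / q2.
rewrite /w2; apply: (mulIf (x := q2 * k%:R)); first by rewrite mulf_neq0 ?gt_eqF.
transitivity (q1 * q2 * k%:R + M.+1%:R * q2 * (1 - q1)).
  by field; rewrite gt_eqF.
by rewrite -hq; field; rewrite gt_eqF.
Qed.

End finner.

(** * The binomial series of a fractional power *)

Section fractional_power.
Context {R : realType}.
Variable b : R.
Hypothesis b01 : 0 < b < 1.

(** The coefficients of the series of [1 - (1 - x)^b], indexed from [x^1]. *)
Fixpoint frac_coeff (k : nat) : R :=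
  if k is k'.+1 then frac_coeff k' * (k'.+1%:R - b) / k'.+2%:R else b.

Definition frac_poly (N : nat) (x : R) : R :=
  \sum_(k < N) frac_coeff k * x ^+ k.+1.

Lemma frac_coeff_ge0 k : 0 <= frac_coeff k.
Proof.
have /andP[b0 b1] := b01; elim: k => [|k IH] /=; first exact: ltW.
rewrite divr_ge0 ?ler0n// mulr_ge0// subr_ge0.
by rewrite (le_trans (ltW b1))// ler1n.
Qed.

(** The sequence [k.+1 * frac_coeff k] decreases from its first value [b]. *)
Lemma frac_coeff_le k : k.+1%:R * frac_coeff k <= b.
Proof.
have /andP[b0 b1] := b01; elim: k => [|k IH]; first by rewrite mul1r.
apply: le_trans IH => /=; rewrite mulrC divfK ?pnatr_eq0// mulrC.
by rewrite ler_wpM2r ?frac_coeff_ge0// lerBlDr lerDl ltW.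
Qed.

Let dfrac_poly N (x : R) : R := \sum_(k < N) frac_coeff k * k.+1%:R * x ^+ k.

Lemma is_derive_frac_poly (N : nat) (x : R) : is_derive x 1 (frac_poly N) (dfrac_poly N x).
Proof.
rewrite /dfrac_poly.
have monomial (c : R) k :
    is_derive x 1 (fun y : R => c * y ^+ k.+1) (c * k.+1%:R * x ^+ k).
  have h := @is_deriveX R R^o id k.+1 x 1 1 (is_derive_id _ _).
  have h2 := @is_deriveZ _ _ _ _ c _ _ _ h.
  apply: is_derive_eq; last by rewrite /= -mulrA -[k.+1%:R * _]mulr1.
  have -> // : (fun y => c * y ^+ k.+1) = c \*: (id ^+ k.+1).
  by apply/funext => y; rewrite !fctE.
have -> : frac_poly N = \sum_(k < N) (fun y => frac_coeff k * y ^+ k.+1).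
  by apply/funext => y; rewrite /frac_poly fct_sumE.
by apply: is_derive_sum => k; exact: monomial.
Qed.

(** [(1 - x)^b] solves [b y + (1 - x) y' = 0]; the truncated series solves it
up to its last monomial, as the recursion of the coefficients telescopes. *)
Lemma frac_poly_ode N x :
  b * (1 - frac_poly N x) - (1 - x) * dfrac_poly N x =
  N.+1%:R * frac_coeff N * x ^+ N.
Proof.
elim: N => [|N IH]; first by rewrite /frac_poly /dfrac_poly !big_ord0/=; ring.
move: IH; rewrite /frac_poly /dfrac_poly !big_ord_recr/=.
set S := \sum_(k < N) _; set D := \sum_(k < N) _ => IH.
have -> : b * (1 - (S + frac_coeff N * x ^+ N.+1)) -
  (1 - x) * (D + frac_coeff N * N.+1%:R * x ^+ N) =
  (b * (1 - S) - (1 - x) * D) - b * frac_coeff N * x ^+ N.+1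
  - (1 - x) * frac_coeff N * N.+1%:R * x ^+ N by ring.
by rewrite IH exprS; field; rewrite -natrD pnatr_eq0.
Qed.

(** By the differential equation the quotient of [1 - frac_poly N] by
[(1 - x)^b] has an explicit nonnegative derivative, and the mean value theorem
compares it with 1. *)
Lemma frac_poly_bounds (N : nat) (x : R) : 0 <= x < 1 ->
  (1 - x) `^ b <= 1 - frac_poly N x <= (1 - x) `^ b + x ^+ N / (1 - x).
Proof.
have /andP[b0 b1] := b01; move=> /andP[x0 x1].
(* [(1 - y)^(-b)] is the integrating factor of the differential equation *)
pose g (y : R) := (1 - frac_poly N y) * (1 - y) `^ (- b).
pose dg (y : R) := (1 - y) `^ (- b - 1) * (N.+1%:R * frac_coeff N * y ^+ N).
have dgE (y : R) : y < 1 -> is_derive y 1 g (dg y).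
  move=> y1; have y10 : 0 < 1 - y by rewrite subr_gt0.
  have d1 : is_derive y 1 (fun y : R => 1 - frac_poly N y) (- dfrac_poly N y).
    have h := @is_deriveB _ _ _ _ _ _ _ _ _ (is_derive_cst (1 : R) y 1)
      (is_derive_frac_poly N y).
    by apply: is_derive_eq h _; rewrite sub0r.
  have d2 : is_derive y 1 (fun y : R => 1 - y) (-1).
    have h := @is_deriveB _ _ _ _ _ _ _ _ _ (is_derive_cst (1 : R) y 1)
      (is_derive_id y 1).
    by apply: is_derive_eq h _; rewrite sub0r.
  have d3 : is_derive y 1 (fun y : R => (1 - y) `^ (- b)) (b * (1 - y) `^ (- b - 1)).
    have h := @is_derive1_comp _ (@powR R ^~ (- b)) _ y _ _ (is_derive1_powR (- b) y10) d2.
    by apply: is_derive_eq h _; ring.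
  have h := is_deriveM d1 d3; apply: is_derive_eq h _.
  rewrite /dg -frac_poly_ode /GRing.scale /=.
  have -> : (1 - y) `^ (- b) = (1 - y) `^ (- b - 1) * (1 - y).
    rewrite -[X in _ * X]powRr1 ?ltW// -powRD ?subrK//.
    by apply/implyP => _; rewrite gt_eqF.
  ring.
have gcont : {within `[0, x], continuous g}.
  apply: derivable_within_continuous => y; rewrite in_itv/= => /andP[_ yx].
  exact: (@ex_derive _ _ _ _ _ _ _ (dgE y (le_lt_trans yx x1))).
have gd y : y \in `]0, x[ -> is_derive y 1 g (dg y).
  by rewrite in_itv/= => /andP[_ yx]; apply: dgE; exact: lt_trans x1.
have [c] := MVT_segment x0 gd gcont; rewrite in_itv/= => /andP[c0 cx].
have y10 : 0 < 1 - x by rewrite subr_gt0.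
have c10 : 0 < 1 - c by rewrite subr_gt0 (le_lt_trans cx).
have -> : g 0 = 1.
  rewrite /g /frac_poly big1 ?subr0 ?powR1 ?mulr1// => k _.
  by rewrite expr0n mulr0.
rewrite subr0 => gx.
have sE : 1 - frac_poly N x = (1 - x) `^ b * g x.
  rewrite /g mulrCA -powRD ?subrr ?powRr0 ?mulr1//.
  by apply/implyP => _; rewrite gt_eqF.
have p0 : 0 < (1 - x) `^ b by exact: powR_gt0.
have dc0 : 0 <= dg c.
  by rewrite !mulr_ge0 ?powR_ge0 ?frac_coeff_ge0 ?exprn_ge0.
have gxE : g x = 1 + dg c * x by lra.
rewrite sE gxE mulrDr mulr1 lerDl lerD2l.
apply/andP; split; first by rewrite (mulr_ge0 (ltW p0)) ?(mulr_ge0 dc0).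
have powc : (1 - c) `^ (- b - 1) <= (1 - x) `^ (- b - 1).
  have -> : - b - 1 = - (b + 1) by ring.
  rewrite !powRN lef_pV2 ?posrE ?powR_gt0//.
  apply: ge0_ler_powR; last by rewrite lerD2l lerN2.
  - by rewrite addr_ge0 ?(ltW b0).
  - by rewrite nnegrE ltW.
  - by rewrite nnegrE ltW.
have powx : (1 - x) `^ b * (1 - x) `^ (- b - 1) = (1 - x)^-1.
  rewrite -powRD; last by apply/implyP => _; rewrite gt_eqF.
  have -> : b + (- b - 1) = -1 by ring.
  by rewrite powR_inv1// ltW.
have coefc : N.+1%:R * frac_coeff N * c ^+ N <= x ^+ N.
  rewrite -[leRHS]mul1r ler_pM ?mulr_ge0 ?frac_coeff_ge0 ?exprn_ge0//.
    exact: le_trans (frac_coeff_le N) (ltW b1).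
  by rewrite lerXn2r ?nnegrE.
apply: (@le_trans _ _ ((1 - x) `^ b * ((1 - x) `^ (- b - 1) * x ^+ N * 1))).
  apply: ler_wpM2l; first exact: ltW.
  apply: ler_pM => //; last exact: ltW.
  apply: ler_pM => //; first exact: powR_ge0.
  by rewrite !mulr_ge0 ?frac_coeff_ge0 ?exprn_ge0.
by rewrite mulr1 mulrA powx mulrC.
Qed.

Lemma cvg_frac_poly (x : R) : 0 <= x < 1 ->
  (1 - frac_poly N x) @[N --> \oo] --> (1 - x) `^ b.
Proof.
move=> x01; apply: (squeeze_cvgr (f := fun=> (1 - x) `^ b)
  (h := fun N => (1 - x) `^ b + x ^+ N / (1 - x))).
- by apply: nearW => N; exact: frac_poly_bounds.
- exact: cvg_cst.
- rewrite -[X in _ --> X]addr0; apply: cvgD; first exact: cvg_cst.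
  rewrite -[X in _ --> X](mul0r (1 - x)^-1); apply: cvgM; last exact: cvg_cst.
  by apply: cvg_expr; have /andP[x0 x1] := x01; rewrite ger0_norm.
Qed.

End fractional_power.

Section limits.
Context {R : realType}.

Lemma cvg_diff_quotient (f : R -> R) (df : R) : is_derive (0 : R) 1 f df ->
  f 0 = 0 -> (N.+1%:R * f (N.+1%:R^-1)) @[N --> \oo] --> df.
Proof.
move=> dfdx f0; have := @ex_derive _ _ _ _ _ _ _ dfdx.
rewrite /derivable => /cvgP h.
have {h} : h^-1 *: ((f \o shift 0) (h *: 1) - f 0) @[h --> (0:R)^'] --> df.
  by rewrite -(@derive_val _ _ _ _ _ _ _ dfdx); exact: (@ex_derive _ _ _ _ _ _ _ dfdx).
move/cvgr_dnbhsP => /(_ (fun N => N.+1%:R^-1)).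
have H : (forall n, (n.+1%:R^-1 : R) != 0) /\ n.+1%:R^-1 @[n --> \oo] --> (0:R).
  split; first by move=> n; rewrite invr_neq0// pnatr_eq0.
  exact: cvg_harmonic.
move=> /(_ H); apply: cvg_trans; apply: near_eq_cvg; apply: nearW => N.
by rewrite /= f0 subr0 invrK addr0 /GRing.scale /= mulr1.
Qed.

(** At [l = 0] continuity is only available from the right, whence the
perturbation of [u] into a positive sequence. *)
Lemma cvg_powR_base (b l : R) (u : R^nat) : 0 < b -> 0 <= l ->
  (forall N, 0 <= u N) -> u @ \oo --> l -> (u N `^ b) @[N --> \oo] --> l `^ b.
Proof.
move=> b0 + u0 ul; rewrite le_eqVlt => /predU1P[l0|l0].
  rewrite -l0 in ul *; rewrite powR0 ?gt_eqF//.
  pose v N := u N + N.+1%:R^-1.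
  have v0 N : 0 < v N by rewrite ltr_wpDl ?invr_gt0.
  have vl : v @ \oo --> (0 : R).
    by rewrite -[X in _ --> X]addr0; apply: cvgD => //; exact: cvg_harmonic.
  have vb := (cvg_at_rightP (@powR R ^~ b) 0 0).1 (powR_cvg0 b0) v (conj v0 vl).
  apply: squeeze_cvgr (cvg_cst 0) vb; apply: nearW => N.
  rewrite powR_ge0 ge0_ler_powR ?nnegrE ?(ltW b0) ?(ltW (v0 N))//.
  by rewrite lerDl invr_ge0.
have h : {for l, continuous (@powR R ^~ b)}.
  apply: differentiable_continuous; apply/derivable1_diffP.
  exact: (@ex_derive _ _ _ _ _ _ _ (is_derive1_powR b l0)).
exact: (cvg_comp _ _ ul h).
Qed.
End limits.

(** * Positive definite functions *)

Section euclidean_space.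
Context {R : realType} {n : nat}.
Local Notation E := (n.-tuple R).
Implicit Types x y z : E.

Definition addt x y : E := [tuple tnth x i + tnth y i | i < n].

Lemma dotpC x y : dotp x y = dotp y x.
Proof. by apply: eq_bigr => i _; rewrite mulrC. Qed.

Lemma dotpDr x y z : dotp x (addt y z) = dotp x y + dotp x z.
Proof. by rewrite -big_split; apply: eq_bigr => i _; rewrite tnth_mktuple mulrDr. Qed.

Lemma dotpBr x y z : dotp x (subt y z) = dotp x y - dotp x z.
Proof. by rewrite -sumrB; apply: eq_bigr => i _; rewrite tnth_mktuple mulrBr. Qed.

Lemma dotpZr a x y : dotp x (scalet a y) = a * dotp x y.
Proof.
by rewrite mulr_sumr; apply: eq_bigr => i _; rewrite tnth_mktuple mulrCA.
Qed.

Lemma dotpZl a x y : dotp (scalet a x) y = a * dotp x y.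
Proof. by rewrite dotpC dotpZr dotpC. Qed.

Definition zerot : E := [tuple 0 | i < n].

Lemma dotp0r x : dotp x zerot = 0.
Proof. by rewrite /dotp big1// => i _; rewrite tnth_mktuple mulr0. Qed.

Lemma dotp_ge0 x : 0 <= dotp x x.
Proof. by apply: sumr_ge0 => i _; rewrite -expr2 sqr_ge0. Qed.

Lemma measurable_dotp : measurable_fun setT (fun xy : E * E => dotp xy.1 xy.2).
Proof.
apply: measurable_sum => i; apply: measurable_funM.
  exact: (measurableT_comp (measurable_tnth i)).
exact: (measurableT_comp (measurable_tnth i)).
Qed.

Lemma measurable_dotp_l z : measurable_fun setT (fun x : E => dotp x z).
Proof.
apply: measurable_sum => i; apply: measurable_funM => //.
exact: measurable_tnth.
Qed.

Lemma enorm_powR x (alpha : R) : enorm x `^ alpha = dotp x x `^ (alpha / 2).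
Proof. by rewrite /enorm -powR12_sqrt ?dotp_ge0// -powRrM mulrC. Qed.

End euclidean_space.

Section positive_definite.
Context {R : realType} {n : nat}.
Local Notation E := (n.-tuple R).
Implicit Types (f g : E -> R).

(** Generated by cosines instead of being defined by positive matrices: these
rules suffice to reach the stable characteristic functions, and induction over
them proves positivity of integrals. Uniform bounds on limits allow dominated
convergence. *)
Inductive posdef : (E -> R) -> Prop :=
| posdef_cos z : posdef (fun u => cos (dotp u z))
| posdefD f g : posdef f -> posdef g -> posdef (fun u => f u + g u)
| posdefZ c f : 0 <= c -> posdef f -> posdef (fun u => c * f u)
| posdef_lim (F : nat -> E -> R) f M : (forall k, posdef (F k)) ->
    (forall k u, `|F k u| <= M) -> (forall u, F k u @[k --> \oo] --> f u) ->
    posdef f.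

Lemma posdef_bounded f : posdef f -> exists M, forall u, `|f u| <= M.
Proof.
elim=> [z|{}f g _ [M fM] _ [N gN]|c {}f c0 _ [M fM]|F {}f M _ _ FM Ff].
- by exists 1 => u; exact: cos_max.
- by exists (M + N) => u; rewrite (le_trans (ler_normD _ _))// lerD.
- by exists (c * M) => u; rewrite normrM ger0_norm// ler_wpM2l.
- exists M => u.
  have := @closed_cvg _ _ \oo _ (fun k => `|F k u|) _ (@closed_le R M).
  by move=> h; apply: (h _ _ _ (cvg_norm (Ff u))); apply: nearW => k; exact: FM.
Qed.

Lemma posdef_measurable f : posdef f -> measurable_fun setT f.
Proof.
elim=> [z|{}f g _ mf _ mg|c {}f c0 _ mf|F {}f M _ mF _ Ff].
- apply: measurableT_comp; last exact: measurable_dotp_l.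
  exact: (continuous_measurable_fun (@continuous_cos R)).
- exact: measurable_funD.
- exact: measurable_funM.
- by apply: measurable_fun_cvg mF _ => u _; exact: Ff.
Qed.

(** Induction on both factors; for two cosines this is the product formula. *)
Lemma posdefM f g : posdef f -> posdef g -> posdef (fun u => f u * g u).
Proof.
move=> pf; elim: pf g => [z|{}f f' _ IH _ IH'|c {}f c0 _ IH|F {}f M _ IH FM Ff] g pg.
- elim: pg => [z'|{}g g' _ IH _ IH'|c {}g c0 _ IH|F {}g M _ IH FM Fg].
  + have -> : (fun u => cos (dotp u z) * cos (dotp u z')) =
       (fun u => 2^-1 * (cos (dotp u (addt z z')) + cos (dotp u (subt z z')))).
      by apply/funext => u; rewrite dotpDr dotpBr cosD cosB; field.
    by apply: posdefZ; [rewrite invr_ge0|exact: posdefD (posdef_cos _) (posdef_cos _)].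
  + under eq_fun do rewrite mulrDr.
    exact: posdefD.
  + under eq_fun do rewrite mulrCA.
    exact: posdefZ.
  + apply: (@posdef_lim (fun k u => cos (dotp u z) * F k u) _ M) => //.
      move=> k u; rewrite normrM -[leRHS]mul1r ler_pM//; exact: cos_max.
    by move=> u; apply: cvgM (Fg u); exact: cvg_cst.
- under eq_fun do rewrite mulrDl.
  by apply: posdefD; [exact: IH|exact: IH'].
- under eq_fun do rewrite -mulrA.
  by apply: posdefZ => //; exact: IH.
- have [N gN] := posdef_bounded pg.
  apply: (@posdef_lim (fun k u => F k u * g u) _ (M * N)) => //.
  + by move=> k; exact: IH.
  + by move=> k u; rewrite normrM ler_pM.
  + by move=> u; apply: cvgM (Ff u) _; exact: cvg_cst.
Qed.

Lemma posdef_cst c : 0 <= c -> posdef (fun=> c).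
Proof.
move=> c0; have -> : (fun=> c) = (fun u : E => c * cos (dotp u zerot)).
  by apply/funext => u; rewrite dotp0r cos0 mulr1.
by apply: posdefZ => //; exact: posdef_cos.
Qed.

Lemma posdefX f k : posdef f -> posdef (fun u => f u ^+ k).
Proof.
move=> pf; elim: k => [|k IH]; first exact: posdef_cst.
by under eq_fun do rewrite exprS; exact: posdefM.
Qed.

Lemma posdef_sum (I : Type) (s : seq I) (F : I -> E -> R) :
  (forall i, posdef (F i)) -> posdef (fun u => \sum_(i <- s) F i u).
Proof.
move=> pF; elim: s => [|i s IH].
  by under eq_fun do rewrite big_nil; exact: posdef_cst.
by under eq_fun do rewrite big_cons; exact: posdefD.
Qed.

Lemma posdef_expR f : posdef f -> posdef (fun u => expR (f u)).
Proof.
move=> pf; have [M fM] := posdef_bounded pf.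
apply: (@posdef_lim (fun k u => series (exp_coeff (f u)) k) _ (expR M)).
- move=> k; rewrite /series /=; apply: posdef_sum => i.
  under eq_fun do rewrite /exp_coeff /= mulrC.
  by apply: posdefZ; [rewrite invr_ge0|exact: posdefX].
- move=> k u; rewrite /series /=.
  apply: le_trans (ler_norm_sum _ _ _) _.
  apply: (@le_trans _ _ (series (exp_coeff M) k)).
    apply: ler_sum => i _; rewrite /exp_coeff /= normrM normrX.
    rewrite [X in _ * X]ger0_norm ?invr_ge0// ler_wpM2r ?invr_ge0//.
    by rewrite lerXn2r ?nnegrE// (le_trans _ (fM u)).
  apply: nondecreasing_cvgn_le; last exact: is_cvg_series_exp_coeff.
  apply/nondecreasing_seqP => i; rewrite /series /= big_nat_recr//= lerDl.
  by apply: exp_coeff_ge0; rewrite (le_trans _ (fM u)).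
- by move=> u; exact: is_cvg_series_exp_coeff.
Qed.

(** Schoenberg's criterion for conditionally negative definite functions,
taken as the definition. *)
Definition negdef f := (forall u, 0 <= f u) /\
  forall t : R, 0 <= t -> posdef (fun u => expR (- t * f u)).

Lemma negdef_bound f t u : negdef f -> 0 <= t -> `|expR (- t * f u)| <= 1.
Proof.
move=> [f0 _] t0; rewrite ger0_norm ?expR_ge0// -[leRHS]expR0 ler_expR mulNr.
by rewrite oppr_le0 mulr_ge0.
Qed.

Lemma negdef_lim (F : nat -> E -> R) f : (forall k, negdef (F k)) ->
  (forall u, F k u @[k --> \oo] --> f u) -> negdef f.
Proof.
move=> nF Ff; split.
  move=> u; have := @closed_cvg _ _ \oo _ (F ^~ u) _ (@closed_ge R 0).
  move=> h; apply: (h _ _ _ (Ff u)); apply: nearW => k.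
  by have [+ _] := nF k; exact.
move=> t t0; apply: (@posdef_lim (fun k u => expR (- t * F k u)) _ 1).
- by move=> k; have [_] := nF k; exact.
- by move=> k u; exact: negdef_bound.
- move=> u; apply: (cvg_comp (fun k => - t * F k u) expR); last exact: continuous_expR.
  by apply: cvgM (Ff u); exact: cvg_cst.
Qed.

Lemma negdefD f g : negdef f -> negdef g -> negdef (fun u => f u + g u).
Proof.
move=> [f0 pf] [g0 pg]; split; first by move=> u; rewrite addr_ge0.
move=> t t0; under eq_fun do rewrite mulrDr expRD.
by apply: posdefM; [exact: pf|exact: pg].
Qed.

Lemma negdefZ c f : 0 <= c -> negdef f -> negdef (fun u => c * f u).
Proof.
move=> c0 [f0 pf]; split; first by move=> u; rewrite mulr_ge0.
move=> t t0; under eq_fun do rewrite mulrA mulNr.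
by apply: pf; exact: mulr_ge0.
Qed.

(** Here [exp(- t (1 - cos))] is a multiple of the exponential of a positive
definite function, the characteristic function of a compound Poisson
variable. *)
Lemma negdef_1Bcos z : negdef (fun u => 1 - cos (dotp u z)).
Proof.
split; first by move=> u; rewrite subr_ge0 cos_le1.
move=> t t0.
have -> : (fun u => expR (- t * (1 - cos (dotp u z)))) =
    (fun u => expR (- t) * expR (t * cos (dotp u z))).
  by apply/funext => u; rewrite -expRD; congr expR; ring.
apply: posdefZ; first exact: expR_ge0.
by apply: posdef_expR; apply: posdefZ => //; exact: posdef_cos.
Qed.

(** The limit of [2 k^2 (1 - cos (a / k))]. *)
Lemma negdef_dotp_sqr z : negdef (fun u => dotp u z ^+ 2).
Proof.
apply: (@negdef_lim
  (fun k u => 2 * k.+1%:R ^+ 2 * (1 - cos (dotp u (scalet k.+1%:R^-1 z))))).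
  move=> k; apply: negdefZ; last exact: negdef_1Bcos.
  by rewrite mulr_ge0// exprn_ge0.
move=> u; set a := dotp u z.
(* [2 k^2 (1 - cos (a / k))] is the square of the difference quotient
   [k * (2 sin (a / (2 k)))] *)
have d : is_derive (0 : R) 1 (fun y : R => 2 * sin (a / 2 * y)) a.
  have d1 := @is_deriveZ _ _ _ _ (a / 2) _ _ _ (@is_derive_id _ R^o (0:R) 1).
  have d2 := @is_derive1_comp _ _ _ _ _ _ (is_derive_sin _) d1.
  have d3 := @is_deriveZ _ _ _ _ 2 _ _ _ d2.
  apply: (is_derive_eq d3).
  rewrite /= /GRing.scale /=.
  have -> : cos (a / 2 *: 0) = 1 by rewrite scaler0 cos0.
  by field.
have h := cvg_diff_quotient d _; rewrite mulr0 sin0 mulr0 in h.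
have {}h := h erefl.
rewrite [a ^+ 2]expr2; apply: cvg_trans (cvgM h h).
apply: near_eq_cvg; apply: nearW => k.
rewrite dotpZr -/a.
have -> : k.+1%:R^-1 * a = a / 2 * k.+1%:R^-1 + a / 2 * k.+1%:R^-1.
  by field; rewrite nat1r pnatr_eq0.
set c := a / 2 * _; have /eqP := cos2Dsin2 c; rewrite eq_sym -subr_eq => /eqP c2.
by rewrite cosD -!expr2 -c2 /= -/c; ring.
Qed.

Lemma negdef_sum (I : Type) (s : seq I) (F : I -> E -> R) :
  (forall i, negdef (F i)) -> negdef (fun u => \sum_(i <- s) F i u).
Proof.
move=> pF; elim: s => [|i s IH].
  under eq_fun do rewrite big_nil; split=> // t t0.
  by apply: posdef_cst; exact: expR_ge0.
by under eq_fun do rewrite big_cons; exact: negdefD.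
Qed.

Lemma negdef_sqr_norm : negdef (fun u => dotp u u).
Proof.
apply: negdef_sum => i.
have -> : (fun u : E => tnth u i * tnth u i) =
    (fun u => dotp u [tuple (j == i)%:R | j < n] ^+ 2).
  apply/funext => u; rewrite -expr2 /dotp (bigD1 i)//= tnth_mktuple eqxx mulr1.
  by rewrite big1 ?addr0// => j /negbTE ji; rewrite tnth_mktuple ji mulr0.
exact: negdef_dotp_sqr.
Qed.

(** Bernstein's subordination without integrals: for a positive definite [x]
with values between 0 and 1, 1 excluded, the function [(1 - x)^b] is a limit
of constants minus positive definite functions, by the signs of the binomial
coefficients; then [f^b] is the limit of [k^b (1 - exp(- f / k))^b]. *)
Lemma negdef_frac f (b : R) : 0 < b < 1 -> negdef f -> negdef (fun u => f u `^ b).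
Proof.
move=> /[dup] b01 /andP[b0 b1] [f0 pf].
(* the shift of [f] by [1 / k] keeps [x k] strictly below 1, where the series
   converges *)
pose x (k : nat) u := expR (- k.+1%:R^-1 * (f u + k.+1%:R^-1)).
have x01 k u : 0 <= x k u < 1.
  rewrite expR_ge0 -expR0 ltr_expR mulNr oppr_lt0 mulr_gt0 ?invr_gt0 ?ltr0n//.
  by rewrite ltr_wpDl// invr_gt0 ltr0n.
have px k : posdef (x k).
  rewrite /x; under eq_fun do rewrite mulrDr expRD mulrC.
  by apply: posdefZ; [exact: expR_ge0|apply: pf; rewrite invr_ge0].
have nN k N : negdef (fun u => 1 - frac_poly b N (x k u)).
  split.
    move=> u; have /andP[+ _] := frac_poly_bounds b01 N (x01 k u).
    by apply: le_trans; exact: powR_ge0.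
  move=> t t0.
  have -> : (fun u => expR (- t * (1 - frac_poly b N (x k u)))) =
      (fun u => expR (- t) * expR (t * frac_poly b N (x k u))).
    by apply/funext => u; rewrite -expRD; congr expR; ring.
  apply: posdefZ; first exact: expR_ge0.
  apply: posdef_expR; apply: posdefZ => //; apply: posdef_sum => i.
  by apply: posdefZ; [exact: frac_coeff_ge0|exact: posdefX].
have nk k : negdef (fun u => (1 - x k u) `^ b).
  apply: negdef_lim (nN k) _ => u; exact: cvg_frac_poly.
apply: (@negdef_lim (fun k u => k.+1%:R `^ b * (1 - x k u) `^ b)).
  by move=> k; apply: negdefZ => //; exact: powR_ge0.
move=> u.
have d : is_derive (0 : R) 1 (fun v : R => 1 - expR (- v * (f u + v))) (f u).
  have did := @is_derive_id R R^o (0 : R) 1.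
  have d1 := is_deriveM (is_deriveN did) (is_deriveD (is_derive_cst (f u) (0:R) 1) did).
  have d2 := @is_derive1_comp _ _ _ (0 : R) _ _ (is_derive_expR _) d1.
  have d3 := is_deriveB (is_derive_cst (1 : R) (0 : R) 1) d2.
  apply: (is_derive_eq d3).
  rewrite !fctE /GRing.scale /= !oppr0 !mul0r expR0 /cst.
  ring.
have h := cvg_diff_quotient d _; rewrite oppr0 mul0r expR0 subrr in h.
have {}h := h erefl.
have x1 k : 0 < 1 - x k u by have /andP[_] := x01 k u; rewrite subr_gt0.
under eq_fun do rewrite -powRM ?ler0n ?(ltW (x1 _))//.
by apply: cvg_powR_base => // k; rewrite mulr_ge0// ltW.
Qed.

(** [|u|^alpha] is the power [alpha / 2 < 1] of [|u|^2]. *)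
Lemma posdef_stable (alpha t : R) : 0 < alpha < 2 -> 0 <= t ->
  posdef (fun u : E => expR (- t * enorm u `^ alpha)).
Proof.
move=> /andP[a0 a2] t0.
have b01 : 0 < alpha / 2 < 1 by rewrite divr_gt0//= ltr_pdivrMr// mul1r.
have [_ h] := negdef_frac b01 negdef_sqr_norm.
by under eq_fun do rewrite enorm_powR; exact: h.
Qed.

End positive_definite.

(** * Lebesgue measure on tuples and affine maps *)

Section affine_line.
Context {R : realType}.
Local Notation leb := (@lebesgue_measure R).

Definition affine (a b : R) (x : measurableTypeR R) : measurableTypeR R := a * x + b.

Lemma measurable_affine a b : measurable_fun setT (affine a b).
Proof.
by apply: measurable_funD => //; apply: measurable_funM.
Qed.

Local Notation pushforward_affine a b :=
  (measure_function_pushforward__canonical__measure_function_Measure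
     leb (measurable_affine a b)).

(** Both sides agree on half-open intervals; for [a < 0] the preimage is open
on the other side, which does not change its length. *)
Lemma lebesgue_measure_affine (a b : R) (A : set (measurableTypeR R)) :
  a != 0 -> measurable A ->
  leb A = mscale (`|a|%:nng) (pushforward_affine a b) A.
Proof.
move=> a0 mA; apply: lebesgue_measure_unique mA => _ [[x y] _ <-].
rewrite /mscale /pushforward /=.
have [ay|ay|ay] := ltgtP a 0; last by rewrite ay eqxx in a0.
- transitivity (`|a|%:E * leb `[((y - b) / a)%R, ((x - b) / a)%R[%classic)%E; last first.
    congr (_ * leb _)%E.
    apply/seteqP; split => z /=; rewrite !in_itv/= /affine.
      by rewrite ler_ndivrMr// ltr_ndivlMr// => /andP[h1 h2]; apply/andP; split; lra.
    by rewrite ler_ndivrMr// ltr_ndivlMr// => /andP[h1 h2]; apply/andP; split; lra.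
  rewrite !lebesgue_measure_itv/= !lte_fin.
  rewrite ltr_ndivrMr// divfK// ltrD2r; case: ifP => xy; last by rewrite mule0.
  rewrite -!EFinD -EFinM; congr EFin; rewrite ltr0_norm//; by field.
- transitivity (`|a|%:E * leb `]((x - b) / a)%R, ((y - b) / a)%R]%classic)%E; last first.
    congr (_ * leb _)%E.
    apply/seteqP; split => z /=; rewrite !in_itv/= /affine.
      by rewrite ltr_pdivrMr// ler_pdivlMr// => /andP[h1 h2]; apply/andP; split; lra.
    by rewrite ltr_pdivrMr// ler_pdivlMr// => /andP[h1 h2]; apply/andP; split; lra.
  rewrite !lebesgue_measure_itv/= !lte_fin.
  rewrite ltr_pdivrMr// divfK// ltrD2r; case: ifP => xy; last by rewrite mule0.
  rewrite -!EFinD -EFinM; congr EFin; rewrite gtr0_norm//; by field.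
Qed.

Lemma ge0_integral_affine (a b : R) (g : R -> \bar R) :
  a != 0 -> measurable_fun setT g -> (forall x, 0 <= g x)%E ->
  (`|a|%:E * \int[leb]_x g (a * x + b)%R = \int[leb]_x g x)%E.
Proof.
move=> a0 mg g0.
rewrite [RHS](eq_measure_integral (mscale (`|a|%:nng) (pushforward_affine a b))); last first.
  by move=> A mA _; exact: lebesgue_measure_affine.
rewrite ge0_integral_mscale//.
congr (_ * _)%E.
by rewrite [RHS](ge0_integral_pushforward (measurable_affine a b) leb measurableT mg).
Qed.

End affine_line.

Section lebesgue_tuple.
Context {R : realType}.
Local Notation leb := (@lebesgue_measure R).

Lemma ge0_integral_lebesgue_tupleS n (g : n.+1.-tuple R -> \bar R) :
  measurable_fun setT g -> (forall x, 0 <= g x)%E ->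
  (\int[lebesgue_tuple n.+1]_x g x =
   \int[leb]_x \int[lebesgue_tuple n]_y g (tuple_cons (x, y)))%E.
Proof.
move=> mg g0.
rewrite -[RHS](fubini_tonelli1 (fun z => g (tuple_cons z)))//; last first.
  exact: measurableT_comp mg (@measurable_tuple_cons R n).
exact: (ge0_integral_pushforward (@measurable_tuple_cons R n)
  (leb \x lebesgue_tuple n)%E measurableT mg).
Qed.

Lemma integral_lebesgue_tuple0 (g : 0.-tuple R -> \bar R) :
  measurable_fun setT g -> (forall x, 0 <= g x)%E ->
  (\int[lebesgue_tuple 0]_x g x = g [tuple])%E.
Proof. by move=> mg g0; rewrite /= integral_dirac// diracT mul1e. Qed.

Definition afft n (a : R) (b y : n.-tuple R) : n.-tuple R :=
  [tuple a * tnth y i + tnth b i | i < n].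

Lemma measurable_afft n : measurable_fun setT
  (fun aby : R * (n.-tuple R * n.-tuple R) => afft aby.1 aby.2.1 aby.2.2).
Proof.
apply/measurable_fun_tnthP => i.
rewrite (_ : _ \o _ = fun aby : R * (n.-tuple R * n.-tuple R) =>
   aby.1 * tnth aby.2.2 i + tnth aby.2.1 i); last first.
  by apply/funext => aby /=; rewrite tnth_mktuple.
apply: measurable_funD.
  apply: measurable_funM => //.
  apply: (measurableT_comp (measurable_tnth i)).
  exact: (measurableT_comp measurable_snd measurable_snd).
apply: (measurableT_comp (measurable_tnth i)).
exact: (measurableT_comp measurable_fst measurable_snd).
Qed.

Lemma measurable_afft_y n a b : measurable_fun setT (@afft n a b).
Proof.
have h := measurableT_comp (@measurable_afft n) (measurable_pair1 a).
exact: (measurableT_comp h (measurable_pair1 b)).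
Qed.

Lemma afft_cons n a b0 (b : n.-tuple R) x y :
  afft a (tuple_cons (b0, b)) (tuple_cons (x, y)) =
  tuple_cons (a * x + b0, afft a b y).
Proof.
apply: eq_from_tnth => i; rewrite tnth_mktuple.
have [->|[j ->]] : i = ord0 \/ exists j, i = lift ord0 j.
  by case: (unliftP ord0 i) => [j ->|->]; [right; exists j|left].
  by rewrite !tnth0.
by rewrite !tnthS tnth_mktuple.
Qed.

Lemma tuple_cons_eta n (x : n.+1.-tuple R) :
  x = tuple_cons (thead x, [tuple of behead x]).
Proof. by apply/val_inj; rewrite /= {1}(tuple_eta x). Qed.

(** Induction on the dimension, one coordinate at a time by Tonelli. *)
Lemma ge0_integral_afft n (a : R) (b : n.-tuple R) (g : n.-tuple R -> \bar R) :
  a != 0 -> measurable_fun setT g -> (forall x, 0 <= g x)%E ->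
  ((`|a| ^+ n)%:E * \int[lebesgue_tuple n]_y g (afft a b y) =
   \int[lebesgue_tuple n]_y g y)%E.
Proof.
move=> a0; elim: n b g => [|n IH] b g mg g0.
  rewrite mul1e; apply: eq_integral => y _; congr g.
  by rewrite (tuple0 y) (tuple0 (afft _ _ _)).
have mga : measurable_fun setT (fun y => g (afft a b y)).
  exact: measurableT_comp mg (measurable_afft_y a b).
have mgc := measurableT_comp mg (@measurable_tuple_cons R n).
rewrite !ge0_integral_lebesgue_tupleS//.
rewrite (tuple_cons_eta b); move: (thead b) [tuple of behead b] => b0 b'.
under eq_integral do under eq_integral do rewrite afft_cons.
pose G x := (\int[lebesgue_tuple n]_y g (tuple_cons (x, y)))%E.
have mG : measurable_fun setT G.
  exact: (measurable_fun_fubini_tonelli_F (fun z => g (tuple_cons z))).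
have G0 x : (0 <= G x)%E by exact: integral_ge0.
rewrite -[RHS](ge0_integral_affine b0 a0 mG G0).
rewrite exprS EFinM -muleA; congr (_ * _)%E.
rewrite -ge0_integralZl//.
- apply: eq_integral => x _; rewrite (IH b' (fun y => g (tuple_cons (a * x + b0, y))))//.
  exact: (measurableT_comp mgc (measurable_pair1 _)).
- pose h (z : measurableTypeR R * n.-tuple R) :=
    g (tuple_cons (a * z.1 + b0, afft a b' z.2)).
  apply: (measurable_fun_fubini_tonelli_F h); last by move=> z; exact: g0.
  apply: (measurableT_comp mgc (measurable_fun_pair _ _)).
    exact: (measurableT_comp (measurable_affine a b0) measurable_fst).
  exact: (measurableT_comp (measurable_afft_y a b') measurable_snd).
- by move=> x _; exact: integral_ge0.
Qed.

Lemma ge0_integral_prod n (h : R -> R) (c : R) : measurable_fun setT h ->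
  (forall x, 0 <= h x) -> (\int[leb]_x (h x)%:E = c%:E)%E ->
  (\int[lebesgue_tuple n]_y (\prod_(i < n) h (tnth y i))%:E = (c ^+ n)%:E)%E.
Proof.
move=> mh h0 hc.
have mp k : measurable_fun setT (fun y : k.-tuple R => \prod_(i < k) h (tnth y i)).
  apply: measurable_prod => i _.
  exact: (measurableT_comp mh (measurable_tnth i)).
have p0 k (y : k.-tuple R) : 0 <= \prod_(i < k) h (tnth y i).
  by apply: prodr_ge0 => i _.
elim: n => [|n IH].
  rewrite integral_lebesgue_tuple0; first by rewrite big_ord0.
    by apply/measurable_EFinP; exact: mp.
  by move=> x; rewrite lee_fin.
rewrite ge0_integral_lebesgue_tupleS; first last.
- by move=> x; rewrite lee_fin.
- by apply/measurable_EFinP; exact: mp.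
transitivity (\int[leb]_x ((h x)%:E * (c ^+ n)%:E))%E.
  apply: eq_integral => x _; rewrite -IH -ge0_integralZl ?lee_fin//.
  - apply: eq_integral => y _; rewrite big_ord_recl tnth0 -EFinM.
    by congr (_ * _)%:E; apply: eq_bigr => i _; rewrite tnthS.
  - by apply/measurable_EFinP; exact: mp.
  - by move=> y _; rewrite lee_fin.
rewrite ge0_integralZr//; first by rewrite hc -EFinM -exprS.
- exact/measurable_EFinP.
- by move=> x _; rewrite lee_fin.
- rewrite lee_fin exprn_ge0// -lee_fin -hc; apply: integral_ge0 => x _.
  by rewrite lee_fin.
Qed.

End lebesgue_tuple.

(** * The Laplace and Cauchy kernels on the line *)

Section laplace_cauchy.
Context {R : realType}.
Local Notation leb := (@lebesgue_measure R).

(** Twice the half-line integral, which the fundamental theorem of calculus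
evaluates. *)
Lemma ge0_integral_even (g F : R -> R) (l : R) : continuous g ->
  (forall x, 0 <= x -> 0 <= g x) -> (forall x : R, is_derive x 1 F (g x)) ->
  F x @[x --> +oo] --> l ->
  (\int[leb]_x (g `|x|)%:E = (2 * (l - F 0))%:E)%E.
Proof.
move=> cg g0 dF Fl.
have dFx (x : R) : derivable F x 1 := @ex_derive _ _ _ _ _ _ _ (dF x).
rewrite (@ge0_symfun_integralT _ (fun x => g `|x|)).
- rewrite [X in (_ * X)%E](_ : _ = (\int[leb]_(x in `[0%R, +oo[) (g x)%:E)%E); last first.
    rewrite set_itvcy; apply: eq_integral => x; rewrite inE /= => x0.
    by rewrite ger0_norm.
  rewrite (ge0_continuous_FTC2y (F := F) (l := l))//.
  + exact: continuous_subspaceT.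
  + apply: cvg_at_right_filter.
    by apply: differentiable_continuous; apply/derivable1_diffP.
  + by move=> x _; rewrite derive1E; exact: (@derive_val _ _ _ _ _ _ _ (dF x)).
- by move=> x; exact: g0.
- move=> x; apply: (@continuous_comp _ _ _ (fun x : R => `|x|) g); last exact: cg.
  exact: norm_continuous.
- by move=> x /=; rewrite normrN.
Qed.

Lemma integral_cauchy : (\int[leb]_x (2 / (1 + x ^+ 2))%:E = (2 * pi)%:E)%E.
Proof.
have h := @ge0_integral_even (fun x => 2 / (1 + x ^+ 2)) (fun x => 2 * atan x) pi.
under eq_integral do rewrite -[X in 1 + X]real_normK ?num_real//.
rewrite h.
- by rewrite atan0 mulr0 subr0.
- move=> x; apply: cvgM; first exact: cvg_cst.
  apply: cvgV; first by rewrite gt_eqF// ltr_pwDl// sqr_ge0.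
  apply: cvgD; first exact: cvg_cst.
  exact: exprn_continuous.
- by move=> x _; rewrite divr_ge0// addr_ge0// sqr_ge0.
- have -> : pi = 2 * (pi / 2) :> R by rewrite mulrC divfK.
  by apply: cvgM; [exact: cvg_cst|exact: cvgy_atan].
Qed.

(** The case of a multiple of an even cosine, where an explicit antiderivative
is available on the half-line. *)
Lemma integral_laplace_even (kappa u : R) : `|kappa| <= 1 ->
  (\int[leb]_x (expR (- `|x|) * (1 + kappa * cos (u * x)))%:E =
   (2 + kappa * (2 / (1 + u ^+ 2)))%:E)%E.
Proof.
move=> k1; have u0 : 1 + u ^+ 2 != 0 by rewrite gt_eqF// ltr_pwDl// sqr_ge0.
pose g x := expR (- x) * (1 + kappa * cos (u * x)).
pose F x := expR (- x) * (kappa * (u * sin (u * x) - cos (u * x)) / (1 + u ^+ 2) - 1).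
have dF (x : R) : is_derive x 1 F (g x).
  have did := @is_derive_id R R^o x 1.
  have d1 := @is_derive1_comp _ _ _ x _ _ (is_derive_expR _) (is_deriveN did).
  have d2 := @is_deriveZ _ _ _ _ u _ _ _ did.
  have d3 := @is_derive1_comp _ _ _ x _ _ (is_derive_sin _) d2.
  have d4 := @is_derive1_comp _ _ _ x _ _ (is_derive_cos _) d2.
  have d5 := is_deriveB (@is_deriveZ _ _ _ _ u _ _ _ d3) d4.
  have d6 := @is_deriveZ _ _ _ _ (kappa / (1 + u ^+ 2)) _ _ _ d5.
  have d7 := is_deriveB d6 (is_derive_cst (1 : R) x 1).
  have d8 := is_deriveM d1 d7.
  have -> : F = (expR \o (-%R : R -> R)) * (((kappa / (1 + u ^+ 2)) \*:
     ((u \*: (sin \o (u \*: (id : R -> R)))) - (cos \o (u \*: (id : R -> R))))) - cst 1).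
    apply/funext => y; rewrite /F !fctE /= /GRing.scale /= /cst.
    by congr (_ * _); field.
  apply: (is_derive_eq d8).
  rewrite !fctE /= /GRing.scale /= /g /cst; field.
  exact: u0.
have F0 : F 0 = - (1 + kappa / (1 + u ^+ 2)).
  by rewrite /F oppr0 expR0 mulr0 sin0 cos0; field.
have kcos (y : R) : `|kappa * cos y| <= 1.
  by rewrite normrM -[leRHS]mul1r ler_pM// cos_max.
have g0 x : 0 <= g x.
  by rewrite mulr_ge0 ?expR_ge0//; have := kcos (u * x); rewrite ler_norml; lra.
transitivity (\int[leb]_x (g `|x|)%:E)%E.
  apply: eq_integral => x _; congr (_ * (1 + _ * _))%:E.
  by have [x0|x0] := ger0P x; [|rewrite mulrN cosN].
rewrite (ge0_integral_even (F := F) (l := 0))//.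
- by rewrite F0; congr EFin; field.
- move=> x; apply: cvgM.
    apply: (@continuous_comp _ _ _ (-%R : R -> R) expR).
      exact: opp_continuous.
    exact: continuous_expR.
  apply: cvgD; first exact: cvg_cst.
  apply: cvgM; first exact: cvg_cst.
  apply: (@continuous_comp _ _ _ (fun x : R => u * x) cos).
    exact: mulrl_continuous.
  exact: continuous_cos.
- pose C := (`|u| + 1) / (1 + u ^+ 2) + 1.
  apply: (squeeze_cvgr (f := fun x => - (expR (- x) * C)) (h := fun x => expR (- x) * C)).
  + apply: nearW => x; rewrite -ler_norml normrM ger0_norm ?expR_ge0//.
    rewrite ler_wpM2l ?expR_ge0// (le_trans (ler_normB _ _))// normr1 lerD2r.
    rewrite normrM normfV [X in _ / X]ger0_norm; last by rewrite addr_ge0// sqr_ge0.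
    rewrite ler_pM2r ?invr_gt0 ?ltr_pwDl ?sqr_ge0// normrM -[leRHS]mul1r ler_pM//.
    rewrite (le_trans (ler_normB _ _))// lerD ?cos_max//.
    by rewrite normrM -[leRHS]mulr1 ler_pM// sin_max.
  + rewrite -oppr0 -(mul0r C); apply: cvgN; apply: cvgM; last exact: cvg_cst.
    exact: cvgr_expR.
  + rewrite -(mul0r C); apply: cvgM; last exact: cvg_cst.
    exact: cvgr_expR.
Qed.

(** The Fourier transform of [exp(- |x|)], with a phase. The added 1 keeps the
integrand nonnegative, so that Tonelli's theorem alone handles its
multivariate version. *)
Lemma integral_laplace (theta u : R) :
  (\int[leb]_x (expR (- `|x|) * (1 + cos (theta + u * x)))%:E =
   (2 + cos theta * (2 / (1 + u ^+ 2)))%:E)%E.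
Proof.
pose A x := expR (- `|x|) * (1 + cos (theta + u * x)).
have mA : measurable_fun setT (EFin \o A).
  apply/measurable_EFinP; apply: measurable_funM.
    apply: measurableT_comp; first exact: measurable_expR.
    apply: measurable_funN; exact: normr_measurable.
  apply: measurable_funD => //.
  apply: measurableT_comp.
    exact: (continuous_measurable_fun (@continuous_cos R)).
  by apply: measurable_funD => //; exact: measurable_funM.
have A0 x : (0 <= (A x)%:E)%E.
  by rewrite lee_fin mulr_ge0 ?expR_ge0//; have := cos_geN1 (theta + u * x); lra.
have symA : (\int[leb]_x (A (- x))%:E = \int[leb]_x (A x)%:E)%E.
  have := ge0_integral_affine (a := -1) 0 _ mA A0.
  rewrite oppr_eq0 oner_eq0 normrN1 mul1e => <-//.
  by apply: eq_integral => x _; rewrite mulN1r addr0.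
have k1 := cos_max theta.
have mAN : measurable_fun setT (fun x : R => (A (- x))%:E).
  apply: (measurableT_comp mA); exact: oppr_measurable.
have dbl (I : \bar R) : I = ((2^-1)%:E * (I + I))%E.
  by rewrite -mule2n -(@mule_natl _ _ 2) muleA -EFinM mulVf ?mul1e.
rewrite -/(A _) [LHS]dbl -{2}symA -(ge0_integralD _ measurableT)//.
under eq_integral do rewrite -EFinD.
pose B x := 2 * (expR (- `|x|) * (1 + cos theta * cos (u * x))).
transitivity ((2^-1)%:E * \int[leb]_x (B x)%:E)%E.
  congr (_ * _)%E; apply: eq_integral => x _; rewrite /A /B normrN mulrN cosD cosB.
  by congr EFin; ring.
have B0 x : (0 <= (expR (- `|x|) * (1 + cos theta * cos (u * x)))%:E)%E.
  have : `|cos theta * cos (u * x)| <= 1.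
    by rewrite normrM -[leRHS]mul1r ler_pM// cos_max.
  by rewrite ler_norml lee_fin => /andP[h _]; rewrite mulr_ge0 ?expR_ge0// -lerBlDl sub0r.
rewrite /B; under eq_integral do rewrite EFinM.
rewrite ge0_integralZl//.
  by rewrite muleA -EFinM mulVf ?mul1e ?integral_laplace_even.
apply/measurable_EFinP; apply: measurable_funM.
  apply: measurableT_comp; first exact: measurable_expR.
  apply: measurable_funN; exact: normr_measurable.
apply: measurable_funD => //; apply: measurable_funM => //.
apply: measurableT_comp.
  exact: (continuous_measurable_fun (@continuous_cos R)).
exact: measurable_funM.
Qed.

End laplace_cauchy.

(** * Product kernels and their Fourier transform *)

Section real_fubini.
Context d1 d2 {T1 : measurableType d1} {T2 : measurableType d2} {R : realType}.
Variables (m1 : {sigma_finite_measure set T1 -> \bar R})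
          (m2 : {sigma_finite_measure set T2 -> \bar R}).
Variables (f : T1 * T2 -> R) (a : T1 -> R) (b : T2 -> R).
Hypotheses (mf : measurable_fun setT f)
  (ia : m1.-integrable setT (EFin \o a)) (ib : m2.-integrable setT (EFin \o b))
  (fab : forall x y, `|f (x, y)| <= a x * b y).

(** Domination by a product of integrable functions is the form in which every
use of Fubini's theorem below is justified. *)
Lemma integrable_prod_dominated :
  (m1 \x m2)%E.-integrable setT (EFin \o f).
Proof.
have mfE : measurable_fun setT (EFin \o f) by exact/measurable_EFinP.
have /integrableP[ma ia'] := ia; have /integrableP[mb ib'] := ib.
apply/integrable12ltyP => //.
have mabsb : measurable_fun setT (fun y => `|(b y)%:E|%E).
  exact: measurableT_comp mb.
have mabsa : measurable_fun setT (fun x => `|(a x)%:E|%E).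
  exact: measurableT_comp ma.
have b0 : (0 <= \int[m2]_y `|(b y)%:E|)%E by exact: integral_ge0.
apply: (@le_lt_trans _ _ (\int[m1]_x (`|(a x)%:E| * \int[m2]_y `|(b y)%:E|))%E).
  apply: ge0_le_integral => //=.
  - by move=> x _; exact: integral_ge0.
  - apply: (measurable_fun_fubini_tonelli_F (fun z => `|(f z)%:E|%E)) => //.
    exact: measurableT_comp mfE.
  - by apply: emeasurable_funM.
  - move=> x _; rewrite -ge0_integralZl//; apply: ge0_le_integral => //.
    + apply: (@measurableT_comp _ _ _ _ _ _ abse _ (fun y => (f (x, y))%:E)) => //.
      exact: (measurableT_comp mfE (measurable_pair1 x)).
    + by apply: emeasurable_funM.
    + move=> y _; rewrite -EFinM lee_fin -normrM.
      by rewrite (le_trans (fab x y))// ler_norm.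
rewrite ge0_integralZr//; apply: lte_mul_pinfty => //.
  exact: integral_ge0.
by rewrite ge0_fin_numE//; exact: integral_ge0.
Qed.

Lemma integrable_dominated_l x : m2.-integrable setT (fun y => (f (x, y))%:E).
Proof.
apply: (@le_integrable _ _ _ m2 _ measurableT _ (EFin \o (fun y => a x * b y))).
- apply/measurable_EFinP; exact: (measurableT_comp mf (measurable_pair1 x)).
- by move=> y _ /=; rewrite lee_fin (le_trans (fab x y))// ler_norm.
- exact: (integrableZl measurableT (a x) ib).
Qed.

Lemma integrable_dominated_r y : m1.-integrable setT (fun x => (f (x, y))%:E).
Proof.
apply: (@le_integrable _ _ _ m1 _ measurableT _ (EFin \o (fun x => a x * b y))).
- apply/measurable_EFinP; exact: (measurableT_comp mf (measurable_pair2 y)).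
- by move=> x _ /=; rewrite lee_fin (le_trans (fab x y))// ler_norm.
- exact: (integrableZr measurableT (b y) ia).
Qed.

Lemma Rfubini : \int[m1]_x \int[m2]_y f (x, y) = \int[m2]_y \int[m1]_x f (x, y).
Proof.
rewrite /Rintegral; congr fine.
under eq_integral do
  rewrite fineK ?(integrable_fin_num measurableT (integrable_dominated_l _))//.
under [RHS]eq_integral do
  rewrite fineK ?(integrable_fin_num measurableT (integrable_dominated_r _))//.
exact: (Fubini integrable_prod_dominated).
Qed.

Lemma measurable_Rfubini : measurable_fun setT (fun x => \int[m2]_y f (x, y)).
Proof.
apply: (@measurableT_comp _ _ _ _ _ _ fine) => //.
exact: (measurable_fubini_F integrable_prod_dominated).
Qed.

End real_fubini.

Section laplace_tuple.
Context {R : realType}.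
Local Notation leb := (@lebesgue_measure R).

Definition laplace_prod n (x : n.-tuple R) : R := \prod_(i < n) expR (- `|tnth x i|).
Definition cauchy_prod n (u : n.-tuple R) : R := \prod_(i < n) (2 / (1 + tnth u i ^+ 2)).

Lemma cauchy_factor_bounds (u : R) : 0 <= 2 / (1 + u ^+ 2) <= 2.
Proof.
have u1 : 1 <= 1 + u ^+ 2 by rewrite lerDl sqr_ge0.
have u0 : 0 < 1 + u ^+ 2 by rewrite (lt_le_trans _ u1).
by rewrite divr_ge0 ?(ltW u0)//= ler_pdivrMr// ler_peMr.
Qed.

Lemma cauchy_bounds n (u : n.-tuple R) : 0 <= cauchy_prod u <= 2 ^+ n.
Proof.
apply/andP; split.
  by apply: prodr_ge0 => i _; have /andP[] := cauchy_factor_bounds (tnth u i).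
rewrite -[in leRHS](card_ord n) -prodr_const.
by apply: ler_prod => i _; exact: cauchy_factor_bounds.
Qed.

Lemma laplace_bounds n (x : n.-tuple R) : 0 <= laplace_prod x <= 1.
Proof.
apply/andP; split; first by apply: prodr_ge0 => i _; exact: expR_ge0.
apply: prodr_ile1 => i _; rewrite expR_ge0 -expR0 ler_expR oppr_le0.
exact: normr_ge0.
Qed.

Lemma measurable_laplace n : measurable_fun setT (@laplace_prod n).
Proof.
apply: measurable_prod => i _; apply: measurableT_comp; first exact: measurable_expR.
by do 2 apply: measurableT_comp => //; exact: measurable_tnth.
Qed.

Lemma measurable_cauchy1 : measurable_fun setT (fun x : R => 2 / (1 + x ^+ 2)).
Proof.
apply: continuous_measurable_fun => x; apply: cvgM; first exact: cvg_cst.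
apply: cvgV; first by rewrite gt_eqF// ltr_pwDl// sqr_ge0.
apply: cvgD; first exact: cvg_cst.
exact: exprn_continuous.
Qed.

Lemma measurable_cauchy n : measurable_fun setT (@cauchy_prod n).
Proof.
apply: measurable_prod => i _.
exact: (measurableT_comp measurable_cauchy1 (measurable_tnth i)).
Qed.

Lemma measurable_cos : measurable_fun setT (@cos R).
Proof. exact: (continuous_measurable_fun (@continuous_cos R)). Qed.

Lemma integral_cauchy_tuple n :
  (\int[lebesgue_tuple n]_u (cauchy_prod u)%:E = ((2 * pi) ^+ n)%:E)%E.
Proof.
apply: (@ge0_integral_prod R n (fun x => 2 / (1 + x ^+ 2))).
- exact: measurable_cauchy1.
- by move=> x; have /andP[] := cauchy_factor_bounds x.
- exact: integral_cauchy.
Qed.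

Lemma integral_laplace_cst : (\int[leb]_x (expR (- `|x|))%:E = 2%:E)%E.
Proof.
have := @integral_laplace_even R 0 0; rewrite normr0 ler01 mul0r addr0 => <-//.
by apply: eq_integral => x _; rewrite mul0r addr0 mulr1.
Qed.

Lemma integral_laplace_tuple n :
  (\int[lebesgue_tuple n]_u (laplace_prod u)%:E = (2 ^+ n)%:E)%E.
Proof.
apply: (@ge0_integral_prod R n (fun x => expR (- `|x|))).
- apply: measurableT_comp; first exact: measurable_expR.
  by apply: measurableT_comp.
- by move=> x; exact: expR_ge0.
- exact: integral_laplace_cst.
Qed.

Lemma tnth_cons0 n (z : measurableTypeR R * n.-tuple R) :
  tnth (tuple_cons z) ord0 = z.1.
Proof. by rewrite tnth0. Qed.

Lemma tnth_consS n (z : measurableTypeR R * n.-tuple R) i :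
  tnth (tuple_cons z) (lift ord0 i) = tnth z.2 i.
Proof. by rewrite tnthS; congr tnth; exact/val_inj. Qed.

(** Induction on the dimension: the phase absorbs the coordinate being split
off. *)
Lemma integral_laplace_cos n (theta : R) (u : n.-tuple R) :
  (\int[lebesgue_tuple n]_x (laplace_prod x * (1 + cos (theta + dotp x u)))%:E =
   (2 ^+ n + cos theta * cauchy_prod u)%:E)%E.
Proof.
have cos1 (y : R) : 0 <= 1 + cos y by have := cos_geN1 y; lra.
have ge0 k (v : k.-tuple R) t x : 0 <= laplace_prod x * (1 + cos (t + dotp x v)).
  have /andP[l0 _] := laplace_bounds x; exact: mulr_ge0 l0 (cos1 _).
have meas k (v : k.-tuple R) t :
    measurable_fun setT (fun x => (laplace_prod x * (1 + cos (t + dotp x v)))%:E).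
  apply/measurable_EFinP; apply: measurable_funM; first exact: measurable_laplace.
  apply: measurable_funD => //; apply: (measurableT_comp measurable_cos).
  by apply: measurable_funD => //; exact: measurable_dotp_l.
elim: n theta u => [|n IH] theta u.
  rewrite integral_lebesgue_tuple0//; last by move=> x; rewrite lee_fin.
  by rewrite /laplace_prod /cauchy_prod /dotp !big_ord0 addr0 mul1r mulr1.
rewrite ge0_integral_lebesgue_tupleS//; last by move=> x; rewrite lee_fin.
have [u0 [v ->]] : exists (u0 : R) (v : n.-tuple R), u = tuple_cons (u0, v).
  by exists (thead u), [tuple of behead u]; exact: tuple_cons_eta.
have /andP[c0 c2] := cauchy_bounds v.
pose A (x : R) := expR (- `|x|); pose B (x : R) := expR (- `|x|) * (1 + cos (theta + u0 * x)).
have A0 x : (0 <= (A x)%:E)%E by rewrite lee_fin expR_ge0.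
have B0 x : (0 <= (B x)%:E)%E.
  by rewrite lee_fin; exact: mulr_ge0 (expR_ge0 _) (cos1 _).
have mA : measurable_fun setT (EFin \o A).
  apply/measurable_EFinP; apply: measurableT_comp; first exact: measurable_expR.
  by apply: measurableT_comp.
have mB : measurable_fun setT (EFin \o B).
  apply/measurable_EFinP; apply: measurable_funM; first exact/measurable_EFinP.
  apply: measurable_funD => //; apply: (measurableT_comp measurable_cos).
  by apply: measurable_funD => //; exact: measurable_funM.
(* the inner integral, evaluated by induction at the phase [theta + u0 x], is
   split into two nonnegative multiples of known integrals *)
transitivity (\int[leb]_x ((2 ^+ n - cauchy_prod v)%:E * (A x)%:E +
    (cauchy_prod v)%:E * (B x)%:E))%E.
  apply: eq_integral => x _.
  transitivity ((expR (- `|x|))%:E *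
     \int[lebesgue_tuple n]_y (laplace_prod y * (1 + cos (theta + u0 * x + dotp y v)))%:E)%E.
    rewrite -ge0_integralZl//.
    - apply: eq_integral => y _; rewrite -EFinM /laplace_prod big_ord_recl tnth_cons0/=.
      rewrite -mulrA; congr (_ * (_ * (1 + cos _)))%:E.
        by apply: eq_bigr => i _; rewrite tnth_consS.
      rewrite /dotp big_ord_recl !tnth_cons0/= addrA (mulrC x); congr (_ + _).
      by apply: eq_bigr => i _; rewrite !tnth_consS.
    - exact: meas.
    - by move=> y _; rewrite lee_fin.
  rewrite IH -!EFinM -EFinD /A /B; congr EFin; ring.
rewrite ge0_integralD//.
- rewrite !ge0_integralZl// ?lee_fin ?subr_ge0//.
  rewrite integral_laplace_cst (integral_laplace theta u0) -!EFinM -EFinD; congr EFin.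
  rewrite /cauchy_prod [in RHS]big_ord_recl tnth_cons0.
  rewrite [in RHS](eq_bigr (fun i => 2 / (1 + tnth v i ^+ 2))); last first.
    by move=> i _; rewrite tnth_consS.
  by rewrite (exprS 2 n) /=; ring.
- by move=> x _; rewrite mule_ge0// lee_fin subr_ge0.
- by apply: emeasurable_funM.
- by move=> x _; rewrite mule_ge0// lee_fin.
- by apply: emeasurable_funM.
Qed.

End laplace_tuple.

(** * Scaled kernels and positivity *)

Section real_dominated.
Context d {T : measurableType d} {R : realType} (mu : {measure set T -> \bar R}).

Lemma le_Rintegrable (f g : T -> R) : measurable_fun setT f ->
  (forall x, `|f x| <= g x) -> mu.-integrable setT (EFin \o g) ->
  mu.-integrable setT (EFin \o f).
Proof.
move=> mf fg; apply: le_integrable => //; first exact/measurable_EFinP.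
by move=> x _ /=; rewrite lee_fin (le_trans (fg x))// ler_norm.
Qed.

Lemma Rdominated_cvg (F : nat -> T -> R) (f g : T -> R) :
  (forall k, measurable_fun setT (F k)) ->
  (forall x, F k x @[k --> \oo] --> f x) ->
  mu.-integrable setT (EFin \o g) -> (forall k x, `|F k x| <= g x) ->
  \int[mu]_x F k x @[k --> \oo] --> \int[mu]_x f x.
Proof.
move=> mF Ff ig Fg.
have mf : measurable_fun setT f by apply: measurable_fun_cvg mF _ => x _; exact: Ff.
have fg x : `|f x| <= g x.
  have h := @closed_cvg _ _ \oo _ (fun k => `|F k x|) _ (@closed_le R (g x)).
  by apply: (h _ _ _ (cvg_norm (Ff x))); apply: nearW => k; exact: Fg.
have intf := le_Rintegrable mf fg ig.
apply: fine_cvg; rewrite fineK; last exact: integrable_fin_num intf.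
apply: (@dominated_cvg _ _ _ mu _ measurableT _ _ (EFin \o g)) => //.
- by move=> k; apply/measurable_EFinP; exact: mF.
- by move=> x _; apply: cvg_EFin; [exact: nearW|exact: Ff].
- by move=> k x _; rewrite /= lee_fin.
Qed.

Lemma Rintegral_EFin (f : T -> R) (c : R) :
  (\int[mu]_x (f x)%:E = c%:E)%E -> \int[mu]_x f x = c.
Proof. by rewrite /Rintegral => ->. Qed.

Lemma ge0_integral_integrable (f : T -> R) (c : R) : measurable_fun setT f ->
  (forall x, 0 <= f x) -> (\int[mu]_x (f x)%:E = c%:E)%E ->
  mu.-integrable setT (EFin \o f).
Proof.
move=> mf f0 fc; apply/integrableP; split; first exact/measurable_EFinP.
under eq_integral do rewrite /= ger0_norm//.
by rewrite fc ltry.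
Qed.

End real_dominated.

Section scaled_laplace.
Context {R : realType} {n : nat}.
Local Notation E := (n.-tuple R).
Local Notation W := (@lebesgue_tuple R n).

Lemma scalet_afft a (x : E) : scalet a x = afft a zerot x.
Proof. by apply: eq_from_tnth => i; rewrite !tnth_mktuple addr0. Qed.

Lemma measurable_scalet a : measurable_fun setT (@scalet R n a).
Proof.
under [scalet a]funext do rewrite scalet_afft.
exact: measurable_afft_y.
Qed.

Lemma cauchy_prod_ge0 (z : E) : 0 <= cauchy_prod z.
Proof. by have /andP[] := cauchy_bounds z. Qed.

Lemma integrable_cauchy_prod : W.-integrable setT (EFin \o @cauchy_prod R n).
Proof.
apply: ge0_integral_integrable (integral_cauchy_tuple n).
  exact: measurable_cauchy.
exact: cauchy_prod_ge0.
Qed.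

Variable del : R.
Hypothesis del0 : 0 < del.

Lemma measurable_laplace_scaled :
  measurable_fun setT (fun x : E => laplace_prod (scalet del x)).
Proof. exact: measurableT_comp (@measurable_laplace R n) (measurable_scalet _). Qed.

Lemma integral_laplace_scaled :
  (\int[W]_x (laplace_prod (scalet del x))%:E = (del ^- n * 2 ^+ n)%:E)%E.
Proof.
have d0 : del != 0 by rewrite gt_eqF.
have h := ge0_integral_afft zerot d0 (g := fun y : E => (laplace_prod y)%:E).
rewrite EFinM -(integral_laplace_tuple n) -h.
- rewrite muleA -EFinM gtr0_norm// mulVf ?expf_neq0// mul1e.
  by apply: eq_integral => x _; rewrite scalet_afft.
- by apply/measurable_EFinP; exact: measurable_laplace.
- by move=> x; rewrite lee_fin; have /andP[] := laplace_bounds x.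
Qed.

Lemma integrable_laplace_scaled :
  W.-integrable setT (EFin \o (fun x => laplace_prod (scalet del x))).
Proof.
apply: ge0_integral_integrable integral_laplace_scaled.
  exact: measurable_laplace_scaled.
by move=> x; have /andP[] := laplace_bounds (scalet del x).
Qed.

Lemma measurable_cos_dotp theta (u : E) :
  measurable_fun setT (fun x : E => cos (theta + dotp x u)).
Proof.
apply: (measurableT_comp (@measurable_cos R)).
by apply: measurable_funD => //; exact: measurable_dotp_l.
Qed.

Lemma integrable_laplace_scaled_cos theta (u : E) : W.-integrable setT
  (EFin \o (fun x => laplace_prod (scalet del x) * cos (theta + dotp x u))).
Proof.
apply: le_Rintegrable integrable_laplace_scaled.
  apply: measurable_funM; first exact: measurable_laplace_scaled.
  exact: measurable_cos_dotp.
move=> x; have /andP[l0 _] := laplace_bounds (scalet del x).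
by rewrite normrM ger0_norm// ler_piMr// cos_max.
Qed.

(** The change of variables by [del] is made on the nonnegative integrand with
[1 + cos]; the kernel itself is then subtracted. *)
Lemma Rintegral_laplace_scaled_cos theta (u : E) :
  \int[W]_x (laplace_prod (scalet del x) * cos (theta + dotp x u)) =
  del ^- n * (cos theta * cauchy_prod (scalet del^-1 u)).
Proof.
have d0 : del != 0 by rewrite gt_eqF.
have cos1 (y : R) : 0 <= 1 + cos y by have := cos_geN1 y; lra.
pose G (y : E) := laplace_prod y * (1 + cos (theta + dotp y (scalet del^-1 u))).
have G0 y : 0 <= G y.
  by have /andP[l0 _] := laplace_bounds y; exact: mulr_ge0 l0 (cos1 _).
have mG : measurable_fun setT (EFin \o G).
  apply/measurable_EFinP; apply: measurable_funM; first exact: measurable_laplace.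
  by apply: measurable_funD => //; exact: measurable_cos_dotp.
have h := ge0_integral_afft zerot d0 mG G0.
have : (\int[W]_x (G (scalet del x))%:E =
    (del ^- n * (2 ^+ n + cos theta * cauchy_prod (scalet del^-1 u)))%:E)%E.
  rewrite EFinM -integral_laplace_cos -[X in (_ * X)%E]h.
  rewrite muleA -EFinM gtr0_norm// mulVf ?expf_neq0// mul1e.
  by apply: eq_integral => x _; rewrite scalet_afft.
move/Rintegral_EFin => hG.
have hl := Rintegral_EFin integral_laplace_scaled.
transitivity (\int[W]_x (G (scalet del x) - laplace_prod (scalet del x))).
  apply: eq_Rintegral => x _; rewrite /G dotpZr dotpZl mulrA mulVf// mul1r.
  by ring.
rewrite RintegralB//; last exact: integrable_laplace_scaled.
  by rewrite hG hl; ring.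
have -> : (fun x => G (scalet del x)) = (fun x => laplace_prod (scalet del x) +
    laplace_prod (scalet del x) * cos (theta + dotp x u)).
  by apply/funext => x; rewrite /G dotpZr dotpZl mulrA mulVf// mul1r; ring.
exact: (integrableD measurableT integrable_laplace_scaled
  (integrable_laplace_scaled_cos theta u)).
Qed.

End scaled_laplace.

Section fourier_inversion.
Context {R : realType} {n : nat}.
Local Notation E := (n.-tuple R).
Local Notation W := (@lebesgue_tuple R n).

Lemma measurable_laplace_cos (del : R) (x : E) : measurable_fun setT
  (fun u : E => laplace_prod (scalet del u) * cos (dotp u x)).
Proof.
apply: measurable_funM; first exact: measurable_laplace_scaled.
apply: (measurableT_comp (@measurable_cos R)); exact: measurable_dotp_l.
Qed.

Lemma integrable_posdef_laplace (f : E -> R) (del : R) (x : E) : 0 < del ->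
  posdef f -> W.-integrable setT
    (EFin \o (fun u => f u * (laplace_prod (scalet del u) * cos (dotp u x)))).
Proof.
move=> d0 pf; have [M fM] := posdef_bounded pf.
apply: (le_Rintegrable (g := fun u => M * laplace_prod (scalet del u))).
- apply: measurable_funM; first exact: posdef_measurable.
  exact: measurable_laplace_cos.
- move=> u; have /andP[l0 _] := laplace_bounds (scalet del u).
  rewrite !normrM (ger0_norm l0) ler_pM ?mulr_ge0//.
  by rewrite ler_piMr ?cos_max.
- exact: (integrableZl measurableT M (integrable_laplace_scaled d0)).
Qed.

(** Induction on the generation of [f]. For a cosine the integral is, by the
product formula, a sum of two values of the Cauchy kernel; the other rules
preserve the inequality by linearity and dominated convergence. *)
Lemma posdef_integral_ge0 (f : E -> R) (del : R) (x : E) : 0 < del -> posdef f ->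
  0 <= \int[W]_u (f u * (laplace_prod (scalet del u) * cos (dotp u x))).
Proof.
move=> d0 pf; elim: pf x => [z|{}f g pf IHf pg IHg|c {}f c0 pf IH|F {}f M pF IH FM Ff] x.
- have icos v := integrable_laplace_scaled_cos d0 0 (v : E).
  have -> : \int[W]_u (cos (dotp u z) * (laplace_prod (scalet del u) * cos (dotp u x)))
    = 2^-1 * (\int[W]_u (laplace_prod (scalet del u) * cos (0 + dotp u (addt z x))) +
      \int[W]_u (laplace_prod (scalet del u) * cos (0 + dotp u (subt z x)))).
    rewrite -RintegralD// -RintegralZl//; last exact: (integrableD measurableT (icos _) (icos _)).
    apply: eq_Rintegral => u _; rewrite dotpDr dotpBr !add0r cosD cosB.
    by field.
  rewrite !Rintegral_laplace_scaled_cos// cos0 !mul1r.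
  rewrite mulr_ge0 ?invr_ge0// addr_ge0// mulr_ge0 ?invr_ge0 ?exprn_ge0 ?(ltW d0)//.
    by have /andP[] := cauchy_bounds (scalet del^-1 (addt z x)).
  by have /andP[] := cauchy_bounds (scalet del^-1 (subt z x)).
- have h v : \int[W]_u ((f u + g u) * (laplace_prod (scalet del u) * cos (dotp u v)))
    = \int[W]_u (f u * (laplace_prod (scalet del u) * cos (dotp u v))) +
      \int[W]_u (g u * (laplace_prod (scalet del u) * cos (dotp u v))).
    rewrite -RintegralD//; try exact: integrable_posdef_laplace.
    by apply: eq_Rintegral => u _; rewrite mulrDl.
  by rewrite h addr_ge0.
- have -> : \int[W]_u ((c * f u) * (laplace_prod (scalet del u) * cos (dotp u x)))
    = c * \int[W]_u (f u * (laplace_prod (scalet del u) * cos (dotp u x))).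
    rewrite -RintegralZl//; last exact: integrable_posdef_laplace.
    by apply: eq_Rintegral => u _; rewrite mulrA.
  by rewrite mulr_ge0.
- have lim : \int[W]_u (F k u * (laplace_prod (scalet del u) * cos (dotp u x))) @[k --> \oo]
     --> \int[W]_u (f u * (laplace_prod (scalet del u) * cos (dotp u x))).
    apply: (Rdominated_cvg (g := fun u => M * laplace_prod (scalet del u))).
    + move=> k; apply: measurable_funM; first exact: posdef_measurable.
      exact: measurable_laplace_cos.
    + by move=> u; apply: cvgM (Ff u) _; exact: cvg_cst.
    + exact: (integrableZl measurableT M (integrable_laplace_scaled d0)).
    + move=> k u; have /andP[l0 _] := laplace_bounds (scalet del u).
      rewrite !normrM (ger0_norm l0) ler_pM ?mulr_ge0//.
      by rewrite ler_piMr ?cos_max.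
  have h := @closed_cvg _ _ \oo _ _ _ (@closed_ge R 0).
  by apply: (h _ _ _ _ lim); apply: nearW => k; exact: IH.
Qed.

End fourier_inversion.

(** * Fourier inversion *)

Section inverse_fourier.
Context {R : realType} {n : nat}.
Local Notation E := (n.-tuple R).
Local Notation W := (@lebesgue_tuple R n).

Lemma fourier_const_sqr : fourier_const R n ^+ 2 = ((2 * pi) ^+ n)^-1.
Proof.
have p0 : 0 < 2 * pi :> R by rewrite mulr_gt0// pi_gt0.
rewrite /fourier_const -powR_mulrn ?powR_ge0// -powRrM mulNr divfK ?pnatr_eq0//.
by rewrite powRN powR_mulrn// ltW.
Qed.

Lemma fourier_const_sqr_gt0 : 0 < fourier_const R n ^+ 2.
Proof. by rewrite fourier_const_sqr invr_gt0 exprn_gt0// mulr_gt0// pi_gt0. Qed.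

(** What Fourier inversion uses about [phi]. Continuity is only asked along
[u + z / k], in the form in which dominated convergence consumes it. *)
Definition char_fun (phi : E -> R) :=
  [/\ posdef phi, forall u, 0 <= phi u, W.-integrable setT (EFin \o phi),
      forall u, phi (scalet (-1) u) = phi u &
      forall u z, phi (afft k.+1%:R^-1 u z) @[k --> \oo] --> phi u].

(** The inverse Fourier transform of an even real function, hence a cosine
transform. *)
Definition invft (phi : E -> R) (x : E) : R :=
  fourier_const R n ^+ 2 * \int[W]_u (cos (dotp u x) * phi u).

Lemma measurable_cos_dotp_pair :
  measurable_fun setT (fun xu : E * E => cos (dotp xu.2 xu.1)).
Proof.
apply: (measurableT_comp (@measurable_cos R)).
under eq_fun do rewrite dotpC.
exact: measurable_dotp.
Qed.

Section inversion.
Variable phi : E -> R.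
Hypothesis cphi : char_fun phi.

Let mphi : measurable_fun setT phi.
Proof. by case: cphi => pphi _ _ _ _; exact: posdef_measurable. Qed.
Let phi0 u : 0 <= phi u. Proof. by case: cphi. Qed.
Let iphi : W.-integrable setT (EFin \o phi). Proof. by case: cphi. Qed.
Let phiN u : phi (scalet (-1) u) = phi u. Proof. by case: cphi. Qed.

Lemma integrable_cos_phi x : W.-integrable setT
  (EFin \o (fun u => cos (dotp u x) * phi u)).
Proof.
apply: le_Rintegrable iphi.
  apply: measurable_funM => //.
  apply: (measurableT_comp (@measurable_cos R)); exact: measurable_dotp_l.
by move=> u; rewrite normrM (ger0_norm (phi0 u)) ler_piMl// cos_max.
Qed.

(** Adding the constant 1 to the cosine makes the integrand nonnegative, which
is what the measurability part of Tonelli's theorem requires. *)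
Lemma measurable_invft : measurable_fun setT (invft phi).
Proof.
apply: measurable_funM => //.
have -> : (fun x => \int[W]_u (cos (dotp u x) * phi u)) =
    (fun x => fine (\int[W]_u ((1 + cos (dotp u x)) * phi u)%:E)%E - \int[W]_u phi u).
  apply/funext => x; rewrite -[fine _]/(\int[W]_u ((1 + cos (dotp u x)) * phi u)).
  have -> : \int[W]_u ((1 + cos (dotp u x)) * phi u) =
      \int[W]_u (phi u + cos (dotp u x) * phi u).
    by apply: eq_Rintegral => u _; rewrite mulrDl mul1r.
  by rewrite RintegralD//; [rewrite addrC addKr|exact: integrable_cos_phi].
apply: measurable_funB => //.
apply: (@measurableT_comp _ _ _ _ _ _ fine) => //.
apply: (measurable_fun_fubini_tonelli_F
  (fun xu : E * E => ((1 + cos (dotp xu.2 xu.1)) * phi xu.2)%:E)).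
  apply/measurable_EFinP; apply: measurable_funM.
    by apply: measurable_funD => //; exact: measurable_cos_dotp_pair.
  exact: measurableT_comp.
by move=> [x u]; rewrite lee_fin mulr_ge0.
Qed.

Lemma cvg_laplace_harmonic (x : E) :
  laplace_prod (scalet k.+1%:R^-1 x) @[k --> \oo] --> (1 : R).
Proof.
have laplaceE : forall k : nat, expR (- (k.+1%:R^-1 * \sum_(i < n) `|tnth x i|)) =
    laplace_prod (scalet k.+1%:R^-1 x).
  move=> k; rewrite /laplace_prod mulr_sumr -sumrN expR_sum.
  apply: eq_bigr => i _; rewrite tnth_mktuple normrM.
  by rewrite ger0_norm// invr_ge0.
have -> : (fun k => laplace_prod (scalet k.+1%:R^-1 x)) =
    (fun k => expR (- (k.+1%:R^-1 * \sum_(i < n) `|tnth x i|))).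
  by apply/funext => k; rewrite laplaceE.
rewrite -[X in _ --> X](@expR0 R).
have h : - (k.+1%:R^-1 * \sum_(i < n) `|tnth x i|) @[k --> \oo] --> (0 : R).
  rewrite -[X in _ --> X]oppr0; apply: cvgN.
  rewrite -[X in _ --> X](mul0r (\sum_(i < n) `|tnth x i|)).
  by apply: cvgM; [exact: cvg_harmonic|exact: cvg_cst].
exact: (cvg_comp _ _ h (@continuous_expR R 0)).
Qed.

(** The limit, as the damping by the Laplace kernel vanishes, of the
nonnegative integrals of [posdef_integral_ge0]. *)
Lemma invft_ge0 x : 0 <= invft phi x.
Proof.
rewrite mulr_ge0 ?sqr_ge0//.
have lim : \int[W]_u (phi u * (laplace_prod (scalet k.+1%:R^-1 u) * cos (dotp u x)))
    @[k --> \oo] --> \int[W]_u (phi u * (1 * cos (dotp u x))).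
  apply: (Rdominated_cvg (g := phi)) => //.
  - by move=> k; apply: measurable_funM => //; exact: measurable_laplace_cos.
  - move=> u; apply: cvgM; first exact: cvg_cst.
    by apply: cvgM; [exact: cvg_laplace_harmonic|exact: cvg_cst].
  - move=> k u; have /andP[l0 l1] := laplace_bounds (scalet k.+1%:R^-1 u).
    rewrite !normrM (ger0_norm l0) (ger0_norm (phi0 u)) ler_piMr//.
    by rewrite -[leRHS]mul1r ler_pM// cos_max.
have h := @closed_cvg _ _ \oo _ _ _ (@closed_ge R 0).
have -> : \int[W]_u (cos (dotp u x) * phi u) = \int[W]_u (phi u * (1 * cos (dotp u x))).
  by apply: eq_Rintegral => u _; rewrite mul1r mulrC.
apply: (h _ _ _ _ lim); apply: nearW => k.
by apply: posdef_integral_ge0; [rewrite invr_gt0|case: cphi].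
Qed.

Lemma invft_bound x : `|invft phi x| <= fourier_const R n ^+ 2 * \int[W]_u phi u.
Proof.
rewrite normrM ger0_norm ?sqr_ge0// ler_wpM2l ?sqr_ge0//.
have ic := integrable_cos_phi x.
apply: le_trans (le_normr_Rintegral measurableT ic) _.
apply: le_Rintegral => //.
  exact: (integrable_norm ic).
by move=> u _; rewrite normrM (ger0_norm (phi0 u)) ler_piMl// cos_max.
Qed.

(** By Fubini's theorem the damped Fourier transform of [invft phi] is the
average of [phi] around [u] and [- u] against a Cauchy kernel of width
[del]. *)
Lemma invft_laplace (del theta : R) (u : E) : 0 < del ->
  \int[W]_x (invft phi x * (laplace_prod (scalet del x) * cos (theta + dotp x u))) =
  cos theta * (fourier_const R n ^+ 2 *
    \int[W]_z ((phi (afft del u z) + phi (afft del (scalet (-1) u) z)) / 2 *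
      cauchy_prod z)).
Proof.
move=> d0.
pose f (xw : E * E) := laplace_prod (scalet del xw.1) * cos (theta + dotp xw.1 u) *
  (cos (dotp xw.2 xw.1) * phi xw.2).
have mf : measurable_fun setT f.
  apply: measurable_funM.
    have m1 := measurable_funM (measurable_laplace_scaled del)
      (measurable_cos_dotp theta u).
    exact: (measurableT_comp m1 measurable_fst).
  apply: measurable_funM; first exact: measurable_cos_dotp_pair.
  exact: measurableT_comp.
have il := integrable_laplace_scaled d0 (n := n).
have fab x w : `|f (x, w)| <= laplace_prod (scalet del x) * phi w.
  have /andP[l0 _] := laplace_bounds (scalet del x).
  rewrite /f /= !normrM (ger0_norm l0) (ger0_norm (phi0 w)) ler_pM ?mulr_ge0//.
    by rewrite ler_piMr ?cos_max.
  by rewrite ler_piMl ?cos_max.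
have fub := Rfubini mf il iphi fab.
have ic t v := integrable_laplace_scaled_cos d0 t (v : E).
transitivity (fourier_const R n ^+ 2 * \int[W]_x \int[W]_w f (x, w)).
  rewrite -RintegralZl//; last first.
    pose C := \int[W]_u phi u.
    apply: (le_Rintegrable (g := fun x => C * laplace_prod (scalet del x))).
    - exact: measurable_Rfubini mf il iphi fab.
    - move=> x; have /andP[l0 _] := laplace_bounds (scalet del x).
      have -> : \int[W]_w f (x, w) = laplace_prod (scalet del x) *
          cos (theta + dotp x u) * \int[W]_w (cos (dotp w x) * phi w).
        by rewrite -RintegralZl//; exact: integrable_cos_phi.
      rewrite mulrC normrM ler_pM//; last first.
        by rewrite normrM ger0_norm// ler_piMr// cos_max.
      have := invft_bound x; rewrite normrM ger0_norm ?sqr_ge0//.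
      by rewrite (ler_pM2l fourier_const_sqr_gt0).
    - exact: (integrableZl measurableT C il).
  apply: eq_Rintegral => x _; rewrite /invft -mulrA; congr (_ * _).
  by rewrite mulrC -RintegralZl//; exact: integrable_cos_phi.
rewrite mulrCA fub; congr (_ * _).
(* [G v] is [h v] after the substitution [w = v + del z] *)
pose h v z := phi (afft del v z) / 2 * cauchy_prod z.
pose G v w := phi w / 2 * (del ^- n * cauchy_prod (scalet del^-1 (subt w v))).
have [M phiM] : exists M : R, forall u, `|phi u| <= M.
  by case: cphi => pphi _ _ _ _; exact: posdef_bounded.
have cp0 := @cauchy_prod_ge0 R n; have icp := @integrable_cauchy_prod R n.
have mh v : measurable_fun setT (h v).
  apply: measurable_funM; last exact: measurable_cauchy.
  by apply: measurable_funM => //; apply: measurableT_comp => //; exact: measurable_afft_y.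
have ih v : W.-integrable setT (EFin \o h v).
  apply: le_Rintegrable (integrableZl measurableT (M / 2) icp) => //.
  move=> z; rewrite /h /= normrM (ger0_norm (cp0 z)) ler_wpM2r//.
  by rewrite normrM [X in _ * X]ger0_norm// ler_wpM2r.
have msub v : measurable_fun setT (fun w : E => subt w v).
  have -> : (fun w : E => subt w v) = afft 1 (scalet (-1) v).
    by apply/funext => w; apply: eq_from_tnth => i; rewrite !tnth_mktuple mul1r mulN1r.
  exact: measurable_afft_y.
have mG v : measurable_fun setT (G v).
  apply: measurable_funM; first exact: measurable_funM.
  apply: measurable_funM => //; apply: (measurableT_comp (@measurable_cauchy R n)).
  exact: (measurableT_comp (measurable_scalet _) (msub v)).
have dn0 : 0 <= del ^- n by rewrite invr_ge0 exprn_ge0// ltW.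
have iG v : W.-integrable setT (EFin \o G v).
  apply: le_Rintegrable (integrableZl measurableT (2^-1 * (del ^- n * 2 ^+ n)) iphi) => //.
  move=> w; rewrite /G /=.
  rewrite ger0_norm; last by rewrite !mulr_ge0.
  rewrite [leRHS](_ : _ = phi w / 2 * (del ^- n * 2 ^+ n)); last by ring.
  rewrite ler_wpM2l ?divr_ge0// ler_wpM2l//.
  by have /andP[] := cauchy_bounds (scalet del^-1 (subt w v)).
have Gh v : \int[W]_w G v w = \int[W]_z h v z.
  have dnz : del != 0 by rewrite gt_eqF.
  have mGE : measurable_fun setT (EFin \o G v) by exact/measurable_EFinP.
  have G0 w : (0 <= (EFin \o G v) w)%E by rewrite lee_fin !mulr_ge0.
  rewrite /Rintegral; congr fine; rewrite -(ge0_integral_afft v dnz mGE G0).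
  have GE z : G v (afft del v z) = del ^- n * h v z.
    rewrite /G /h mulrCA; congr (_ * (_ * cauchy_prod _)).
    by apply: eq_from_tnth => i; rewrite !tnth_mktuple addrK mulKf.
  rewrite [X in (_ * X)%E](eq_integral (fun z => (del ^- n)%:E * (EFin \o h v) z)%E); last first.
    by move=> z _; rewrite /comp GE EFinM.
  rewrite (integralZl measurableT (ih v)) muleA -EFinM gtr0_norm// mulfV ?mul1e//.
  by rewrite expf_neq0.
transitivity (\int[W]_w (cos theta * (G u w + G (scalet (-1) u) w))).
  apply: eq_Rintegral => w _.
  pose v1 := addt u w; pose v2 := subt u w.
  have -> : \int[W]_x f (x, w) = phi w / 2 *
      (\int[W]_x (laplace_prod (scalet del x) * cos (theta + dotp x v1)) +
       \int[W]_x (laplace_prod (scalet del x) * cos (theta + dotp x v2))).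
    rewrite -RintegralD// -RintegralZl//; last exact: (integrableD measurableT (ic _ _) (ic _ _)).
    apply: eq_Rintegral => x _; rewrite /f /= dotpDr dotpBr (dotpC w x) addrA.
    rewrite [theta + (_ - _)]addrA (cosD (theta + dotp x u)) (cosB (theta + dotp x u)).
    by field.
  rewrite !Rintegral_laplace_scaled_cos// /G.
  have -> : cauchy_prod (scalet del^-1 (subt w u)) = cauchy_prod (scalet del^-1 v2).
    apply: eq_bigr => i _; rewrite !tnth_mktuple.
    by congr (_ / (1 + _)); ring.
  have -> : scalet del^-1 (subt w (scalet (-1) u)) = scalet del^-1 v1.
    by apply: eq_from_tnth => i; rewrite !tnth_mktuple mulN1r opprK addrC.
  ring.
rewrite RintegralZl//; last exact: (integrableD measurableT (iG _) (iG _)).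
congr (_ * _); rewrite RintegralD// !Gh -RintegralD//.
by apply: eq_Rintegral => z _; rewrite /h !mulrDl.
Qed.

(** The Cauchy kernels are an approximate identity, of total mass
[(2 pi)^n]. *)
Lemma cvg_invft_laplace theta (u : E) :
  \int[W]_x (invft phi x *
    (laplace_prod (scalet k.+1%:R^-1 x) * cos (theta + dotp x u)))
  @[k --> \oo] --> cos theta * phi u.
Proof.
have [M phiM] : exists M : R, forall u, `|phi u| <= M.
  by case: cphi => pphi _ _ _ _; exact: posdef_bounded.
have cp0 := @cauchy_prod_ge0 R n; have icp := @integrable_cauchy_prod R n.
have -> : cos theta * phi u = cos theta * (fourier_const R n ^+ 2 *
    \int[W]_z (phi u * cauchy_prod z)).
  rewrite RintegralZl// (Rintegral_EFin (integral_cauchy_tuple n)) fourier_const_sqr.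
  rewrite (mulrCA _ (phi u)) mulVf ?mulr1//.
  by rewrite expf_neq0// mulf_neq0// gt_eqF// pi_gt0.
under eq_cvg do rewrite invft_laplace ?invr_gt0//.
apply: cvgM; first exact: cvg_cst.
apply: cvgM; first exact: cvg_cst.
apply: (Rdominated_cvg (g := fun z => M * cauchy_prod z)).
- move=> k; apply: measurable_funM; last exact: measurable_cauchy.
  apply: measurable_funM => //; apply: measurable_funD.
    by apply: measurableT_comp => //; exact: measurable_afft_y.
  by apply: measurableT_comp => //; exact: measurable_afft_y.
- move=> z; apply: cvgM; last exact: cvg_cst.
  have -> : phi u = (phi u + phi u) / 2 by field.
  apply: cvgM; last exact: cvg_cst.
  have [_ _ _ _ cphi_] := cphi.
  by apply: cvgD; [exact: cphi_|rewrite -[X in _ --> X]phiN; exact: cphi_].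
- exact: (integrableZl measurableT M icp).
- move=> k z; rewrite normrM (ger0_norm (cp0 z)) ler_wpM2r//.
  rewrite normrM [X in _ * X]ger0_norm// ler_pdivrMr// mulr_natr mulr2n.
  by rewrite (le_trans (ler_normD _ _))// lerD.
Qed.

(** Fatou's lemma: the damped integrals stay bounded because they converge to
[phi 0]; this is where the positivity of [invft phi] matters. *)
Lemma integrable_invft : W.-integrable setT (EFin \o invft phi).
Proof.
pose F k x := invft phi x * laplace_prod (scalet k.+1%:R^-1 x).
have F0 k x : 0 <= F k x.
  by have /andP[l0 _] := laplace_bounds (scalet k.+1%:R^-1 x); rewrite mulr_ge0 ?invft_ge0.
have mF k : measurable_fun setT (EFin \o F k).
  apply/measurable_EFinP; apply: measurable_funM; first exact: measurable_invft.
  exact: measurable_laplace_scaled.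
have iF k : (\int[W]_x (F k x)%:E)%E = (\int[W]_x F k x)%:E.
  rewrite /Rintegral fineK//; apply: integrable_fin_num => //.
  pose C := fourier_const R n ^+ 2 * \int[W]_u phi u.
  have d0 : 0 < k.+1%:R^-1 :> R by rewrite invr_gt0.
  apply: (le_Rintegrable _ _ (integrableZl measurableT C (integrable_laplace_scaled d0))).
    exact/measurable_EFinP.
  move=> x; have /andP[l0 _] := laplace_bounds (scalet k.+1%:R^-1 x).
  by rewrite normrM (ger0_norm l0) ler_wpM2r// invft_bound.
have limF : \int[W]_x F k x @[k --> \oo] --> phi zerot.
  have := @cvg_invft_laplace 0 zerot; rewrite cos0 mul1r; apply: cvg_trans.
  apply: near_eq_cvg; apply: nearW => k; apply: eq_Rintegral => x _.
  by rewrite dotp0r addr0 cos0 mulr1.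
have limE : (\int[W]_x (F k x)%:E)%E @[k --> \oo] --> (phi zerot)%:E.
  under eq_cvg do rewrite iF.
  by apply: cvg_EFin => //; exact: nearW.
(* the pointwise limit of [F k] is [invft phi] *)
have := fatou W measurableT mF (fun k x _ => F0 k x).
rewrite (cvg_limn_einf_sup limE).1.
rewrite (eq_integral (EFin \o invft phi)); last first.
  move=> x _; apply: (cvg_limn_einf_sup _).1; apply: cvg_EFin; first exact: nearW.
  rewrite -[X in _ --> X]mulr1; apply: cvgM; first exact: cvg_cst.
  exact: cvg_laplace_harmonic.
move=> intle; apply/integrableP; split.
  by apply/measurable_EFinP; exact: measurable_invft.
under eq_integral do rewrite /= ger0_norm ?invft_ge0//.
by rewrite (le_lt_trans intle)// ltry.
Qed.

(** Fourier inversion, with a phase: both sides are the limit of the damped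
integrals. *)
Lemma invft_cos theta (u : E) :
  \int[W]_x (invft phi x * cos (theta + dotp x u)) = cos theta * phi u.
Proof.
have lim1 := @cvg_invft_laplace theta u.
have lim2 : \int[W]_x (invft phi x *
    (laplace_prod (scalet k.+1%:R^-1 x) * cos (theta + dotp x u)))
    @[k --> \oo] --> \int[W]_x (invft phi x * (1 * cos (theta + dotp x u))).
  apply: (Rdominated_cvg (g := invft phi)) => //.
  - move=> k; apply: measurable_funM; first exact: measurable_invft.
    apply: measurable_funM; first exact: measurable_laplace_scaled.
    exact: measurable_cos_dotp.
  - move=> x; apply: cvgM; first exact: cvg_cst.
    by apply: cvgM; [exact: cvg_laplace_harmonic|exact: cvg_cst].
  - exact: integrable_invft.
  - move=> k x; have /andP[l0 l1] := laplace_bounds (scalet k.+1%:R^-1 x).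
    move: (invft phi x) (invft_ge0 x) => K K0.
    rewrite !normrM (ger0_norm l0) (ger0_norm K0) ler_piMr//.
    by rewrite -[leRHS]mul1r ler_pM// cos_max.
have -> : \int[W]_x (invft phi x * cos (theta + dotp x u)) =
    \int[W]_x (invft phi x * (1 * cos (theta + dotp x u))).
  by apply: eq_Rintegral => x _; rewrite mul1r.
exact: (cvg_unique _ lim2 lim1).
Qed.

Lemma invft_total : \int[W]_x invft phi x = phi zerot.
Proof.
rewrite -[RHS]mul1r -cos0 -invft_cos; apply: eq_Rintegral => x _.
by rewrite dotp0r addr0 cos0 mulr1.
Qed.

End inversion.

(** Fubini's theorem and inversion for [psi]. *)
Lemma invft_conv (phi psi : E -> R) (x : E) : char_fun phi -> char_fun psi ->
  \int[W]_y (invft phi (subt x y) * invft psi y) =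
  invft (fun u => phi u * psi u) x.
Proof.
move=> cphi cpsi.
have [_ phi0 iphi _ _] := cphi.
have ipsi := integrable_invft cpsi.
pose f (yu : E * E) := invft psi yu.1 * (cos (dotp yu.2 (subt x yu.1)) * phi yu.2).
have mf : measurable_fun setT f.
  apply: measurable_funM.
    exact: (measurableT_comp (measurable_invft cpsi) measurable_fst).
  apply: measurable_funM; last first.
    by apply: (measurableT_comp _ measurable_snd); apply/measurable_EFinP; case/integrableP: iphi.
  apply: (measurableT_comp (@measurable_cos R)).
  under eq_fun do rewrite dotpBr.
  apply: measurable_funB.
    exact: (measurableT_comp (measurable_dotp_l x) measurable_snd).
  under eq_fun do rewrite dotpC.
  exact: measurable_dotp.
have fab y u : `|f (y, u)| <= invft psi y * phi u.
  rewrite /f /=; move: (invft psi y) (invft_ge0 cpsi y) => K K0.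
  by rewrite !normrM (ger0_norm K0) (ger0_norm (phi0 u)) ler_wpM2l// ler_piMl// cos_max.
have fub := Rfubini mf ipsi iphi fab.
have fE y : \int[W]_u f (y, u) =
    invft psi y * \int[W]_u (cos (dotp u (subt x y)) * phi u).
  by rewrite -RintegralZl//; exact: integrable_cos_phi.
transitivity (fourier_const R n ^+ 2 * \int[W]_y \int[W]_u f (y, u)).
  rewrite -RintegralZl//; last first.
    apply: (le_Rintegrable _ _ (integrableZl measurableT (\int[W]_u phi u) ipsi)).
      exact: measurable_Rfubini mf ipsi iphi fab.
    move=> y; rewrite fE normrM (ger0_norm (invft_ge0 cpsi y)) mulrC ler_wpM2r ?invft_ge0//.
    have := invft_bound cphi (subt x y); rewrite normrM ger0_norm ?sqr_ge0//.
    by rewrite (ler_pM2l fourier_const_sqr_gt0).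
  apply: eq_Rintegral => y _; rewrite {1}/invft -mulrA; congr (_ * _).
  by rewrite fE mulrC.
rewrite fub /invft; congr (_ * _); apply: eq_Rintegral => u _.
rewrite /f /=.
transitivity (phi u * \int[W]_y (invft psi y * cos (- dotp u x + dotp y u))).
  rewrite -RintegralZl//; last first.
    apply: le_Rintegrable ipsi.
      apply: measurable_funM; first exact: measurable_invft.
      exact: measurable_cos_dotp.
    move=> y; rewrite normrM (ger0_norm (invft_ge0 cpsi y)).
    by rewrite ler_piMr ?invft_ge0// cos_max.
  apply: eq_Rintegral => y _; rewrite dotpBr -cosN opprB (addrC (dotp u y)) (dotpC u y).
  by ring.
by rewrite invft_cos// cosN; ring.
Qed.

End inverse_fourier.

(** * Densities and characteristic functions of stable laws *)

Section density_probability.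
Context d {T : measurableType d} {R : realType}.
Variables (mu : {sigma_finite_measure set T -> \bar R}) (k : T -> R).
Hypotheses (mk : measurable_fun setT k) (k0 : forall x, 0 <= k x)
  (k1 : (\int[mu]_x (k x)%:E = 1)%E).

Definition density_measure (A : set T) : \bar R := (\int[mu]_(x in A) (k x)%:E)%E.

Let density0 : density_measure set0 = 0%E.
Proof. exact: integral_set0. Qed.

Let density_ge0 A : (0 <= density_measure A)%E.
Proof. by apply: integral_ge0 => x _; rewrite lee_fin. Qed.

Let density_sigma_additive : semi_sigma_additive density_measure.
Proof.
move=> /= F mF tF mUF; rewrite /density_measure; apply: cvg_toP.
  apply: ereal_nondecreasing_is_cvgn => m n mn.
  apply: lee_sum_nneg_natr => // i _ _.
  by apply: integral_ge0 => /= x _; rewrite lee_fin.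
rewrite ge0_integral_bigcup//=.
- by apply/measurable_EFinP; exact: measurable_funTS.
- by move=> x _; rewrite lee_fin.
Qed.

HB.instance Definition _ := isMeasure.Build _ _ _ density_measure
  density0 density_ge0 density_sigma_additive.

Let density_setT : density_measure setT = 1%:E.
Proof. exact: k1. Qed.

HB.instance Definition _ := @Measure_isProbability.Build _ _ R
  density_measure density_setT.

Definition density_prob : probability T R := density_measure.

(** By uniqueness the Radon-Nikodym derivative is [k]. *)
Lemma ge0_integral_density (g : T -> \bar R) : measurable_fun setT g ->
  (forall x, 0 <= g x)%E ->
  (\int[density_prob]_x g x = \int[mu]_x (g x * (k x)%:E))%E.
Proof.
move=> mg g0.
have mkE : measurable_fun setT (EFin \o k) by exact/measurable_EFinP.
have dom : density_prob `<< mu.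
  apply/null_content_dominatesP => A mA A0.
  by apply: null_set_integral => //; exact: measurable_funTS.
rewrite -(Radon_Nikodym_SigmaFinite.change_of_variables dom g0 measurableT mg).
have iRN := Radon_Nikodym_SigmaFinite.f_integrable dom.
have mRN := measurable_int _ iRN.
have ae := integral_ae_eq measurableT iRN mkE.
have {}ae : ae_eq mu setT (Radon_Nikodym_SigmaFinite.f density_prob mu) (EFin \o k).
  apply: ae => A _ mA.
  by rewrite -(Radon_Nikodym_SigmaFinite.f_integral dom mA).
apply: ge0_ae_eq_integral => //.
- exact: emeasurable_funM.
- exact: emeasurable_funM.
- by move=> x _; rewrite mule_ge0//; exact: Radon_Nikodym_SigmaFinite.f_ge0.
- by move=> x _; rewrite mule_ge0// lee_fin.
- by apply: filterS ae => x h Dx; rewrite h.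
Qed.

End density_probability.

Section stable_law.
Context {R : realType} {n : nat}.
Local Notation E := (n.-tuple R).
Local Notation W := (@lebesgue_tuple R n).
Variable alpha : R.
Hypotheses (n_gt0 : (0 < n)%N) (alpha02 : 0 < alpha < 2).

Let alpha0 : 0 < alpha. Proof. by have /andP[] := alpha02. Qed.

Definition stable_char (t : R) (u : E) : R := expR (- t * enorm u `^ alpha).

Lemma enorm_scalet a (u : E) : enorm (scalet a u) = `|a| * enorm u.
Proof.
by rewrite /enorm dotpZl dotpZr mulrA sqrtrM -expr2 ?sqr_ge0// sqrtr_sqr.
Qed.

(** The exponential beats any power: [(y / k)^k <= exp y] with [k] such that
[alpha k >= 2]. *)
Lemma expR_stable_le (c : R) : 0 < c ->
  exists2 C : R, 0 <= C &
    forall x : R, expR (- (c * `|x| `^ alpha)) <= C * (2 / (1 + x ^+ 2)).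
Proof.
move=> c0.
(* large enough for [(|x|^alpha)^k] to dominate [x^2] when [|x| >= 1] *)
pose k := (Num.truncn (2 / alpha)).+1.
have k2 : 2 <= alpha * k%:R.
  by rewrite mulrC -ler_pdivrMr// ltW// truncnS_gt.
have k0 : 0 < k%:R :> R by rewrite ltr0n.
pose D := (k%:R / c) ^+ k.
have D0 : 0 <= D by rewrite exprn_ge0// divr_ge0 ?ltW.
exists (1 + D); first by rewrite addr_ge0.
move=> x.
have x1 : 0 < 1 + x ^+ 2 by rewrite ltr_pwDl// sqr_ge0.
set y := c * _.
suff h : 1 + x ^+ 2 <= (1 + D) * 2 * expR y.
  by rewrite mulrA ler_pdivlMr// expRN mulrC ler_pdivrMr ?expR_gt0.
have y0 : 0 <= y by rewrite mulr_ge0 ?powR_ge0 ?ltW.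
have ey1 : 1 <= expR y by rewrite -expR0 ler_expR.
have De : 0 <= D * expR y by rewrite mulr_ge0 ?expR_ge0.
have [xle|xge] := leP `|x| 1.
  have x21 : x ^+ 2 <= 1 by rewrite -real_normK ?num_real// expr_le1.
  by lra.
have x2 : x ^+ 2 <= D * expR y.
  have eyk : (y / k%:R) ^+ k <= expR y.
    have -> : expR y = expR (y / k%:R) ^+ k.
      by rewrite -expRM_natl mulrC divfK// gt_eqF.
    rewrite lerXn2r ?nnegrE ?expR_ge0 ?divr_ge0 ?(ltW k0)//.
    by apply: le_trans (expR_ge1Dx _); rewrite lerDr.
  apply: le_trans (ler_wpM2l D0 eyk).
  have -> : D * (y / k%:R) ^+ k = (`|x| `^ alpha) ^+ k.
    rewrite /D -exprMn /y; congr (_ ^+ _); field.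
    by rewrite !gt_eqF.
  rewrite -[in leRHS]powR_mulrn ?powR_ge0// -[in leRHS]powRrM -real_normK ?num_real//.
  rewrite -powR_mulrn//; apply: ler_powR => //; exact: ltW.
by lra.
Qed.

(** As [|u|^alpha] dominates the mean of the [|u_i|^alpha], the characteristic
function is bounded by a product of functions of one coordinate. *)
Lemma stable_char_le (t : R) : 0 < t -> exists2 C : R, 0 <= C &
  forall u, stable_char t u <= C * cauchy_prod u.
Proof.
move=> t0; have n0 : 0 < n%:R :> R by rewrite ltr0n.
have [C C0 Cle] := expR_stable_le (divr_gt0 t0 n0).
exists (C ^+ n); first exact: exprn_ge0.
move=> u; rewrite -[X in C ^+ X](card_ord n) -prodr_const -big_split/=.
apply: (@le_trans _ _ (\prod_(i < n) expR (- (t / n%:R * `|tnth u i| `^ alpha)))).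
  rewrite -expR_sum ler_expR sumrN -mulr_sumr mulNr lerN2.
  rewrite mulrAC -mulrA ler_wpM2l ?(ltW t0)// ler_pdivrMr//.
  rewrite -[n in n%:R](card_ord n) mulr_natr -sumr_const.
  apply: ler_sum => i _; apply: ge0_ler_powR; rewrite ?nnegrE ?(ltW alpha0)//.
    exact: sqrtr_ge0.
  rewrite -sqrtr_sqr ler_sqrt ?dotp_ge0// /dotp (bigD1 i)//= -expr2 lerDl.
  by apply: sumr_ge0 => j _; rewrite -expr2 sqr_ge0.
by apply: ler_prod => i _; rewrite expR_ge0/= Cle.
Qed.

(** Integrability comes from the Cauchy bound, positive definiteness from
[posdef_stable]. *)
Lemma stable_char_fun (t : R) : 0 < t -> char_fun (stable_char t).
Proof.
move=> t0; have p := @posdef_stable R n alpha t alpha02 (ltW t0).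
split.
- exact: p.
- by move=> u; exact: expR_ge0.
- have [C C0 Cle] := stable_char_le t0.
  apply: (le_Rintegrable _ _ (integrableZl measurableT C
    (@integrable_cauchy_prod R n))).
    exact: posdef_measurable.
  by move=> u; rewrite ger0_norm ?expR_ge0// Cle.
- by move=> u; rewrite /stable_char enorm_scalet normrN1 mul1r.
- move=> u z; rewrite /stable_char.
  have h : (- t * enorm (afft k.+1%:R^-1 u z) `^ alpha) @[k --> \oo] -->
      - t * enorm u `^ alpha.
    apply: cvgM; first exact: cvg_cst.
    rewrite enorm_powR; under eq_cvg do rewrite enorm_powR.
    apply: cvg_powR_base; rewrite ?divr_gt0// ?dotp_ge0//.
      by move=> k; exact: dotp_ge0.
    have -> : (fun k : nat => dotp (afft k.+1%:R^-1 u z) (afft k.+1%:R^-1 u z)) =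
      (fun k : nat => (k.+1%:R^-1 * k.+1%:R^-1) * dotp z z +
          (k.+1%:R^-1 * (2 * dotp z u) + dotp u u)).
      apply/funext => k; rewrite /dotp !mulr_sumr -!big_split/=.
      by apply: eq_bigr => i _; rewrite !tnth_mktuple; ring.
    have hh := @cvg_harmonic R.
    have := cvgD (cvgM (cvgM hh hh) (cvg_cst (dotp z z)))
      (cvgD (cvgM hh (cvg_cst (2 * dotp z u))) (cvg_cst (dotp u u))).
    by rewrite !mul0r !add0r => h; apply: h; exact: eventually_filter.
  exact: (cvg_comp _ _ h (@continuous_expR R _)).
Qed.

Lemma stable_densityE t (x : E) :
  stable_density alpha t x = invft (stable_char t) x.
Proof.
rewrite /stable_density /invft /fourier /cintegral expr2 -mulrA; congr (_ * _).
rewrite /= mul0r subr0; congr (_ * _).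
apply: eq_Rintegral => u _ /=.
by rewrite mulr0 subr0 cosN.
Qed.

End stable_law.

(** * Stable laws and their scaling *)

Section stable_semigroup.
Context {R : realType} {n : nat}.
Local Notation E := (n.-tuple R).
Local Notation W := (@lebesgue_tuple R n).
Variable alpha : R.
Hypotheses (n_gt0 : (0 < n)%N) (alpha02 : 0 < alpha < 2).
Local Notation K := (@stable_density R n alpha).

Let alpha0 : 0 < alpha. Proof. by have /andP[] := alpha02. Qed.

Section fixed_time.
Variable t : R.
Hypothesis t0 : 0 < t.

Let cft : char_fun (stable_char (n := n) alpha t).
Proof. exact: stable_char_fun. Qed.

Lemma stable_density_fun : K t = invft (stable_char alpha t).
Proof. by apply/funext => x; exact: stable_densityE. Qed.

Lemma measurable_stable_density : measurable_fun setT (K t).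
Proof. by rewrite stable_density_fun; exact: measurable_invft. Qed.

Lemma stable_density_ge0 x : 0 <= K t x.
Proof. by rewrite stable_density_fun; exact: invft_ge0. Qed.

Lemma integrable_stable_density : W.-integrable setT (EFin \o K t).
Proof. by rewrite stable_density_fun; exact: integrable_invft. Qed.

Lemma integral_stable_density : (\int[W]_x (K t x)%:E = 1)%E.
Proof.
have := integrable_fin_num measurableT integrable_stable_density.
move/fineK => <-; congr EFin.
rewrite -[LHS]/(\int[W]_x K t x) stable_density_fun invft_total// /stable_char.
have -> : enorm (zerot : E) = 0.
  by rewrite /enorm dotp0r sqrtr0.
by rewrite powR0 ?gt_eqF// mulr0 expR0.
Qed.

Definition stable_law : probability E R :=
  density_prob measurable_stable_density stable_density_ge0 integral_stable_density.

Lemma ge0_integral_stable_law (g : E -> \bar R) : measurable_fun setT g ->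
  (forall x, 0 <= g x)%E ->
  (\int[stable_law]_x g x = \int[W]_x (g x * (K t x)%:E))%E.
Proof. by move=> mg g0; exact: ge0_integral_density. Qed.

Lemma stable_densityN x : K t (scalet (-1) x) = K t x.
Proof.
rewrite stable_density_fun /invft; congr (_ * _); apply: eq_Rintegral => u _.
by rewrite dotpZr mulN1r cosN.
Qed.

(** Reflection and translation, the density being even. *)
Lemma ge0_integral_stable_subt (g : E -> \bar R) (x : E) :
  measurable_fun setT g -> (forall y, 0 <= g y)%E ->
  (\int[W]_y ((K t (subt x y))%:E * g y) = \int[stable_law]_y g (addt x y))%E.
Proof.
move=> mg g0.
have addE : addt x = afft 1 x.
  by apply/funext => y; apply: eq_from_tnth => i; rewrite !tnth_mktuple mul1r addrC.
have subE : subt x = afft (-1) x.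
  by apply/funext => y; apply: eq_from_tnth => i; rewrite !tnth_mktuple mulN1r addrC.
have mK := measurable_stable_density.
have mKg : measurable_fun setT (fun y => (K t (subt x y))%:E * g y)%E.
  apply: emeasurable_funM => //; apply/measurable_EFinP.
  by rewrite subE; exact: (measurableT_comp mK (measurable_afft_y _ _)).
rewrite ge0_integral_stable_law; last by move=> y; exact: g0.
  rewrite -(@ge0_integral_afft _ _ 1 x _ _ mKg) ?oner_eq0//; last first.
    by move=> y; rewrite mule_ge0// lee_fin; exact: stable_density_ge0.
  rewrite normr1 expr1n mul1e -addE; apply: eq_integral => y _.
  rewrite muleC; congr (_ * _%:E)%E; rewrite -[RHS]stable_densityN; congr (K t _).
  by apply: eq_from_tnth => i; rewrite !tnth_mktuple; ring.
by rewrite addE; exact: (measurableT_comp mg (measurable_afft_y _ _)).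
Qed.

End fixed_time.

(** Self-similarity is read off the characteristic function and carried over
by the change of variables [u := lam u]. As in [measurable_invft], 1 is added
to the cosine so as to change variables in nonnegative integrals only. *)
Lemma stable_density_scale (s lam : R) (x : E) : 0 < s -> 0 < lam ->
  K s x = lam ^+ n * K (lam `^ alpha * s) (scalet lam x).
Proof.
move=> s0 l0; have ls0 : 0 < lam `^ alpha * s by rewrite mulr_gt0 ?powR_gt0.
have charE u : stable_char alpha (lam `^ alpha * s) u = stable_char alpha s (scalet lam u).
  rewrite /stable_char enorm_scalet gtr0_norm// powRM ?sqrtr_ge0 ?(ltW l0)//.
  by congr expR; ring.
have Rint_scale (g : E -> R) : measurable_fun setT g -> (forall u, 0 <= g u) ->
    lam ^+ n * \int[W]_u g (scalet lam u) = \int[W]_u g u.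
  move=> mg g0; have mgE : measurable_fun setT (EFin \o g) by exact/measurable_EFinP.
  rewrite /Rintegral -(@ge0_integral_afft _ _ lam zerot _ _ mgE) ?gt_eqF//.
  rewrite gtr0_norm//.
  under [in RHS]eq_integral do rewrite /= -scalet_afft.
  have ln0 : 0 < lam ^+ n by exact: exprn_gt0.
  case: (\int[W]_u _)%E => [r||] /=; rewrite ?mulr0//.
  - by rewrite gt0_muley ?lte_fin.
  - by rewrite gt0_muleNy ?lte_fin.
have cs := stable_char_fun n_gt0 alpha02 s0.
have cls := stable_char_fun n_gt0 alpha02 ls0.
have [ps ps0 is_ _ _] := cs; have [pl pl0 il _ _] := cls.
have mps := posdef_measurable ps.
pose g u := (1 + cos (dotp u x)) * stable_char alpha s u.
have g0 u : 0 <= g u.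
  by apply: mulr_ge0 (ps0 u); have := cos_geN1 (dotp u x); lra.
have mg : measurable_fun setT g.
  apply: measurable_funM => //; apply: measurable_funD => //.
  apply: (measurableT_comp (@measurable_cos R)); exact: measurable_dotp_l.
have icos := integrable_cos_phi cs x.
have intgE : \int[W]_u (cos (dotp u x) * stable_char alpha s u) =
    \int[W]_u g u - \int[W]_u stable_char alpha s u.
  have -> : \int[W]_u g u =
      \int[W]_u (stable_char alpha s u + cos (dotp u x) * stable_char alpha s u).
    by apply: eq_Rintegral => u _; rewrite /g mulrDl mul1r.
  by rewrite RintegralD// addrC addKr.
rewrite !stable_densityE /invft mulrCA; congr (_ * _).
rewrite intgE -(Rint_scale g)// -(Rint_scale (stable_char alpha s))//.
rewrite -mulrBr; congr (_ * _).
have icosl := integrable_cos_phi cls (scalet lam x).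
have E1 : \int[W]_u g (scalet lam u) =
    \int[W]_u stable_char alpha (lam `^ alpha * s) u +
    \int[W]_u (cos (dotp u (scalet lam x)) * stable_char alpha (lam `^ alpha * s) u).
  rewrite -(RintegralD measurableT il icosl).
  by apply: eq_Rintegral => u _; rewrite /g dotpZl dotpZr charE mulrDl mul1r.
have E2 : \int[W]_u stable_char alpha s (scalet lam u) =
    \int[W]_u stable_char alpha (lam `^ alpha * s) u.
  by apply: eq_Rintegral => u _; rewrite charE.
rewrite [X in X - _ = _]E1 [X in _ - X = _]E2.
by rewrite addrAC subrr add0r.
Qed.
End stable_semigroup.

(** * The stable convolution semigroup *)

Section stable_averaging.
Context {R : realType} {n : nat}.
Local Notation E := (n.-tuple R).
Local Notation W := (@lebesgue_tuple R n).
Variable alpha : R.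
Hypotheses (n_gt0 : (0 < n)%N) (alpha02 : 0 < alpha < 2).
Local Notation K := (@stable_density R n alpha).
Local Notation law t0 := (stable_law n_gt0 alpha02 t0).

Lemma measurable_act_addt : measurable_act (@addt R n).
Proof.
rewrite /measurable_act.
have -> : (fun zy : E * E => addt zy.1 zy.2) = (fun zy => afft 1 zy.1 zy.2).
  by apply/funext => y; apply: eq_from_tnth => i; rewrite !tnth_mktuple mul1r addrC.
exact: (measurableT_comp (@measurable_afft R n) (measurable_pair1 (1 : R))).
Qed.

Lemma addtC (x y : E) : addt x y = addt y x.
Proof. by apply: eq_from_tnth => i; rewrite !tnth_mktuple addrC. Qed.

Lemma addtA (x y z : E) : addt x (addt y z) = addt (addt x y) z.
Proof. by apply: eq_from_tnth => i; rewrite !tnth_mktuple addrA. Qed.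

Lemma add0t (x : E) : addt zerot x = x.
Proof. by apply: eq_from_tnth => i; rewrite !tnth_mktuple add0r. Qed.

Lemma measurable_subt_pair : measurable_fun setT (fun zy : E * E => subt zy.1 zy.2).
Proof.
have -> : (fun zy : E * E => subt zy.1 zy.2) = (fun zy => afft (-1) zy.1 zy.2).
  by apply/funext => y; apply: eq_from_tnth => i; rewrite !tnth_mktuple mulN1r addrC.
exact: (measurableT_comp (@measurable_afft R n) (measurable_pair1 (-1 : R))).
Qed.

Lemma avg_stableE (t : R) (t0 : 0 < t) (g : E -> R) x : bounded_pos g ->
  ((avg (law t0) addt g x)%:E = \int[W]_y ((K t (subt x y) * g y)%:E))%E.
Proof.
move=> bg; have mg := bounded_pos_measurable bg.
have g0 y : (0 <= (g y)%:E)%E by rewrite lee_fin ltW// (bounded_pos_gt0 _ bg).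
have mgE : measurable_fun setT (EFin \o g) by exact/measurable_EFinP.
under eq_integral do rewrite EFinM.
rewrite (ge0_integral_stable_subt n_gt0 alpha02 t0 x mgE g0).
exact: EFin_Rintegral_bounded_pos (bounded_pos_act x measurable_act_addt bg).
Qed.

(** The product of the characteristic functions is that of time [s + r]. *)
Lemma stable_density_conv (s r : R) (x z : E) : 0 < s -> 0 < r ->
  (\int[W]_y (K s (subt x y) * K r (subt y z))%:E = (K (s + r) (subt x z))%:E)%E.
Proof.
move=> s0 r0.
have Ks0 := stable_density_ge0 n_gt0 alpha02 s0.
have Kr0 := stable_density_ge0 n_gt0 alpha02 r0.
have mKs := measurable_stable_density n_gt0 alpha02 s0.
have mKr := measurable_stable_density n_gt0 alpha02 r0.
have cs := stable_char_fun n_gt0 alpha02 s0.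
have cr := stable_char_fun n_gt0 alpha02 r0.
pose g y := (K s (subt x y) * K r (subt y z))%:E.
have msx : measurable_fun setT (fun y : E => subt x y).
  exact: (measurableT_comp measurable_subt_pair (measurable_pair1 x)).
have msz : measurable_fun setT (fun y : E => subt y z).
  exact: (measurableT_comp measurable_subt_pair (measurable_pair2 z)).
have mg : measurable_fun setT g.
  apply/measurable_EFinP; apply: measurable_funM.
    exact: (measurableT_comp mKs msx).
  exact: (measurableT_comp mKr msz).
have g0 y : (0 <= g y)%E by rewrite lee_fin mulr_ge0.
have one0 : (1 : R) != 0 by rewrite oner_eq0.
rewrite -(ge0_integral_afft z one0 mg g0) normr1 expr1n mul1e.
rewrite (eq_integral (fun y => (K s (subt (subt x z) y) * K r y)%:E)); last first.
  move=> y _; congr (K s _ * K r _)%:E; apply: eq_from_tnth => i; rewrite !tnth_mktuple; ring.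
have conv := invft_conv (subt x z) cs cr.
have charM : (fun u => stable_char alpha s u * stable_char alpha r u) =
    stable_char (n := n) alpha (s + r).
  by apply/funext => u; rewrite /stable_char -expRD; congr expR; ring.
rewrite charM -stable_densityE in conv.
rewrite -conv /Rintegral fineK.
  by apply: eq_integral => y _; rewrite !stable_densityE.
have iKr := integrable_invft cr.
pose C := fourier_const R n ^+ 2 * \int[W]_u stable_char alpha s u.
apply: integrable_fin_num => //.
apply: (le_Rintegrable _ _ (integrableZl measurableT C iKr)).
  apply: measurable_funM; last exact: measurable_invft.
  apply: (measurableT_comp (measurable_invft cs)).
  exact: (measurableT_comp measurable_subt_pair (measurable_pair1 (subt x z))).
move=> y; have := invft_bound cs (subt (subt x z) y); rewrite -/C => h.
move: (invft _ y) (invft_ge0 cr y) => k k0.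
by rewrite normrM (ger0_norm k0) ler_wpM2r.
Qed.

(** Tonelli's theorem and [stable_density_conv]. *)
Lemma avg_stable_add (s r sr : R) (s0 : 0 < s) (r0 : 0 < r) (sr0 : 0 < sr)
  (g : E -> R) x : sr = s + r -> bounded_pos g ->
  avg (law s0) addt (avg (law r0) addt g) x = avg (law sr0) addt g x.
Proof.
move=> srE bg; apply: EFin_inj.
have bavg := bounded_pos_avg (law r0) measurable_act_addt bg.
have E1 := avg_stableE s0 x bavg.
have E2 := avg_stableE sr0 x bg.
apply: (eq_trans E1); apply: (eq_trans _ (esym E2)) => {E1 E2}.
have Ks0 := stable_density_ge0 n_gt0 alpha02 s0.
have Kr0 := stable_density_ge0 n_gt0 alpha02 r0.
have mKs := measurable_stable_density n_gt0 alpha02 s0.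
have mKr := measurable_stable_density n_gt0 alpha02 r0.
have g0 y : 0 <= g y by rewrite ltW// (bounded_pos_gt0 _ bg).
have msx : measurable_fun setT (fun y : E => subt x y).
  exact: (measurableT_comp measurable_subt_pair (measurable_pair1 x)).
have mKsx := measurableT_comp mKs msx.
have mg := bounded_pos_measurable bg.
pose f (yz : E * E) := ((K s (subt x yz.1) * (K r (subt yz.1 yz.2) * g yz.2))%:E).
have mKryz := measurableT_comp mKr measurable_subt_pair.
have mf : measurable_fun setT f.
  apply/measurable_EFinP; apply: measurable_funM.
    exact: (measurableT_comp mKsx measurable_fst).
  apply: measurable_funM; first exact: mKryz.
  exact: (measurableT_comp mg measurable_snd).
have f0 yz : (0 <= f yz)%E by rewrite lee_fin; exact: mulr_ge0 (Ks0 _) (mulr_ge0 (Kr0 _) (g0 _)).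
transitivity (\int[W]_y \int[W]_z f (y, z))%E.
  apply: eq_integral => y _; rewrite EFinM (avg_stableE r0 y bg) -ge0_integralZl//.
  - apply/measurable_EFinP; apply: measurable_funM; last exact: mg.
    exact: (measurableT_comp mKryz (measurable_pair1 y)).
  - by move=> z _; rewrite lee_fin; exact: mulr_ge0 (Kr0 _) (g0 _).
  - by rewrite lee_fin; exact: Ks0.
rewrite (fubini_tonelli f mf f0); apply: eq_integral => z _.
rewrite /f /= srE [in RHS]EFinM -(stable_density_conv x z s0 r0).
rewrite -ge0_integralZr//.
- by apply: eq_integral => y _; rewrite -EFinM mulrA.
- apply/measurable_EFinP; apply: measurable_funM; first exact: mKsx.
  exact: (measurableT_comp mKryz (measurable_pair2 z)).
- by move=> y _; rewrite lee_fin; exact: mulr_ge0 (Ks0 _) (Kr0 _).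
- by rewrite lee_fin; exact: g0.
Qed.

Lemma iter_avg_stable (tau : R) (tau0 : 0 < tau) k (t : R) (t0 : 0 < t)
  (g : E -> R) x : (0 < k)%N -> t = k%:R * tau -> bounded_pos g ->
  iter k (avg (law tau0) addt) g x = avg (law t0) addt g x.
Proof.
move=> k0 tE bg; elim: k k0 t t0 tE x => [//|[|k] IH] _ t t0 tE x.
  by rewrite mul1r in tE; subst t; rewrite (bool_irrelevance t0 tau0).
have kt0 : 0 < k.+1%:R * tau by rewrite mulr_gt0.
rewrite iterS (_ : iter k.+1 (avg (law tau0) addt) g = avg (law kt0) addt g).
  by apply: avg_stable_add => //; rewrite tE -natr1 mulrDl mul1r addrC.
by apply/funext => y; exact: IH.
Qed.

End stable_averaging.

(** * Reverse hypercontractivity for bounded functions *)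

Section bounded_hypercontractivity.
Context {R : realType}.

(** Jensen's inequality, as the Hoelder inequality against the constant 1. *)
Lemma Rintegral_powR_le d (X : measurableType d) (P : probability X R)
  (h : X -> R) (q : R) : 0 <= q <= 1 -> bounded_pos h ->
  \int[P]_x (h x `^ q) <= (\int[P]_x h x) `^ q.
Proof.
move=> /andP[q0 q1] bh.
have bhq := bounded_pos_powR q bh.
have b1 : bounded_pos (fun _ : X => 1 : R) by apply: bounded_pos_cst.
rewrite -ler_ln ?posrE ?powR_gt0 ?Rintegral_bounded_pos_gt0// ln_powR.
pose g (b : bool) x := if b then h x else 1.
pose w (b : bool) := if b then q else 1 - q.
have := @ln_Rintegral_le _ _ X P bool xpredT w (fun x => h x `^ q) g bhq.
rewrite !big_bool /w /g /=.
have -> : ln (\int[P]_x (1 : R)) = 0.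
  suff -> : \int[P]_x (1 : R) = 1 by rewrite ln1.
  apply/eqP; rewrite eq_le andbC.
  by apply: Rintegral_probability_bounds => // x; rewrite lexx.
rewrite mulr0 addr0; apply.
- by case.
- by case; rewrite ?subr_ge0.
- by rewrite addrC subrK.
- by case.
- by move=> x; rewrite big_bool /= ln1 mulr0 addr0 ln_powR.
Qed.

Lemma ler0_archi (x c : R) (N : nat) : 0 <= c ->
  (forall M, (N < M)%N -> x <= c / M%:R) -> x <= 0.
Proof.
move=> c0 h; rewrite leNgt; apply/negP => x0.
pose M := (maxn N (Num.truncn (c / x))).+1.
have M0 : 0 < M%:R :> R by rewrite ltr0n.
have NM : (N < M)%N by rewrite ltnS leq_maxl.
have := h M NM; rewrite leNgt => /negP; apply.
rewrite ltr_pdivrMr// mulrC -ltr_pdivrMr//.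
apply: (lt_le_trans (truncnS_gt _)).
by rewrite ler_nat ltnS leq_maxr.
Qed.

(** For a ratio [k / m] slightly above [th] the hypothesis holds with an
exponent [q] slightly above [q2], determined by the same relation. Both
[q - q2] and the resulting loss are of order [1 / m]. *)
Lemma rational_approximation (L D th q1 q2 : R) (B : R -> R) :
  0 < th < 1 -> 0 < q1 < 1 -> 0 < q2 -> th * (1 - q2) * q1 = q2 * (1 - q1) ->
  (forall q, q2 <= q -> B q <= B q2 + (q - q2) * D) ->
  (forall (k m : nat) q, (0 < k < m)%N -> th < k%:R / m%:R -> 0 < q < 1 ->
    k%:R * (1 - q) * q1 = m%:R * q * (1 - q1) -> L <= q1 / q * B q) ->
  L <= q1 / q2 * B q2.
Proof.
move=> /andP[th0 th1] /andP[q10 q11] q20 hq Bq Lq.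
suff h : q2 * L - q1 * B q2 <= 0.
  by rewrite mulrAC ler_pdivlMr// mulrC; lra.
have q10' : 0 < 1 - q1 by rewrite subr_gt0.
pose N := Num.truncn ((1 - th)^-1).
apply: (@ler0_archi _ (q1 / (1 - q1) * `|q1 * D - L|) N).
  by rewrite mulr_ge0 ?divr_ge0// ltW.
move=> M NM.
have M0 : 0 < M%:R :> R by rewrite ltr0n (leq_ltn_trans _ NM).
(* the least ratio [k / M] above [th]; it exceeds [th] by at most [1 / M] *)
pose k := (Num.truncn (th * M%:R)).+1.
have thM0 : 0 <= th * M%:R by rewrite mulr_ge0 ?ltW.
have /andP[k1 k2] := truncn_itv thM0.
have kM : (k < M)%N.
  rewrite -(ltr_nat R); apply: (@le_lt_trans _ _ (th * M%:R + 1)).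
    by rewrite -natr1 lerD2r.
  have : (1 - th)^-1 < M%:R.
    by apply: (lt_le_trans (truncnS_gt _)); rewrite ler_nat.
  by rewrite -[X in X < _]mul1r ltr_pdivrMr ?subr_gt0//; lra.
pose rho : R := k%:R / M%:R.
have rhoM : rho * M%:R = k%:R by rewrite /rho divfK// gt_eqF.
have rhoth : th < rho by rewrite ltr_pdivlMr.
have rho1 : rho < 1 by rewrite ltr_pdivrMr// mul1r ltr_nat.
have rho_th : rho - th <= M%:R^-1.
  by rewrite lerBlDr ler_pdivrMr// mulrDl mulVf ?gt_eqF// addrC -natr1 lerD2r.
have rho0 : 0 < rho by exact: lt_trans rhoth.
have d0 : 0 < rho * q1 + (1 - q1) by rewrite addr_gt0// mulr_gt0.
have dth0 : 0 < th * q1 + (1 - q1) by rewrite addr_gt0// mulr_gt0.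
(* the solution of [rho (1 - q) q1 = q (1 - q1)] *)
pose q := rho * q1 / (rho * q1 + (1 - q1)).
have qE : q * (rho * q1 + (1 - q1)) = rho * q1 by rewrite /q divfK// gt_eqF.
have q0 : 0 < q by rewrite divr_gt0// mulr_gt0.
have q1' : q < 1 by rewrite ltr_pdivrMr// mul1r ltrDl.
have q2E : q2 * (th * q1 + (1 - q1)) = th * q1 by lra.
have diff : (q - q2) * ((rho * q1 + (1 - q1)) * (th * q1 + (1 - q1))) =
    (rho - th) * q1 * (1 - q1).
  transitivity (q * (rho * q1 + (1 - q1)) * (th * q1 + (1 - q1)) -
    q2 * (th * q1 + (1 - q1)) * (rho * q1 + (1 - q1))); first by ring.
  by rewrite qE q2E; ring.
have q2q : q2 <= q.
  rewrite -subr_ge0 -(@pmulr_lge0 _ ((rho * q1 + (1 - q1)) * (th * q1 + (1 - q1)))).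
    by rewrite diff !mulr_ge0 ?subr_ge0 ?(ltW q11) ?(ltW q10)// ltW.
  exact: mulr_gt0.
have qdiff : q - q2 <= q1 / (1 - q1) * M%:R^-1.
  have le1 : (q - q2) * ((1 - q1) * (1 - q1)) <= (rho - th) * q1 * (1 - q1).
    rewrite -diff ler_wpM2l ?subr_ge0//.
    by rewrite ler_pM ?(ltW q10')// lerDr mulr_ge0 ?ltW.
  have le2 : (q - q2) * (1 - q1) <= (rho - th) * q1.
    by rewrite -(ler_pM2r q10') -mulrA.
  rewrite mulrAC ler_pdivlMr//; apply: (le_trans le2).
  by rewrite mulrC ler_wpM2l// ltW.
have Mq : k%:R * (1 - q) * q1 = M%:R * q * (1 - q1).
  rewrite -rhoM.
  transitivity (M%:R * (rho * q1 - q * (rho * q1 + (1 - q1)) + q * (1 - q1))); first by ring.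
  by rewrite qE; ring.
have k0M : (0 < k < M)%N by [].
have q01 : 0 < q < 1 by rewrite q0.
have Lle := Lq k M q k0M rhoth q01 Mq.
have Lle' : q * L <= q1 * (B q2 + (q - q2) * D).
  apply: (@le_trans _ _ (q1 * B q)); last by rewrite ler_pM2l// Bq.
  by move: Lle; rewrite mulrAC ler_pdivlMr// mulrC.
apply: (@le_trans _ _ ((q - q2) * (q1 * D - L))); first by lra.
apply: (@le_trans _ _ ((q - q2) * `|q1 * D - L|)).
  by rewrite ler_wpM2l ?subr_ge0 ?ler_norm.
by rewrite mulrAC ler_wpM2r.
Qed.

Context {n : nat}.
Local Notation E := (n.-tuple R).
Variable alpha : R.
Hypotheses (n_gt0 : (0 < n)%N) (alpha02 : 0 < alpha < 2).
Local Notation law t0 := (stable_law n_gt0 alpha02 t0).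
Local Opaque stable_law.

Lemma Rintegral_law t (t0 : 0 < t) (g : E -> R) :
  \int[law t0]_y g y = avg (law t0) addt g zerot.
Proof. by apply: eq_Rintegral => y _; rewrite add0t. Qed.

(** The discrete inequality for the law at time [tau], iterated averages being
replaced by the semigroup. *)
Lemma rational_step (k m : nat) (tau A r s q1 q : R) (tau0 : 0 < tau)
  (A0 : 0 < A) (r0 : 0 < r) (s0 : 0 < s) (f : E -> R) :
  (0 < k < m)%N -> A = m%:R * tau -> r = k%:R * tau -> s = (m - k)%:R * tau ->
  0 < q1 < 1 -> 0 < q -> k%:R * (1 - q) * q1 = m%:R * q * (1 - q1) ->
  bounded_pos f ->
  ln (\int[law A0]_y (f y `^ q1)) <=
  q1 / q * ln (\int[law r0]_y ((avg (law s0) addt f y) `^ q)).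
Proof.
move=> /andP[k0 km] AE rE sE q101 q0 hq bf.
case: m km AE sE hq => [//|M] kM AE sE hq.
have kM' : (0 < k <= M.+1)%N by rewrite k0 ltnW.
have mact := @measurable_act_addt R n.
have := discrete_reverse_hypercontractivity (law tau0) mact (@addtC _ _)
  (@addtA _ _) zerot kM' q101 q0 hq bf.
rewrite (iter_avg_stable n_gt0 alpha02 tau0 A0 _ _ AE (bounded_pos_powR _ bf))//.
have -> : iter (M.+1 - k) (avg (law tau0) addt) f = avg (law s0) addt f.
  by apply/funext => y; apply: iter_avg_stable => //; rewrite subn_gt0.
have bH := bounded_pos_avg (law s0) mact bf.
rewrite (iter_avg_stable n_gt0 alpha02 tau0 r0 _ k0 rE (bounded_pos_powR _ bH)).
by rewrite -!Rintegral_law.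
Qed.

(** Jensen's inequality applied to the averaging over the time [del] that
passes from the outer to the inner average. *)
Lemma time_shift_step (r del r' s s' q : R) (r0 : 0 < r) (del0 : 0 < del)
  (r'0 : 0 < r') (s0 : 0 < s) (s'0 : 0 < s') (f : E -> R) :
  r' = r + del -> s = del + s' -> 0 <= q <= 1 -> bounded_pos f ->
  \int[law r'0]_y ((avg (law s'0) addt f y) `^ q) <=
  \int[law r0]_y ((avg (law s0) addt f y) `^ q).
Proof.
move=> rE sE q01 bf; have mact := @measurable_act_addt R n.
have bh := bounded_pos_avg (law s'0) mact bf.
have bhq := bounded_pos_powR q bh.
rewrite Rintegral_law.
rewrite -(avg_stable_add n_gt0 alpha02 r0 del0 r'0 _ rE bhq) -Rintegral_law.
apply: le_Rintegral => //.
- exact/bounded_pos_integrable/bounded_pos_avg.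
- exact/bounded_pos_integrable/bounded_pos_powR/bounded_pos_avg.
- move=> y _.
  rewrite -(avg_stable_add n_gt0 alpha02 del0 s'0 s0 y sE bf).
  apply: Rintegral_powR_le => //; exact: (bounded_pos_act y mact bh).
Qed.

(** The rational case at the times [k A / m > r], transported back to [r] by
[time_shift_step] and sent to the limit by [rational_approximation]. *)
Lemma bounded_reverse_hypercontractivity (A r s q1 q2 : R)
  (A0 : 0 < A) (r0 : 0 < r) (s0 : 0 < s) (f : E -> R) :
  A = r + s -> 0 < q1 < 1 -> 0 < q2 < 1 ->
  (1 - q2) * q1 * r = q2 * (1 - q1) * A -> bounded_pos f ->
  ln (\int[law A0]_y (f y `^ q1)) <=
  q1 / q2 * ln (\int[law r0]_y ((avg (law s0) addt f y) `^ q2)).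
Proof.
move=> AE /andP[q10 q11] /andP[q20 q21] hq bf.
have mact := @measurable_act_addt R n.
pose H := avg (law s0) addt f.
have bH : bounded_pos H by exact: bounded_pos_avg.
have int_gt0 t (t0 : 0 < t) g : bounded_pos g -> 0 < \int[law t0]_x g x.
  exact: Rintegral_bounded_pos_gt0.
have [mH [c [C [c0 HC]]]] := bH.
pose C' := Num.max C 1; have C'1 : 1 <= C' by rewrite le_max lexx orbT.
have C'0 : 0 < C' by exact: lt_le_trans C'1.
have HC' y : 0 < H y <= C'.
  by have /andP[cH HC''] := HC y; rewrite (lt_le_trans c0 cH) le_max HC''.
have lnle (x y : R) : 0 < x -> x <= y -> ln x <= ln y.
  by move=> x0 xy; rewrite ler_ln ?posrE// (lt_le_trans x0).
have rA : r < A by rewrite AE ltrDl.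
have bHq q : bounded_pos (fun y => H y `^ q) by exact: bounded_pos_powR.
have iHq q := bounded_pos_integrable (law r0) (bHq q).
apply: (@rational_approximation _ (ln C') (r / A) q1 q2
  (fun q => ln (\int[law r0]_y (H y `^ q)))).
- by rewrite divr_gt0//= ltr_pdivrMr// mul1r.
- by rewrite q10.
- exact: q20.
- apply: (mulIf (x := A)); first by rewrite gt_eqF.
  by rewrite -hq; field; rewrite gt_eqF.
(* [H^q <= C'^(q - q2) H^q2] for [q >= q2] *)
- move=> q q2q; rewrite -ln_powR -lnM ?posrE ?powR_gt0 ?int_gt0//.
  rewrite ler_ln ?posrE ?mulr_gt0 ?powR_gt0 ?int_gt0//.
  rewrite mulrC -(RintegralZl _ measurableT (iHq q2)); apply: le_Rintegral => //.
  + exact: (integrableZl measurableT _ (iHq q2)).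
  + move=> y _; have /andP[Hy0 HyC] := HC' y.
    have -> : H y `^ q = H y `^ (q - q2) * H y `^ q2.
      by rewrite -powRD ?subrK//; apply/implyP => _; rewrite gt_eqF.
    rewrite ler_wpM2r ?powR_ge0//.
    by apply: ge0_ler_powR; rewrite ?nnegrE ?subr_ge0// ltW.
- move=> k m q /[dup] km /andP[k0 km'] rm /andP[q0 q1'] hq'.
  have m0 : 0 < m%:R :> R by rewrite ltr0n (ltn_trans k0).
  have tau0 : 0 < A / m%:R by exact: divr_gt0.
  have r'0 : 0 < k%:R * (A / m%:R) by rewrite mulr_gt0// ltr0n.
  have s'0 : 0 < (m - k)%:R * (A / m%:R) by rewrite mulr_gt0// ltr0n subn_gt0.
  have del0 : 0 < k%:R * (A / m%:R) - r.
    by rewrite subr_gt0 mulrCA -ltr_pdivrMl// mulrC.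
  have AE' : A = m%:R * (A / m%:R) by rewrite mulrC divfK// gt_eqF.
  have q101 : 0 < q1 < 1 by rewrite q10.
  apply: le_trans (rational_step tau0 A0 r'0 s'0 km AE' erefl erefl q101 q0 hq' bf) _.
  apply: ler_wpM2l; first exact: divr_ge0 (ltW q10) (ltW q0).
  have bH' : bounded_pos (avg (law s'0) addt f) by exact: bounded_pos_avg.
  have bHq' : bounded_pos (fun y => avg (law s'0) addt f y `^ q).
    exact: bounded_pos_powR.
  apply: (lnle _ _ (int_gt0 _ r'0 _ bHq')).
  apply: (time_shift_step r0 del0 r'0 s0 s'0 _ _ _ bf).
  + by rewrite addrC subrK.
  + rewrite natrB; last exact: ltnW.
    have -> : s = A - r by rewrite AE addrC addKr.
    by rewrite {1}AE'; ring.
  + by rewrite !ltW.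
Qed.

End bounded_hypercontractivity.

(** * Reverse hypercontractivity for positive functions *)

Section unbounded_hypercontractivity.
Context {R : realType}.

(** Each of [a / (a + b)] and [b / (a + b)] is at most its own power [q]. *)
Lemma powR_subadditive (a b q : R) : 0 <= a -> 0 < b -> 0 < q <= 1 ->
  (a + b) `^ q <= a `^ q + b `^ q.
Proof.
rewrite le_eqVlt => /predU1P[<- b0 /andP[q0 _]|a0 b0 /andP[q0 q1]].
  by rewrite add0r powR0 ?gt_eqF// add0r.
have ab0 : 0 < a + b by rewrite addr_gt0.
have part (x : R) : 0 < x -> x <= a + b -> x / (a + b) <= x `^ q / (a + b) `^ q.
  move=> x0 xab; have -> : x `^ q / (a + b) `^ q = (x / (a + b)) `^ q.
    rewrite powRM ?(ltW x0) ?invr_ge0 ?(ltW ab0)// -(powR_inv1 (ltW ab0)).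
    by rewrite -powRrM mulN1r powRN.
  by apply: ger1_powR => //; rewrite divr_gt0//= ler_pdivrMr// mul1r.
have h1 : a / (a + b) <= a `^ q / (a + b) `^ q by rewrite part// lerDl ltW.
have h2 : b / (a + b) <= b `^ q / (a + b) `^ q by rewrite part// lerDr ltW.
rewrite -[leLHS]mul1r -ler_pdivlMr ?powR_gt0// mulrDl.
apply: le_trans (lerD h1 h2); rewrite -mulrDl divff// gt_eqF//.
Qed.

Lemma poweR_le (x y : \bar R) (r : R) : 0 <= r -> (0 <= x)%E -> (x <= y)%E ->
  (x `^ r <= y `^ r)%E.
Proof.
move=> r0 x0 xy; apply: gt0_ler_poweR => //; rewrite in_itv/= leey andbT//.
exact: le_trans xy.
Qed.

Lemma integral_probability_cst d (T : measurableType d) (P : probability T R)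
  (c : R) : (\int[P]_y c%:E = c%:E)%E.
Proof.
rewrite (integral_cst P measurableT) -[RHS]mule1.
by congr (_ * _)%E; exact: probability_setT.
Qed.

Lemma ge0_le_integralD_cst d (T : measurableType d) (P : probability T R)
  (k u : T -> \bar R) (c : R) : 0 <= c ->
  measurable_fun setT k -> measurable_fun setT u ->
  (forall x, 0 <= k x)%E -> (forall x, 0 <= u x)%E ->
  (forall x, k x <= u x + c%:E)%E ->
  (\int[P]_x k x <= \int[P]_x u x + c%:E)%E.
Proof.
move=> c0 mk mu k0 u0 kuc; rewrite -[X in (_ <= _ + X)%E](integral_probability_cst P).
rewrite -ge0_integralD//; apply: ge0_le_integral => //.
by apply: emeasurable_funD => //; exact: measurable_cst.
Qed.

Lemma ln_le_powR (a b q : R) : 0 < a -> 0 < b -> ln a <= q * ln b -> a <= b `^ q.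
Proof. by move=> a0 b0; rewrite -ln_powR ler_ln ?posrE// powR_gt0. Qed.

Context {n : nat}.
Local Notation E := (n.-tuple R).
Variable alpha : R.
Hypotheses (n_gt0 : (0 < n)%N) (alpha02 : 0 < alpha < 2).
Local Notation law t0 := (stable_law n_gt0 alpha02 t0).
Local Opaque stable_law.

(** The bounded case applied to [min f (N + 1) + 1 / (N + 1)]. On the left the
truncations [min f (N + 1)] alone are kept, and they increase to [f]; on the
right the added constant costs at most its power [q2] by subadditivity, which
tends to 0. *)
Lemma reverse_hypercontractivity (A r s q1 q2 : R)
  (A0 : 0 < A) (r0 : 0 < r) (s0 : 0 < s) (f : E -> R) :
  A = r + s -> 0 < q1 < 1 -> 0 < q2 < 1 ->
  (1 - q2) * q1 * r = q2 * (1 - q1) * A ->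
  measurable_fun setT f -> (forall x, 0 < f x) ->
  ((\int[law A0]_x (f x `^ q1)%:E) `^ q1^-1 <=
   (\int[law r0]_z ((\int[law s0]_y (f (addt z y))%:E) `^ q2)) `^ q2^-1)%E.
Proof.
move=> AE q101 q201 hq mf f0.
have /andP[q10 q11] := q101; have /andP[q20 q21] := q201.
have mact := @measurable_act_addt R n.
pose U z := (\int[law s0]_y (f (addt z y))%:E)%E.
pose e N : R := N.+1%:R^-1.
have e0 N : 0 < e N by rewrite invr_gt0.
pose g N x := Num.min (f x) N.+1%:R.
pose h N x := g N x + e N.
have g0 N x : 0 < g N x by rewrite lt_min f0 ltr0n.
have mg N : measurable_fun setT (g N) by exact: measurable_minr.
have bh N : bounded_pos (h N).
  split; first exact: measurable_funD.
  exists (e N), (N.+1%:R + e N); split => // x.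
  by rewrite lerDr ltW//= lerD2r ge_min lexx orbT.
have mact_f : measurable_fun setT (fun zy : E * E => (f (addt zy.1 zy.2))%:E).
  by apply/measurable_EFinP; exact: measurableT_comp mf mact.
have mU : measurable_fun setT U.
  apply: (measurable_fun_fubini_tonelli_F (fun zy : E * E => (f (addt zy.1 zy.2))%:E) mact_f).
  by move=> zy; rewrite lee_fin ltW.
have U0 z : (0 <= U z)%E by apply: integral_ge0 => y _; rewrite lee_fin ltW.
pose Y := (\int[law r0]_z (U z `^ q2))%E.
have Y0 : (0 <= Y)%E by apply: integral_ge0 => z _; exact: poweR_ge0.
change ((\int[law A0]_x (f x `^ q1)%:E) `^ q1^-1 <= Y `^ q2^-1)%E.
have RintE t (t0 : 0 < t) (k : E -> R) : bounded_pos k ->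
    ((\int[law t0]_x k x)%:E = \int[law t0]_x (k x)%:E)%E.
  exact: EFin_Rintegral_bounded_pos.
pose H N := avg (law s0) addt (h N).
have bH N : bounded_pos (H N) by exact: bounded_pos_avg.
have HU N z : ((H N z)%:E <= U z + (e N)%:E)%E.
  have bhz := bounded_pos_act z mact (bh N).
  rewrite /H /avg RintE//.
  apply: ge0_le_integralD_cst; first exact: ltW.
  - by apply/measurable_EFinP; exact: bounded_pos_measurable bhz.
  - exact: (measurableT_comp mact_f (measurable_pair1 z)).
  - by move=> y; rewrite lee_fin ltW// (bounded_pos_gt0 _ bhz).
  - by move=> y; rewrite lee_fin ltW.
  - by move=> y; rewrite -EFinD lee_fin lerD2r ge_min lexx.
have HY N : ((\int[law r0]_z (H N z `^ q2))%:E <= Y + (e N `^ q2)%:E)%E.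
  have bHq := bounded_pos_powR q2 (bH N).
  rewrite RintE//.
  apply: ge0_le_integralD_cst; first exact: powR_ge0.
  - by apply/measurable_EFinP; exact: bounded_pos_measurable bHq.
  - exact: (measurableT_comp (measurable_poweR q2) mU).
  - by move=> z; rewrite lee_fin powR_ge0.
  - by move=> z; exact: poweR_ge0.
  - move=> z; have := HU N z; have := U0 z.
    case: (U z) => [u||]; last by [].
      rewrite lee_fin => u0; rewrite -EFinD lee_fin => Hu.
      rewrite poweR_EFin -EFinD lee_fin.
      apply: le_trans (powR_subadditive u0 (e0 N) _); last by rewrite q20 ltW.
      apply: ge0_ler_powR => //; rewrite ?nnegrE ?(ltW q20)//.
        by rewrite ltW// (bounded_pos_gt0 _ (bH N)).
      by rewrite addr_ge0// ltW.
    by move=> _ _; rewrite poweRyr ?gt_eqF// addye// leey.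
have step N : (\int[law A0]_x (g N x `^ q1)%:E <=
    (Y + (e N `^ q2)%:E) `^ (q1 / q2))%E.
  have bhq := bounded_pos_powR q1 (bh N).
  have bHq := bounded_pos_powR q2 (bH N).
  apply: (@le_trans _ _ ((\int[law A0]_x (h N x `^ q1))%:E)).
    rewrite (RintE _ A0 _ bhq); apply: ge0_le_integral; first exact: measurableT.
    - by move=> x _; rewrite lee_fin powR_ge0.
    - apply/measurable_EFinP; exact: (measurableT_comp (measurable_powR q1) (mg N)).
    - by apply/measurable_EFinP; exact: bounded_pos_measurable bhq.
    - move=> x _; rewrite lee_fin; apply: ge0_ler_powR; rewrite ?nnegrE ?(ltW q10)//.
      + exact: ltW.
      + by rewrite ltW// (bounded_pos_gt0 _ (bh N)).
      + by rewrite lerDl ltW.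
  have p1 := Rintegral_bounded_pos_gt0 (law A0) bhq.
  have p2 := Rintegral_bounded_pos_gt0 (law r0) bHq.
  have le1 := ln_le_powR p1 p2 (bounded_reverse_hypercontractivity
    n_gt0 alpha02 A0 r0 s0 AE q101 q201 hq (bh N)).
  apply: (@le_trans _ _ ((\int[law r0]_z (H N z `^ q2))%:E `^ (q1 / q2))%E).
    by rewrite poweR_EFin lee_fin.
  apply: poweR_le (HY N); first by rewrite divr_ge0 ?ltW.
  by rewrite lee_fin ltW.
(* both sides now pass to the limit, unless the bound is infinite *)
case YE : Y Y0 => [y||] y0; last by [].
  rewrite lee_fin in y0.
  have lim1 : (\int[law A0]_x (g N x `^ q1)%:E)%E @[N --> \oo] -->
      (\int[law A0]_x (f x `^ q1)%:E)%E.
    have -> : (\int[law A0]_x (f x `^ q1)%:E =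
        \int[law A0]_x limn (fun N => (g N x `^ q1)%:E))%E.
      apply: eq_integral => x _; apply/esym/cvg_lim => //.
      apply: cvg_near_cst; have fV0 : 0 < (f x)^-1 by rewrite invr_gt0.
      have [N0 _ N0P] := near_infty_natSinv_lt (PosNum fV0).
      exists N0 => // N /N0P/=; rewrite ltf_pV2 ?posrE// => /ltW fN.
      by rewrite /g (min_idPl fN).
    apply: (@cvg_monotone_convergence _ _ R (law A0) setT measurableT
      (fun N x => (g N x `^ q1)%:E)).
    - move=> N; apply/measurable_EFinP.
      exact: (measurableT_comp (measurable_powR q1) (mg N)).
    - by move=> N x _; rewrite lee_fin powR_ge0.
    - move=> x _ M N MN; rewrite lee_fin.
      apply: ge0_ler_powR; rewrite ?nnegrE ?(ltW q10) ?(ltW (g0 _ _))//.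
      by rewrite le_min ge_min lexx/= ge_min ler_nat ltnS MN orbT.
  have lim2 : ((y + e N `^ q2) `^ (q1 / q2))%:E @[N --> \oo] --> (y `^ (q1 / q2))%:E.
    apply: cvg_EFin; first exact: nearW.
    apply: cvg_powR_base; rewrite ?divr_gt0//.
      by move=> N; rewrite addr_ge0// powR_ge0.
    rewrite -[X in _ --> X]addr0; apply: cvgD; first exact: cvg_cst.
    rewrite -[X in _ --> X](@powR0 R q2) ?gt_eqF//.
    apply: cvg_powR_base => //; first by move=> N; exact: ltW.
    exact: cvg_harmonic.
  have le_lim : (\int[law A0]_x (f x `^ q1)%:E <= (y `^ (q1 / q2))%:E)%E.
    rewrite -(cvg_lim _ lim1)// -(cvg_lim _ lim2)//.
    apply: lee_lim; [by apply/cvg_ex; eexists; exact: lim1|by apply/cvg_ex; eexists; exact: lim2|].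
    by apply: nearW => N; have := step N; rewrite YE -EFinD poweR_EFin.
  have -> : (y%:E `^ q2^-1 = (y `^ (q1 / q2))%:E `^ q1^-1)%E.
    rewrite !poweR_EFin -powRrM; congr ((y `^ _)%:E); field.
    by rewrite !gt_eqF.
  apply: poweR_le le_lim; first by rewrite invr_ge0 ltW.
  by apply: integral_ge0 => x _; rewrite lee_fin powR_ge0.
by rewrite poweRyr ?invr_neq0 ?gt_eqF// leey.
Qed.

End unbounded_hypercontractivity.

(** * The Levy-Ornstein-Uhlenbeck semigroup *)

Section levy_ornstein_uhlenbeck.
Context {R : realType} {n : nat}.
Local Notation E := (n.-tuple R).
Local Notation W := (@lebesgue_tuple R n).
Variable alpha : R.
Hypotheses (n_gt0 : (0 < n)%N) (alpha02 : 0 < alpha < 2).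
Local Notation K := (@stable_density R n alpha).
Local Notation law t0 := (stable_law n_gt0 alpha02 t0).
Local Opaque stable_law stable_density.

Let alpha0 : 0 < alpha. Proof. by have /andP[] := alpha02. Qed.

(** If [X] has law [K s] then [lam X] has law [K (lam^alpha s)]. *)
Lemma integral_scalet_stable (s lam : R) (ls0 : 0 < lam `^ alpha * s)
  (g : E -> \bar R) : 0 < s -> 0 < lam ->
  measurable_fun setT g -> (forall x, 0 <= g x)%E ->
  (\int[W]_x (g (scalet lam x) * (K s x)%:E) = \int[law ls0]_x g x)%E.
Proof.
move=> s0 lam0 mg g0.
have K0 := @stable_density_ge0 R n alpha n_gt0 alpha02 _ ls0.
have mK := @measurable_stable_density R n alpha n_gt0 alpha02 _ ls0.
have mgK : measurable_fun setT (fun x => g x * (K (lam `^ alpha * s) x)%:E)%E.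
  by apply: emeasurable_funM => //; apply/measurable_EFinP; exact: mK.
have gK0 x : (0 <= g x * (K (lam `^ alpha * s) x)%:E)%E.
  by apply: mule_ge0; rewrite ?lee_fin.
apply: eq_trans (esym (ge0_integral_stable_law n_gt0 alpha02 ls0 mg g0)).
apply: eq_trans (ge0_integral_afft zerot (lt0r_neq0 lam0) mgK gK0).
rewrite gtr0_norm//.
have mS : measurable_fun setT (fun x : E => afft lam zerot x) by exact: measurable_afft_y.
apply: eq_trans (ge0_integralZl _ measurableT (measurableT_comp mgK mS)
  (fun x _ => gK0 _) _); last first.
  by rewrite lee_fin exprn_ge0// ltW.
apply: eq_integral => x _ /=.
by rewrite -scalet_afft (stable_density_scale n_gt0 alpha02 x s0 lam0) EFinM muleCA.
Qed.

Lemma Lq_stableE (q : R) (A0 : 0 < alpha^-1) (g : E -> \bar R) :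
  measurable_fun setT g -> (forall x, 0 <= g x)%E ->
  Lq_stable alpha q g = ((\int[law A0]_x (g x `^ q)) `^ q^-1)%E.
Proof.
move=> mg g0; rewrite /Lq_stable.
rewrite ge0_integral_stable_law.
- by congr (_ `^ _)%E; apply: eq_integral => x _; rewrite gee0_abs.
- exact: (measurableT_comp (measurable_poweR q) mg).
- by move=> x; exact: poweR_ge0.
Qed.

Lemma levy_semigroupE (s : R) (s0 : 0 < s) (g : E -> \bar R) (z : E) :
  measurable_fun setT g -> (forall x, 0 <= g x)%E ->
  levy_semigroup alpha s g z = (\int[law s0]_y g (addt z y))%E.
Proof.
move=> mg g0; rewrite /levy_semigroup (gt_eqF s0).
exact: ge0_integral_stable_subt.
Qed.

(** At time 0 the Levy operator is the identity by convention. *)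
Lemma LOU_semigroup0 (g : E -> \bar R) : LOU_semigroup alpha 0 g = g.
Proof.
apply/funext => x; rewrite /LOU_semigroup /levy_semigroup.
rewrite mulr0 oppr0 expR0 subrr mul0r eqxx; congr g.
by apply: eq_from_tnth => i; rewrite tnth_mktuple mul1r.
Qed.

(** The dilation by [exp(- t)] turns the invariant law into the law at time
[r]. *)
Lemma Lq_stable_LOU (r s t q : R) (r0 : 0 < r) (s0 : 0 < s)
  (g : E -> \bar R) :
  r = expR (- (alpha * t)) / alpha -> s = (1 - expR (- (alpha * t))) / alpha ->
  measurable_fun setT g -> (forall x, 0 <= g x)%E ->
  Lq_stable alpha q (LOU_semigroup alpha t g) =
  ((\int[law r0]_z ((\int[law s0]_y g (addt z y)) `^ q)) `^ q^-1)%E.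
Proof.
move=> rE sE mg g0.
pose U z := (\int[law s0]_y g (addt z y))%E.
have mgU : measurable_fun setT (fun zy : E * E => g (addt zy.1 zy.2)).
  exact: measurableT_comp mg (@measurable_act_addt R n).
have mU : measurable_fun setT U.
  exact: (measurable_fun_fubini_tonelli_F (fun zy : E * E => g (addt zy.1 zy.2)) mgU).
have U0 z : (0 <= U z)%E by apply: integral_ge0.
have lamE : r = expR (- t) `^ alpha * alpha^-1.
  by rewrite rE -expRM mulNr (mulrC t).
clear rE; subst r.
have LE x : LOU_semigroup alpha t g x = U (scalet (expR (- t)) x).
  by rewrite /LOU_semigroup -sE; exact: levy_semigroupE.
rewrite /Lq_stable; congr (_ `^ _)%E.
rewrite -integral_scalet_stable ?expR_gt0 ?invr_gt0//; last first.
- by move=> x; exact: poweR_ge0.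
- exact: (measurableT_comp (measurable_poweR q) mU).
by apply: eq_integral => x _; rewrite LE gee0_abs.
Qed.

End levy_ornstein_uhlenbeck.

Theorem corollary6p3 (R : realType) (n : nat) (alpha : R)
    (n_ge1 : (1 <= n)%N) (alpha_gt0 : 0 < alpha) (alpha_lt2 : alpha < 2)
    (f : n.-tuple R -> R) (mf : measurable_fun [set: n.-tuple R]%classic f)
    (f_gt0 : forall x, 0 < f x)
    (t q1 q2 : R) (t_ge0 : 0 <= t)
    (q2_gt0 : 0 < q2) (q2_le_q1 : q2 <= q1) (q1_lt1 : q1 < 1)
    (hq : q2 - 1 = q2 / q1 * (q1 - 1) * expR (alpha * t)) :
  (Lq_stable alpha q1 (EFin \o f) <=
   Lq_stable alpha q2 (LOU_semigroup alpha t (EFin \o f)))%E.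
Proof.
have alpha02 : 0 < alpha < 2 by rewrite alpha_gt0.
have q1_gt0 : 0 < q1 := lt_le_trans q2_gt0 q2_le_q1.
have q2_lt1 : q2 < 1 := le_lt_trans q2_le_q1 q1_lt1.
have hq' : (1 - q2) * q1 = q2 * (1 - q1) * expR (alpha * t).
  rewrite -(opprB q2) hq; field; exact: lt0r_neq0.
move: t_ge0; rewrite le_eqVlt => /predU1P[t0|t_gt0].
  rewrite -t0 mulr0 expR0 mulr1 in hq'.
  have -> : q1 = q2 by lra.
  by rewrite -t0 LOU_semigroup0.
pose th := expR (- (alpha * t)).
have th1 : th < 1 by rewrite expR_lt1 oppr_lt0 mulr_gt0.
have A0 : 0 < alpha^-1 by rewrite invr_gt0.
have r0 : 0 < th / alpha by rewrite divr_gt0 ?expR_gt0.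
have s0 : 0 < (1 - th) / alpha by rewrite divr_gt0 ?subr_gt0.
have mEf : measurable_fun setT (EFin \o f) by exact/measurable_EFinP.
have Ef0 x : (0 <= (EFin \o f) x)%E by rewrite lee_fin ltW.
rewrite (Lq_stableE n_ge1 alpha02 q1 A0 mEf Ef0).
rewrite (Lq_stable_LOU n_ge1 alpha02 q2 r0 s0 erefl erefl mEf Ef0).
apply: reverse_hypercontractivity => //.
- by rewrite -mulrDl addrC subrK mul1r.
- by rewrite q1_gt0.
- by rewrite q2_gt0.
- rewrite hq' /th expRN; field.
  by rewrite !gt_eqF// expR_gt0.
Qed.
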